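(* Let $p \geq 2$ be a prime number and let $K_v$ be the completion of a number field $K$ at a place $v \mid p$. Suppose that $K_v$ contains $\mu_p$ and a subfield $k_{(v)}$ of $\mathbb{Q}_p(\mu_{p^\infty})$ of degree $p^m$ over $\mathbb{Q}_p(\mu_p)$, where $m \geq 0$. Let $\alpha \in K_v^\times$ be a local unit such that the Kummer extension $K_v(\sqrt[p]{\alpha})/K_v$ is unramified. Then $$\mathrm{N}_{K_v/\mathbb{Q}_p}(\alpha) \equiv 1 \bmod (p^{m+2}).$$ Moreover, if $p = 2$ and $k_{(v)} = \mathbb{Q}_2^{(m)}$, $m \geq 0$, and if at least one of the following two conditions holds: (i) $\alpha \in K_v^{\times 2}$, (ii) the ramification index $e_v(K_v/k_{(v)})$ of $K_v/k_{(v)}$ is even, then $$\mathrm{N}_{K_v/\mathbb{Q}_2}(\alpha) \equiv 1 \bmod (4\cdot 2^{m+1}).$$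
   Context: $\mu_n$ denotes the group of $n$th roots of unity, and $\mathbb{Q}_p(\mu_{p^\infty})$ is the extension of $\mathbb{Q}_p$ generated by all roots of unity of $p$-power order (all fields lie in a fixed algebraic closure of $\mathbb{Q}_p$). $\mathrm{N}_{K_v/\mathbb{Q}_p}$ is the local field norm, and the congruences are in $\mathbb{Z}_p$. A local unit is an element of valuation $0$. The Kummer extension $K_v(\sqrt[p]{\alpha})/K_v$ is allowed to be trivial (i.e. $\alpha \in K_v^{\times p}$). For $p=2$ and $m \geq 0$, $\mathbb{Q}_2^{(m)} := \mathbb{Q}_2\,\mathbb{Q}^{(m)}$, where $\mathbb{Q}^{(m)}$ is the subfield of degree $2^m$ over $\mathbb{Q}$ of the cyclotomic $\mathbb{Z}_2$-extension of $\mathbb{Q}$ (equivalently, $\mathbb{Q}^{(m)}$ is the maximal real subfield of $\mathbb{Q}(\mu_{4\cdot 2^m})$); in particular $\mathbb{Q}_2^{(0)} = \mathbb{Q}_2$. *)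

(* Defs.v *)
From HB Require Import structures.
From mathcomp Require Import all_boot all_order all_algebra all_field.

Set Implicit Arguments.
Unset Strict Implicit.
Unset Printing Implicit Defensive.

Import Order.TTheory GRing.Theory Num.Theory.
Local Open Scope ring_scope.

(* Normalized discrete valuations, written additively.  The value of [v] at 0  *)
(* is irrelevant (it stands for +oo): every axiom and every use below only     *)
(* constrains [v] away from 0.                                                 *)
Record is_valuation (F : fieldType) (v : F -> int) : Prop := IsValuation {
  valuationM : forall x y, x != 0 -> y != 0 -> v (x * y) = v x + v y;
  valuationD : forall x y, x != 0 -> y != 0 -> x + y != 0 ->
    Num.min (v x) (v y) <= v (x + y);
  valuation_normalized : exists2 x, x != 0 & v x = 1
}.

(* v x >= n, with v 0 = +oo *)
Definition val_ge (F : fieldType) (v : F -> int) (n : int) (x : F) : bool :=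
  (x == 0) || (n <= v x).

Definition val_ring (F : fieldType) (v : F -> int) : {pred F} :=
  fun x => val_ge v 0 x.

Definition is_local_unit (F : fieldType) (v : F -> int) (x : F) : Prop :=
  x != 0 /\ v x = 0.

Definition val_cauchy (F : fieldType) (v : F -> int) (u : nat -> F) : Prop :=
  forall n : int, exists N : nat, forall i j : nat,
    (N <= i)%N -> (N <= j)%N -> val_ge v n (u i - u j).

Definition val_limit (F : fieldType) (v : F -> int) (u : nat -> F) (l : F) :
    Prop :=
  forall n : int, exists N : nat, forall i : nat,
    (N <= i)%N -> val_ge v n (u i - l).

(* (E, w), together with f : F -> E, is the completion of F at the discrete    *)
(* valuation v; it is unique up to a unique isomorphism of valued F-fields.    *)
Record is_completion (F E : fieldType) (v : F -> int) (w : E -> int)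
    (f : {rmorphism F -> E}) : Prop := IsCompletion {
  completion_valuation : is_valuation w;
  completion_extends : forall x, x != 0 -> w (f x) = v x;
  completion_dense : forall (y : E) (n : int), exists x, val_ge w n (y - f x);
  completion_complete : forall u, val_cauchy w u -> exists l, val_limit w u l
}.

Definition padic_val (p : nat) (x : rat) : int :=
  (logn p `|numq x|%N)%:Z - (logn p `|denq x|%N)%:Z.

(* w restricts along f : F -> E to e * v; v and w being normalized, e is the   *)
(* index of the value group of F in that of E.                                 *)
Definition is_ramification_index (F E : fieldType) (v : F -> int)
    (w : E -> int) (f : F -> E) (e : nat) : Prop :=
  (0 < e)%N /\ forall x, x != 0 -> w (f x) = e%:Z * v x.

(* Only meant for v complete with finite residue field: there is then exactly  *)
(* one normalized valuation on L above v, and the residue field extension is   *)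
(* automatically separable, so that unramified means e(L/F) = 1.               *)
Definition is_unramified (F : fieldType) (v : F -> int) (L : fieldExtType F) :
    Prop :=
  exists w : L -> int, is_valuation w /\
    is_ramification_index v w (in_alg L) 1.

Definition field_norm (F : fieldType) (L : fieldExtType F) (x : L) : F :=
  \det (passmx.mxof (vbasis {:L}) (vbasis {:L}) (amulr x)).

Definition congr_mod (F : fieldType) (v : F -> int) (d x y : F) : Prop :=
  exists2 z, z \in val_ring v & x - y = d * z.

(* the subfield of E generated by A *)
Definition gen_subfield (E : fieldType) (A : E -> Prop) (x : E) : Prop :=
  forall S : {pred E}, divring_closed S -> (forall y, A y -> y \in S) ->
    x \in S.

(* F(mu_{p^oo}) inside C, where i : F -> C is an algebraic closure of F *)
Definition in_cyclotomic_tower (F C : fieldType) (i : F -> C) (p : nat) :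
    C -> Prop :=
  gen_subfield (fun y => (exists a, y = i a) \/
                         (exists n : nat, y ^+ (p ^ n) = 1)).

(* Q^(m), as the maximal real subfield of Q(mu_{4 * 2^m}) *)
Definition in_Q_layer (m : nat) (x : algC) : Prop :=
  gen_subfield (fun y : algC => y ^+ (4 * 2 ^ m) = 1) x /\ x \is Num.real.

(* The compositum F Q^(m) inside C; since Q^(m) is normal over Q, it does not  *)
(* depend on the embedding [iota] of the algebraic numbers into C.             *)
Definition in_layer (F C : fieldType) (i : F -> C) (iota : algC -> C)
    (m : nat) : C -> Prop :=
  gen_subfield (fun y => (exists a, y = i a) \/
                         (exists2 x, in_Q_layer m x & y = iota x)).

(* Main.v *)
(* Put lambda = 1 - zeta, and let O be the ring of integers of Qpbar.             *)
(* Since the residue field of K_v is perfect, successive approximation of beta    *)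
(* in the unramified extension L gives alpha = x^p (1 + p lambda c), with x a     *)
(* unit and c integral.                                                           *)
(*                                                                                *)
(* An integral element of k lies in some Z_p[z_(n+1)], z_n being a primitive      *)
(* p^n-th root of unity with z_(n+1)^p = z_n, so the norms to k of the two        *)
(* factors have the form f(z_(n+1)) and 1 + p lambda f(z_(n+1)).                  *)
(* With F_n(f) the product of the f(z_n^a), a < p^n, the norm of f(z_(n+1)) from  *)
(* Q_p(z_(n+1)) to Q_p is F_(n+1)(f) / F_n(f), and it is N(f(z_(n+1)))^(p^(n-m))  *)
(* for the norm N from k.  Dwork's congruence F_(n+1)(f) = F_n(f) mod p^(n+1)     *)
(* bounds the first factor.  For the second one, put                              *)
(* g = 1 + p (1 - X^(p^n)) f: then F_n(g) = 1, g(z_(n+1)) = 1 + p lambda          *)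
(* f(z_(n+1)), and g = 1 mod p gives F_(n+1)(g) = 1 mod p^(n+2).  It remains to   *)
(* extract p-power roots in 1 + p Z_p, respectively 1 + 4 Z_2.                    *)
(*                                                                                *)
(* If k = Q_2^(m), then k = Q_2(theta) with theta = 2 cos (2 pi / 2^(m+2)), and   *)
(* the norm of f(theta) is the value at 0 of the m-th iterate of the operator     *)
(* dnorm, where (dnorm f)(y^2 - 2) = f(y) f(-y).  Congruences for dnorm show that *)
(* N(u)^2 = 1 mod 2^(m+3) for a unit u of k, and N(1 + 4 y) = 1 mod 2^(m+3) for y *)
(* in the maximal ideal.  If e(K_v/k) is even, a uniformizer of k is a square     *)
(* times 1 + z with w(z) > 0, whence 1 + 4 c is a product of 1 + 4 z' and         *)
(* 1 + (4 / varpi) r^2 with w(z') > 0 and w(r) > 0; both have norms to k of the   *)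
(* form 1 + 4 y, the second because the power sum of the squares of the           *)
(* conjugates of r is a square in k modulo 2.                                     *)
Require Import Defs.
From HB Require Import structures.
From mathcomp Require Import all_boot all_order all_algebra all_field perm.
From mathcomp.classical Require Import boolp.
From mathcomp Require Import zify ring.

Set Implicit Arguments.
Unset Strict Implicit.
Unset Printing Implicit Defensive.

Import Order.TTheory GRing.Theory Num.Theory.
Local Open Scope ring_scope.

(** * Characteristic polynomials and norms in towers *)

(** Unramifiedness enters through [primary_decomposition] only: alpha = x^p (1 + p (1 - zeta) c)
    with x a unit and c integral. Norms being multiplicative, N(x)^p and N(1 + p (1 - zeta) c) are
    treated separately, and both are pushed down to k by transitivity ([field_norm_tower]).
    Conjugates of integral elements are integral ([conjugate_roots]), so the norm to k of a unit is
    a unit and that of 1 + s y has the form 1 + s y'.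

    Inside k one computes with polynomials. The cyclotomic polynomials shifted by 1 are Eisenstein,
    so an integral u in k equals f(z_(n+1)) with f over Z_p and n as large as desired
    ([cyclo_integral], [integral_level]). Splitting the p^(n+1)-th roots of unity into primitive
    ones and p^n-th roots of unity gives F_(n+1)(f) = N(u)^(p^(n-m)) F_n(f) ([norm_level]). Now
    F_n(f) is the value at 1 of the n-th iterate of Dwork's operator [norm_op], which sharpens a
    congruence modulo p^k to one modulo p^(k+1) ([norm_op_congr]) and is the identity modulo p on
    polynomials over Z_p ([norm_op_frobenius]). This yields [norm_unit_congr] and
    [norm_principal_level]; each extraction of a p-th root close to 1 then costs one power of p
    ([val_ge_exppn]).

    For k = Q_2^(m) the missing factor 2 is gained by replacing the p-th power map with y -> y^2 -
    2, whose norm operator is [dnorm]. The orbit 0, -2, 2, 2, ... of 0 ends in a fixed point, and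
    evaluation there improves the congruence ([iter_dnorm_sqr]). This settles alpha = b^2. In the
    case of even ramification, [rel_norm_1_add4] writes the norm to k of 1 + 4 c as a product of
    elements 1 + 4 y with y in the maximal ideal, and [norm_1_add4_theta] applies to these.

    Norms are determinants throughout. Galois theory is replaced by one principle: a characteristic
    polynomial dividing a power of an irreducible polynomial is itself a power of it. *)

Lemma coef_prod_top (R : comNzRingType) (n d : nat) (f : 'I_n -> {poly R}) :
  (forall i, (size (f i) <= d.+1)%N) ->
  (size (\prod_i f i)%R <= (n * d).+1)%N /\
  (\prod_i f i)`_(n * d) = \prod_i (f i)`_d.
Proof.
elim: n f => [|n IH] f hf; first by rewrite !big_ord0 size_poly1 coef1.
rewrite !big_ord_recl; have [|h1 h2] := IH (fun i => f (lift ord0 i)).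
  by move=> i; apply: hf.
set g := \prod_i f (lift ord0 i) in h1 h2 *.
have hf0 := hf ord0; split.
  by apply: leq_trans (size_polyMleq _ _) _; rewrite mulSn; lia.
have hd : (d < (d + n * d).+1)%N by rewrite ltnS leq_addr.
rewrite mulSn coefM (bigD1 (Ordinal hd)) //= addKn h2 [X in _ + X]big1 ?addr0 // => i.
rewrite -(inj_eq val_inj) /= => hi.
have [lti|gti|eqi] := ltngtP (i : nat) d; last by rewrite eqi eqxx in hi.
  by rewrite [g`_ _]nth_default ?mulr0 //; apply: leq_trans h1 _; lia.
by rewrite nth_default ?mul0r //; apply: leq_trans hf0 _.
Qed.

Lemma coef_det_top (R : comNzRingType) (n d : nat) (A : 'M[{poly R}]_n) :
  (forall i j, (size (A i j) <= d.+1)%N) ->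
  (size (\det A) <= (n * d).+1)%N /\
  (\det A)`_(n * d) = \det (\matrix_(i, j) (A i j)`_d).
Proof.
move=> hA; split.
  apply/leq_sizeP => k hk; rewrite /determinant coef_sum big1 // => s _.
  have [|h _] := @coef_prod_top R n d (fun i => A i (s i)); first by move=> i.
  by rewrite -signr_odd mulr_sign; case: odd; rewrite ?coefN nth_default
    ?oppr0 // (leq_trans h).
rewrite /determinant coef_sum; apply: eq_bigr => s _.
have [|_ h] := @coef_prod_top R n d (fun i => A i (s i)); first by move=> i.
have -> : \prod_i (\matrix_(i, j) (A i j)`_d) i (s i) = \prod_i (A i (s i))`_d.
  by apply: eq_bigr => i _; rewrite mxE.
by rewrite -h; case: (odd_perm s); rewrite ?expr0 ?expr1 ?mul1r ?mulN1r ?coefN.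
Qed.

Lemma det_monic_mx (R : comNzRingType) (n d : nat) (A : 'M[{poly R}]_n) :
  (forall i j, (size (A i j) <= d.+1)%N) ->
  \matrix_(i, j) (A i j)`_d = 1%:M ->
  \det A \is monic /\ size (\det A) = (n * d).+1.
Proof.
move=> hA h1; have [hs hc] := coef_det_top hA; rewrite h1 det1 in hc.
have hsz : size (\det A) = (n * d).+1.
  apply/eqP; rewrite eqn_leq hs /= ltnNge; apply/negP => hle.
  by move: hc; rewrite nth_default // => /eqP; rewrite eq_sym oner_eq0.
by split; rewrite // monicE lead_coefE hsz hc.
Qed.

Lemma monic_irreducible_dvd_exp (F : fieldType) (m g : {poly F}) (s : nat) :
  irreducible_poly m -> m \is monic -> g \is monic -> g %| m ^+ s ->
  exists t, g = m ^+ t.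
Proof.
move=> irr mm; elim: s g => [|s IH] g mg.
  rewrite expr0 dvdp1 size_poly_eq1 => /eqpP [[a b] /= /andP[a0 b0] hab].
  exists 0%N; rewrite expr0; apply/eqP; rewrite -eqp_monic ?monic1 //.
  by apply/eqpP; exists (a, b); rewrite ?a0.
move=> hd; have [cop|ncop] := boolP (coprimep g m).
  by apply: IH => //; move: hd; rewrite exprS Gauss_dvdpr.
have hm : m %| g.
  have [_ hirr] := irr; have := hirr (gcdp g m).
  rewrite coprimep_def in ncop => /(_ ncop (dvdp_gcdr _ _)) e.
  by rewrite -(eqp_dvdl _ e) dvdp_gcdl.
have m0 := monic_neq0 mm.
have hg := divpK hm; have mq : g %/ m \is monic.
  by rewrite -(monicMr _ mm) hg.
have [|t ht] := IH _ mq; last by exists t.+1; rewrite exprSr -ht hg.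
by rewrite -(dvdp_mul2r _ _ m0) hg -exprSr.
Qed.

Section PolyRep.
Variables (F E : fieldType) (n : nat) (rho : {rmorphism E -> 'M[F]_n}).

(** The determinant of this matrix plays the role of the norm from E[X] to F[X]. *)
Definition poly_rep (Q : {poly E}) : 'M[{poly F}]_n :=
  \matrix_(i, j) \poly_(l < size Q) rho Q`_l i j.

Lemma coef_poly_rep Q i j l : (poly_rep Q i j)`_l = rho Q`_l i j.
Proof.
rewrite mxE coef_poly; case: ltnP => // h.
by rewrite nth_default // raddf0 mxE.
Qed.

Lemma poly_repM P Q : poly_rep (P * Q) = poly_rep P *m poly_rep Q.
Proof.
apply/matrixP => i j; apply/polyP => l; rewrite coef_poly_rep mxE coef_sum.
under [RHS]eq_bigr do rewrite coefM.
rewrite exchange_big coefM raddf_sum summxE; apply: eq_bigr => s _ /=.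
rewrite rmorphM [in LHS]mxE; apply: eq_bigr => h _.
by rewrite !coef_poly_rep.
Qed.

Lemma poly_repXsubC x : poly_rep ('X - x%:P) = char_poly_mx (rho x).
Proof.
apply/matrixP => i j; apply/polyP => l; rewrite coef_poly_rep !mxE.
rewrite !coefB coefX !coefC coefMn coefX.
case: l => [|[|l]] /=; rewrite ?sub0r ?subr0 ?raddf0 ?mxE ?mul0rn ?sub0r
  ?rmorphN ?rmorph1 ?mxE ?subr0 //.
Qed.

Lemma poly_rep_monic Q : Q \is monic ->
  \det (poly_rep Q) \is monic /\
  size (\det (poly_rep Q)) = (n * (size Q).-1).+1.
Proof.
move=> mQ; have Q0 : (0 < size Q)%N by rewrite size_poly_gt0 monic_neq0.
apply: det_monic_mx => [i j|].
  by rewrite mxE (prednK Q0) size_poly.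
apply/matrixP => i j; rewrite mxE coef_poly_rep -lead_coefE (monicP mQ).
by rewrite rmorph1.
Qed.

Lemma horner0_det_poly_rep Q : (\det (poly_rep Q)).[0] = \det (rho Q.[0]).
Proof.
rewrite -horner_evalE -det_map_mx; congr (\det _); apply/matrixP => i j.
by rewrite (horner_coef0 Q) -coef_poly_rep -horner_coef0 mxE.
Qed.

Variable f : {rmorphism F -> E}.
Hypothesis rho_scalar : forall a, rho (f a) = a%:M.

Lemma poly_rep_map (p : {poly F}) : poly_rep (map_poly f p) = p%:M.
Proof.
apply/matrixP => i j; apply/polyP => l; rewrite coef_poly_rep coef_map /=.
by rewrite rho_scalar !mxE coefMn.
Qed.

Lemma det_poly_rep_dvd (m : {poly F}) (Q : {poly E}) (s : nat) :
  Q %| map_poly f m ^+ s -> \det (poly_rep Q) %| m ^+ (s * n).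
Proof.
move=> /dvdpP [S hS]; have : \det (poly_rep (map_poly f m ^+ s)) =
  \det (poly_rep S) * \det (poly_rep Q) by rewrite hS poly_repM det_mulmx.
by rewrite -rmorphXn poly_rep_map det_scalar -exprM => ->; apply: dvdp_mull.
Qed.

Lemma char_poly_rep_dvd (m : {poly F}) x : root (map_poly f m) x ->
  char_poly (rho x) %| m ^+ n.
Proof.
rewrite -dvdp_XsubCl -[map_poly f m]expr1 => /det_poly_rep_dvd.
by rewrite poly_repXsubC mul1n.
Qed.

Lemma char_poly_rep_exp (m : {poly F}) x : irreducible_poly m -> m \is monic ->
  root (map_poly f m) x -> exists t, char_poly (rho x) = m ^+ t.
Proof.
move=> irr mm hx; apply: (monic_irreducible_dvd_exp irr mm (char_poly_monic _)).
exact: char_poly_rep_dvd hx.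
Qed.

End PolyRep.

Lemma monic_exp_size_inj (F : fieldType) (m : {poly F}) (s t : nat) :
  (1 < size m)%N -> m \is monic -> size (m ^+ s) = size (m ^+ t) -> s = t.
Proof.
move=> hm mm /(congr1 predn); rewrite !size_exp => /eqP.
rewrite eqn_pmul2l; first by move/eqP.
by rewrite -subn1 subn_gt0.
Qed.

(* Both characteristic polynomials of x (over F directly, or over E and then   *)
(* descended to F) are powers of the minimal polynomial of x, of equal degree. *)
Lemma det_rep_tower (F E K : fieldType) (f : {rmorphism F -> E})
    (g : {rmorphism E -> K}) (n1 n2 n3 : nat)
    (r1 : {rmorphism E -> 'M[F]_n1}) (r2 : {rmorphism K -> 'M[E]_n2})
    (r3 : {rmorphism K -> 'M[F]_n3}) (m : {poly F}) (x : K) :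
  (forall a, r1 (f a) = a%:M) -> (forall a, r2 (g a) = a%:M) ->
  (forall a, r3 (g (f a)) = a%:M) -> n3 = (n1 * n2)%N ->
  irreducible_poly m -> m \is monic -> root (map_poly (g \o f) m) x ->
  \det (r3 x) = \det (r1 (\det (r2 x))).
Proof.
move=> h1 h2 h3 e3 irr mm hx.
have [s hs] := @char_poly_rep_exp F K n3 r3 (g \o f) h3 m x irr mm hx.
have hx' : root (map_poly g (map_poly f m)) x by rewrite -map_poly_comp.
have hdvd := char_poly_rep_dvd h2 hx'.
have [mon sz] := poly_rep_monic r1 (char_poly_monic (r2 x)).
have [t ht] := monic_irreducible_dvd_exp irr mm mon (det_poly_rep_dvd h1 hdvd).
have est : s = t.
  apply: (@monic_exp_size_inj _ m) => //; first by case: irr.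
  by rewrite -hs -ht sz !size_char_poly /= e3.
(* Both polynomials are now the same power of m; their constant terms are the two determinants, up
   to the same sign. *)
have := horner0_det_poly_rep r1 (char_poly (r2 x)).
rewrite ht -est -hs !horner_coef0 !char_poly_det.
have -> : (-1) ^+ n2 * \det (r2 x) = f ((-1) ^+ n2) * \det (r2 x).
  by rewrite rmorphXn rmorphN1.
rewrite rmorphM h1 det_mulmx det_scalar -exprM mulnC -e3.
by move/(can_inj (signrMK _)).
Qed.

Section RegularRep.
Variables (F : fieldType) (L : fieldExtType F).

Definition reg_rep (x : L) : 'M[F]_(\dim {:L}) :=
  passmx.mxof (vbasis {:L}) (vbasis {:L}) (amulr x).

Let bL : basis_of {:L} (vbasis {:L}) := vbasisP _.

Fact reg_rep_zmod : zmod_morphism reg_rep.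
Proof. move=> x y; rewrite /reg_rep; have -> : amulr (x - y) = amulr x - amulr y.
  by apply/lfunP => z; rewrite add_lfunE opp_lfunE !lfunE /= mulrBr.
exact: (GRing.zmod_morphism_linear (passmx.mxof_linear _ _)). Qed.
HB.instance Definition _ := GRing.isZmodMorphism.Build _ _ reg_rep reg_rep_zmod.

Fact reg_rep_monoid : monoid_morphism reg_rep.
Proof.
split=> [|x y].
  rewrite /reg_rep; have -> : amulr (1 : L) = \1%VF.
    by apply/lfunP => z; rewrite lfunE id_lfunE /= mulr1.
  by rewrite passmx.mxof1 // (basis_free bL).
rewrite /reg_rep; have -> : amulr (x * y) = (amulr y \o amulr x)%VF.
  by apply/lfunP => z; rewrite comp_lfunE !lfunE /= mulrA.
exact: (passmx.mxof_comp _ _ bL).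
Qed.
HB.instance Definition _ := GRing.isMonoidMorphism.Build _ _ reg_rep
  reg_rep_monoid.

Lemma reg_rep_scalar a : reg_rep a%:A = a%:M.
Proof.
have -> : a%:M = a *: reg_rep 1 by rewrite rmorph1 scalemx1.
rewrite /reg_rep -[RHS](GRing.scalable_linear (passmx.mxof_linear _ _)).
congr passmx.mxof.
by apply/lfunP => z; rewrite !lfunE /= lfunE /= mulr1 -scalerAr mulr1.
Qed.

Lemma field_normE (x : L) : field_norm x = \det (reg_rep x).
Proof. by []. Qed.

Lemma field_normM (x y : L) : @field_norm F L (x * y) = field_norm x * field_norm y.
Proof. by rewrite !field_normE rmorphM det_mulmx. Qed.

Lemma field_norm1 : @field_norm F L 1 = 1.
Proof. by rewrite field_normE rmorph1 det1. Qed.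

Lemma field_normX (x : L) n : @field_norm F L (x ^+ n) = field_norm x ^+ n.
Proof.
elim: n => [|n IH]; first by rewrite !expr0 field_norm1.
by rewrite !exprS field_normM IH.
Qed.

Lemma min_poly_exists (x : L) :
  exists m : {poly F}, [/\ irreducible_poly m, m \is monic &
    root (map_poly (in_alg L) m) x].
Proof.
have /polyOver1P [m hm] := minPolyOver 1 x; exists m.
have sm : size m = (adjoin_degree 1 x).+1.
  by rewrite -(size_minPoly 1 x) hm size_map_poly.
have mm : m \is monic by rewrite -(map_monic (in_alg L)) -hm monic_minPoly.
split=> //; last by rewrite -hm root_minPoly.
split=> [|q q1 qm]; first by rewrite sm.
have : map_poly (in_alg L) q %| minPoly 1 x by rewrite hm dvdp_map.
move/(minPoly_irr (alg_polyOver 1 q)) => /orP[].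
  by rewrite hm eqp_map.
by move/eqp_size; rewrite size_map_poly size_poly1 => /eqP; rewrite (negPf q1).
Qed.

End RegularRep.

Section RelativeNorm.
Variables (F : fieldType) (L : fieldExtType F) (k : {subfield L}).

Definition rel_dim := \dim {: fieldOver k}.

(** [fieldOver k] is L viewed as an algebra over k; the regular representation is restated on L
    itself so that it is a morphism there. *)
Definition rel_rep (x : L) : 'M[subvs_of k]_rel_dim :=
  reg_rep (x : fieldOver k).

Fact rel_rep_zmod : zmod_morphism rel_rep.
Proof. exact: (@reg_rep_zmod _ (fieldOver k)). Qed.
HB.instance Definition _ := GRing.isZmodMorphism.Build _ _ rel_rep rel_rep_zmod.

Fact rel_rep_monoid : monoid_morphism rel_rep.
Proof. exact: (@reg_rep_monoid _ (fieldOver k)). Qed.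
HB.instance Definition _ := GRing.isMonoidMorphism.Build _ _ rel_rep
  rel_rep_monoid.

Lemma rel_rep_scalar a : rel_rep (vsval a) = a%:M.
Proof.
by rewrite -(@reg_rep_scalar _ (fieldOver k)) fieldOver_scaleE mulr1.
Qed.

Definition rel_norm (x : L) : subvs_of k := \det (rel_rep x).

Lemma rel_normM x y : rel_norm (x * y) = rel_norm x * rel_norm y.
Proof. by rewrite /rel_norm rmorphM det_mulmx. Qed.

Lemma rel_norm1 : rel_norm 1 = 1.
Proof. by rewrite /rel_norm rmorph1 det1. Qed.

Lemma field_norm_tower (x : L) : field_norm x = field_norm (rel_norm x).
Proof.
have [m [irr mm hx]] := min_poly_exists x.
rewrite !field_normE.
apply: (@det_rep_tower F _ L (in_alg (subvs_of k)) vsval _ _ _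
  (@reg_rep F (subvs_of k)) rel_rep (@reg_rep F L) m) => //.
- exact: reg_rep_scalar.
- exact: rel_rep_scalar.
- by move=> a; rewrite -reg_rep_scalar /= algid1.
- have -> : rel_dim = \dim_k {:L}.
    rewrite /rel_dim -(@dim_aspaceOver _ _ k {:L}%AS (subvf k)); congr (\dim _).
    apply/vspaceP => y. by rewrite memvf (@mem_aspaceOver _ _ k {:L}%AS) ?subvf // [RHS]memvf.
  rewrite mulnC [\dim {: subvs_of k}]dimvf; exact: (dim_sup_field (subvf k)).
- have -> : map_poly (vsval \o in_alg (subvs_of k)) m = map_poly (in_alg L) m.
    by apply: eq_map_poly => a /=; rewrite algid1.
  by [].
Qed.

End RelativeNorm.

(** By the factor theorem in the ring of polynomials with matrix coefficients, X - A divides the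
    scalar matrix m; determinants then divide. *)
Lemma char_poly_dvd_exp (F : fieldType) (n : nat) (A : 'M[F]_n.+1)
    (m : {poly F}) : horner_mx A m = 0 -> char_poly A %| m ^+ n.+1.
Proof.
have [phi [[psi phiK psiK] phiZ phiC _]] := mx_poly_ring_isom F n.
move/rootP/factor_theorem => [q hq].
have : m%:M = psi q *m char_poly_mx A.
  apply: (can_inj phiK); rewrite [phi (_ *m _)](rmorphM phi) psiK phiZ hq.
  by rewrite rmorphB phiC phiZ map_polyX.
by move/(congr1 determinant); rewrite det_scalar det_mulmx => ->; apply: dvdp_mull.
Qed.

Lemma det_exp_irreducible (F : fieldType) (n1 n2 q : nat) (m : {poly F})
    (A : 'M[F]_n1) (B : 'M[F]_n2) (s t : nat) :
  irreducible_poly m -> n2 = (q * n1)%N ->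
  char_poly A = m ^+ s -> char_poly B = m ^+ t -> \det B = \det A ^+ q.
Proof.
move=> [hm _] e hA hB.
have dm : (0 < (size m).-1)%N by rewrite -subn1 subn_gt0.
have eA : n1 = ((size m).-1 * s)%N.
  by rewrite -size_exp -hA size_char_poly.
have eB : n2 = ((size m).-1 * t)%N.
  by rewrite -size_exp -hB size_char_poly.
have et : t = (s * q)%N.
  by apply/eqP; rewrite -(eqn_pmul2l dm) -eB e mulnA -eA mulnC.
have := char_poly_det B; rewrite hB et exprM -hA -!horner_coef0 horner_exp.
have -> : (-1) ^+ n2 = (-1) ^+ (n1 * q) :> F by rewrite e mulnC.
rewrite horner_coef0 char_poly_det exprMn -exprM.
by move/(can_inj (signrMK _)).
Qed.

Lemma horner_char_poly (R : comNzRingType) (n : nat) (A : 'M[R]_n) (a : R) :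
  (char_poly A).[a] = \det (a%:M - A).
Proof.
rewrite -horner_evalE -det_map_mx; congr (\det _); apply/matrixP => i j.
by rewrite !mxE /= /horner_eval hornerD hornerN hornerC hornerMn hornerX.
Qed.

(** Split f into linear factors: det (A - z) is, up to sign, the characteristic polynomial of A at
    z, and the double product can be exchanged. *)
Lemma det_horner_mx (C : closedFieldType) (n : nat) (A : 'M[C]_n.+1)
    (rs : seq C) (f : {poly C}) :
  char_poly A = \prod_(t <- rs) ('X - t%:P) ->
  \det (horner_mx A f) = \prod_(t <- rs) f.[t].
Proof.
move=> hA.
have srs : size rs = n.+1.
  by have := size_char_poly A; rewrite hA size_prod_XsubC => -[].
have [ss ->] := closed_field_poly_normal f; move: (lead_coef f) => c.
rewrite linearZ /= detZ rmorph_prod /=.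
under [RHS]eq_bigr do rewrite hornerZ.
rewrite big_split /=.
have -> : \prod_(t <- rs) c = c ^+ n.+1.
  by rewrite big_const_seq count_predT srs iter_mulr_1.
congr (_ * _).
have -> : \det (\prod_(z <- ss) horner_mx A ('X - z%:P)) =
          \prod_(z <- ss) \det (horner_mx A ('X - z%:P)).
  apply: (big_morph (fun M => \det M)); first by move=> M N; rewrite det_mulmx.
  by rewrite det1.
under [RHS]eq_bigr do rewrite horner_prod.
rewrite exchange_big /=; apply: eq_bigr => z _.
rewrite rmorphB /= horner_mx_X horner_mx_C -opprB -scaleN1r detZ.
rewrite -horner_char_poly hA horner_prod -srs.
have -> : (-1) ^+ size rs = \prod_(t <- rs) (-1) :> C.
  by rewrite big_const_seq count_predT iter_mulr_1.
rewrite -big_split /=; apply: eq_bigr => t _.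
by rewrite !hornerXsubC mulN1r opprB.
Qed.

Lemma horner_mx_comp (R : comNzRingType) (n : nat) (A : 'M[R]_n.+1)
    (p q : {poly R}) : horner_mx A (p \Po q) = horner_mx (horner_mx A q) p.
Proof.
elim/poly_ind: p => [|p c IH]; first by rewrite comp_poly0 !rmorph0.
by rewrite comp_poly_MXaddC !rmorphD !rmorphM /= IH !horner_mx_C horner_mx_X.
Qed.

(* The algebra F[X]/P plays the role of a second field containing u.           *)
Lemma det_rep_prod_roots (F : fieldType) (C : closedFieldType)
    (i : {rmorphism F -> C}) (k : fieldType) (e : {rmorphism F -> k})
    (n1 q : nat) (rho : {rmorphism k -> 'M[F]_n1}) (u : k) (m : {poly F})
    (P f : {poly F}) (rs : seq C) :
  (forall a, rho (e a) = a%:M) ->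
  irreducible_poly m -> m \is monic -> root (map_poly e m) u ->
  P \is monic -> (size P).-1 = (q * n1)%N -> (0 < q * n1)%N ->
  map_poly i P = \prod_(t <- rs) ('X - t%:P) -> P %| m \Po f ->
  i (\det (rho u)) ^+ q = \prod_(t <- rs) (map_poly i f).[t].
Proof.
move=> hrho irr mm hu mP sP n0 hrs hdvd.
have [s hs] := char_poly_rep_exp hrho irr mm hu.
(* A is the companion matrix of P, that is, multiplication by X on F[X]/P, so that f(A) stands for
   u. *)
have [A hA] : exists A : 'M[F]_((size P).-1.-1.+1), char_poly A = P.
  have := companionmxK mP; rewrite /companionmx.
  move: (\matrix_(i0, j) _); rewrite prednK; last by rewrite sP.
  by move=> A hA; exists A.
have hfA : horner_mx (horner_mx A f) m = 0.
  have [g hg] := dvdpP _ _ hdvd.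
  have hCH := Cayley_Hamilton A; rewrite hA in hCH.
  by rewrite -horner_mx_comp hg rmorphM /= hCH mulr0.
have [t ht] := monic_irreducible_dvd_exp irr mm (char_poly_monic _)
  (char_poly_dvd_exp hfA).
have e1 : (size P).-1.-1.+1 = (q * n1)%N by rewrite prednK sP.
rewrite -rmorphXn -(det_exp_irreducible irr e1 hs ht) -det_map_mx.
by rewrite map_horner_mx; apply: det_horner_mx; rewrite -map_char_poly hA.
Qed.

(** * Discrete valuations and p-adic fields *)

Section Valuation.
Variables (F : fieldType) (v : F -> int) (hv : is_valuation v).

Lemma val1 : v 1 = 0.
Proof.
have := valuationM hv (oner_neq0 F) (oner_neq0 F).
by rewrite mulr1; move: (v 1) => z; lia.
Qed.

Lemma valN x : v (- x) = v x.
Proof.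
have [->|x0] := eqVneq x 0; first by rewrite oppr0.
have n0 : (-1 : F) != 0 by rewrite oppr_eq0 oner_neq0.
have h : v (-1) = 0.
  have := valuationM hv n0 n0; rewrite mulrNN mulr1 val1.
  by move: (v (-1)) => z; lia.
by rewrite -mulN1r (valuationM hv) // h add0r.
Qed.

Lemma valX x n : x != 0 -> v (x ^+ n) = n%:Z * v x.
Proof.
move=> x0; elim: n => [|n IH]; first by rewrite expr0 val1 mul0r.
by rewrite exprS (valuationM hv) ?expf_neq0 // IH; lia.
Qed.

Lemma valV x : x != 0 -> v x^-1 = - v x.
Proof.
move=> x0; have := valuationM hv x0 (invr_neq0 x0).
by rewrite mulfV // val1; lia.
Qed.

Lemma val_ge0 n : val_ge v n 0.
Proof. by rewrite /val_ge eqxx. Qed.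

Lemma val_ge_neq0 n x : x != 0 -> val_ge v n x = (n <= v x).
Proof. by rewrite /val_ge => /negbTE->. Qed.

Lemma val_ge_le m n x : m <= n -> val_ge v n x -> val_ge v m x.
Proof.
by rewrite /val_ge => mn /orP[->//|h]; rewrite (le_trans mn h) orbT.
Qed.

Lemma val_geD n x y : val_ge v n x -> val_ge v n y -> val_ge v n (x + y).
Proof.
have [->|x0] := eqVneq x 0; first by rewrite add0r.
have [->|y0] := eqVneq y 0; first by rewrite addr0.
have [->|s0] := eqVneq (x + y) 0; first by rewrite val_ge0.
rewrite !val_ge_neq0 // => hx hy; apply: le_trans (valuationD hv x0 y0 s0).
by rewrite le_min hx.
Qed.

Lemma val_geN n x : val_ge v n (- x) = val_ge v n x.
Proof. by rewrite /val_ge oppr_eq0 valN. Qed.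

Lemma val_geB n x y : val_ge v n x -> val_ge v n y -> val_ge v n (x - y).
Proof. by move=> hx hy; apply: val_geD; rewrite ?val_geN. Qed.

Lemma val_geM m n x y :
  val_ge v m x -> val_ge v n y -> val_ge v (m + n) (x * y).
Proof.
have [->|x0] := eqVneq x 0; first by move=> *; rewrite mul0r val_ge0.
have [->|y0] := eqVneq y 0; first by move=> *; rewrite mulr0 val_ge0.
rewrite !val_ge_neq0 ?mulf_neq0 // (valuationM hv) // => hx hy.
exact: lerD.
Qed.

Lemma val_geMl n x y : val_ge v 0 x -> val_ge v n y -> val_ge v n (x * y).
Proof. by move=> hx hy; have := val_geM hx hy; rewrite add0r. Qed.

Lemma val_geMr n x y : val_ge v n x -> val_ge v 0 y -> val_ge v n (x * y).
Proof. by rewrite mulrC => hx hy; apply: val_geMl. Qed.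

Lemma val_ge_div n x y : x != 0 -> val_ge v n (y / x) = val_ge v (n + v x) y.
Proof.
move=> x0; have [->|y0] := eqVneq y 0; first by rewrite mul0r !val_ge0.
rewrite !val_ge_neq0 ?mulf_neq0 ?invr_neq0 // (valuationM hv) ?invr_neq0 //.
by rewrite valV //; lia.
Qed.

Lemma val_ge1 : val_ge v 0 1.
Proof. by rewrite val_ge_neq0 ?oner_neq0 // val1. Qed.

Lemma val_ge_sum n (I : Type) (r : seq I) (P : pred I) (f : I -> F) :
  (forall i, P i -> val_ge v n (f i)) -> val_ge v n (\sum_(i <- r | P i) f i).
Proof. by move=> h; elim/big_rec: _ => [|i x Pi]; [exact: val_ge0|apply: val_geD; apply: h]. Qed.

Lemma val_ge_prod (I : Type) (r : seq I) (P : pred I) (f : I -> F) :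
  (forall i, P i -> val_ge v 0 (f i)) -> val_ge v 0 (\prod_(i <- r | P i) f i).
Proof. by move=> h; elim/big_rec: _ => [|i x Pi]; [exact: val_ge1|apply: val_geMl; apply: h]. Qed.

Lemma val_ge_nat n : val_ge v 0 n%:R.
Proof.
elim: n => [|n IH]; first exact: val_ge0.
by rewrite -addn1 natrD; apply: val_geD => //; exact: val_ge1.
Qed.

Lemma val_geXn n m x : val_ge v n x -> val_ge v (m%:Z * n) (x ^+ m).
Proof.
move=> hx; elim: m => [|m IH]; first by rewrite mul0r val_ge1.
rewrite exprS; have -> : m.+1%:Z * n = n + m%:Z * n by lia.
exact: val_geM.
Qed.

Lemma val_geX x m : val_ge v 0 x -> val_ge v 0 (x ^+ m).
Proof. by move/(val_geXn m); rewrite mulr0. Qed.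

Lemma val_ge_inf x : (forall n : nat, val_ge v n x) -> x = 0.
Proof.
move=> h; apply/eqP; case: (eqVneq x 0) => // x0.
by have := h (`|v x| + 1)%N; rewrite val_ge_neq0 //; lia.
Qed.

Lemma not_val_ge1 x : val_ge v 0 x -> ~~ val_ge v 1 x -> x != 0 /\ v x = 0.
Proof.
move=> h0 h1; have x0 : x != 0 by apply: contraNneq h1 => ->; rewrite val_ge0.
by split=> //; rewrite !val_ge_neq0 // in h0 h1; move: (v x) h0 h1 => z; lia.
Qed.

Lemma unit_val_ge x : x != 0 -> v x = 0 -> val_ge v 0 x /\ val_ge v 0 x^-1.
Proof. by move=> x0 vx; rewrite !val_ge_neq0 ?invr_neq0 ?valV // vx. Qed.

Lemma val_ge_prime1 m n x y : val_ge v 0 x -> val_ge v 0 y ->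
  ~~ val_ge v m.+1%:Z x -> ~~ val_ge v n.+1%:Z y ->
  ~~ val_ge v (m + n)%N.+1%:Z (x * y).
Proof.
move=> _ _ hx hy.
have x0 : x != 0 by apply: contraNneq hx => ->; rewrite val_ge0.
have y0 : y != 0 by apply: contraNneq hy => ->; rewrite val_ge0.
rewrite !val_ge_neq0 ?mulf_neq0 // (valuationM hv) // in hx hy *.
by rewrite -ltNge in hx; rewrite -ltNge in hy; rewrite -ltNge; lia.
Qed.

Lemma val_ge1M x y : val_ge v 0 x -> val_ge v 0 y -> val_ge v 1 (x * y) ->
  val_ge v 1 x || val_ge v 1 y.
Proof.
move=> hx hy; apply: contraLR; rewrite negb_or => /andP[hx1 hy1].
exact: (@val_ge_prime1 0 0).
Qed.

Lemma val_ge1X x n : val_ge v 0 x -> val_ge v 1 (x ^+ n) -> val_ge v 1 x.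
Proof.
move=> hx; elim: n => [|n IH].
  by rewrite expr0 val_ge_neq0 ?oner_neq0 // val1.
by rewrite exprS => /(val_ge1M hx (val_geX n hx))/orP[].
Qed.

(* The argument hv is a phantom that carries the closure properties to the       *)
(* canonical instances below.                                                    *)
Definition val_pred (hv : is_valuation v) : {pred F} := val_ring v.

Fact val_pred_subring : subring_closed (val_pred hv).
Proof.
split; rewrite /val_pred ?unfold_in ?inE /val_ring /=.
- exact: val_ge1.
- by move=> x y; apply: val_geB.
- by move=> x y; apply: val_geMl.
Qed.
HB.instance Definition _ :=
  GRing.isSubringClosed.Build F (val_pred hv) val_pred_subring.

(** The valuation ring as a ring type of its own, so that [integralOver] can be applied to its
    inclusion. *)
Record vint := Vint { vval : F; vvalP : vval \in val_pred hv }.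
HB.instance Definition _ := [isSub for vval].
HB.instance Definition _ := [Choice of vint by <:].
HB.instance Definition _ := [SubChoice_isSubComNzRing of vint by <:].

Fact vval_zmod : zmod_morphism vval.
Proof. by []. Qed.
HB.instance Definition _ := GRing.isZmodMorphism.Build _ _ vval vval_zmod.

Fact vval_monoid : monoid_morphism vval.
Proof. by []. Qed.
HB.instance Definition _ := GRing.isMonoidMorphism.Build _ _ vval vval_monoid.

Lemma vint_ge (a : vint) : val_ge v 0 (vval a).
Proof. exact: vvalP. Qed.

End Valuation.

Section PadicNumbers.
Variables (p : nat) (p_prime : prime p).
Variables (Qp : fieldType) (vp : Qp -> int) (iQ : {rmorphism rat -> Qp}).
Hypothesis Qp_completion : is_completion (padic_val p) vp iQ.

Let hv : is_valuation vp := completion_valuation Qp_completion.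

Lemma padic_natr_neq0 n : (0 < n)%N -> n%:R != 0 :> Qp.
Proof.
by move=> n0; rewrite -(rmorph_nat iQ) fmorph_eq0 pnatr_eq0 -lt0n.
Qed.

Lemma padic_val_nat n : (0 < n)%N -> vp n%:R = (logn p n)%:Z.
Proof.
move=> n0; rewrite -(rmorph_nat iQ) (completion_extends Qp_completion);
  last by rewrite pnatr_eq0 -lt0n.
rewrite /padic_val -[n%:R]/((n%:Z)%:~R) numq_int denq_int logn1 subr0.
by [].
Qed.

Lemma padic_val_p : vp p%:R = 1.
Proof. by rewrite padic_val_nat ?prime_gt0 // logn_prime // eqxx. Qed.

Lemma padic_val_ge_int (a : int) : (p %| a)%Z -> val_ge vp 1 a%:~R.
Proof.
move=> /dvdzP [q ->]; rewrite rmorphM /= mulrC.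
apply: (val_geMr hv).
  by rewrite val_ge_neq0 ?padic_natr_neq0 ?prime_gt0 // padic_val_p.
by case: q => n; rewrite ?NegzE ?mulrNz ?(val_geN hv); apply: val_ge_nat.
Qed.

(** The residue field is Z/p: approximate z by a rational number, whose denominator is then prime to
    p, and divide modulo p by the Chinese remainder theorem. *)
Lemma padic_residue z : val_ge vp 0 z -> exists n : nat, val_ge vp 1 (z - n%:R).
Proof.
move=> hz; have [r hr] := completion_dense Qp_completion z 1.
suff [n hn] : exists n : nat, val_ge vp 1 (iQ r - n%:R).
  exists n; have -> : z - n%:R = (z - iQ r) + (iQ r - n%:R) by ring.
  exact: (val_geD hv).
have [->|r0] := eqVneq r 0.
  by exists 0%N; rewrite rmorph0 subr0 val_ge0.
have hr0 : 0 <= padic_val p r.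
  rewrite -(completion_extends Qp_completion) // -(@val_ge_neq0 _ _ _ _);
    last by rewrite fmorph_eq0.
  have -> : iQ r = z - (z - iQ r) by ring.
  by apply: (val_geB hv) => //; apply: (val_ge_le _ hr).
have cpd : coprime p `|denq r|.
  rewrite prime_coprime //; apply/negP => pd.
  have pn : ~~ (p %| `|numq r|)%N.
    have := coprime_num_den r; apply: contraTN => pn.
    rewrite /coprime; apply/eqP => h1.
    have : (p %| 1)%N by rewrite -h1 dvdn_gcd pn pd.
    by rewrite dvdn1 => /eqP pe; have := prime_gt1 p_prime; rewrite pe.
  move: hr0; rewrite /padic_val (lognE p `|numq r|) (negPf pn) !andbF.
  have : (0 < logn p `|denq r|)%N.
    by rewrite logn_gt0 mem_primes p_prime pd absz_gt0 denq_neq0.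
  by lia.
have [n hn] : exists n : nat, (p %| numq r - n%:Z * denq r)%Z.
  have cz : coprimez p%:Z (denq r) by rewrite coprimezE.
  set x := zchinese p%:Z (denq r) (numq r) 0.
  have hx1 : (x = numq r %[mod p%:Z])%Z by apply: zchinese_modl.
  have /dvdzP [q hq] : (denq r %| x)%Z.
    by apply/dvdz_mod0P; rewrite zchinese_modr // mod0z.
  have p0 : p%:Z != 0 by rewrite eqz_nat -lt0n prime_gt0.
  exists `|(q %% p)%Z|%N; rewrite gez0_abs ?modz_ge0 // -eqz_mod_dvd.
  by rewrite -hx1 hq modzMml.
exists n.
have d0 : (denq r)%:~R != 0 :> Qp.
  by rewrite -(rmorph_int iQ) fmorph_eq0 intr_eq0 denq_neq0.
have -> : iQ r - n%:R = (numq r - n%:Z * denq r)%:~R / (denq r)%:~R.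
  rewrite -{1}[r]divq_num_den rmorphM fmorphV !rmorph_int.
  by rewrite rmorphB rmorphM /= mulrBl mulfK.
rewrite (val_ge_div hv) //.
have -> : vp (denq r)%:~R = 0.
  have := denq_gt0 r; case: (denq r) cpd => // d cpd d0'.
  rewrite [_%:~R]/(d%:R) padic_val_nat // lognE.
  by rewrite prime_coprime // in cpd; rewrite (negPf cpd) !andbF.
exact: padic_val_ge_int.
Qed.

Lemma padic_fermat c : val_ge vp 0 c -> val_ge vp 1 (c ^+ p - c).
Proof.
move=> hc; have [n hn] := padic_residue hc.
have -> : c ^+ p - c = (c ^+ p - n%:R ^+ p) + (n%:R ^+ p - n%:R) - (c - n%:R).
  by ring.
apply: (val_geB hv) => //; apply: (val_geD hv).
  rewrite subrXX; apply: (val_geMr hv) => //; apply: (val_ge_sum) => // i _.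
  by apply: (val_geMl hv); apply: (val_geX hv) => //; apply: val_ge_nat.
have -> : n%:R ^+ p - n%:R = ((n ^ p)%N%:Z - n%:Z)%:~R :> Qp.
  by rewrite rmorphB /= -natrX.
apply: padic_val_ge_int; rewrite -eqz_mod_dvd.
by apply/eqP; have := fermat_little n p_prime; rewrite !modz_nat => ->.
Qed.

End PadicNumbers.

Section ResidueCharacteristic.
Variables (F : fieldType) (v : F -> int) (hv : is_valuation v).
Variables (p : nat) (p_prime : prime p).
Hypothesis v_p : val_ge v 1 p%:R.

Lemma val_ge1_exprD x y : val_ge v 0 x -> val_ge v 0 y ->
  val_ge v 1 ((x + y) ^+ p - (x ^+ p + y ^+ p)).
Proof.
move=> hx hy; case: p p_prime v_p => // q q_prime v_q.
rewrite exprDn big_ord_recl big_ord_recr /= !subn0 subnn bin0 binn !mulr1n.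
rewrite !expr0 mulr1 mul1r.
have -> : forall a b c : F, a + (b + c) - (a + c) = b by move=> a b c; ring.
apply: (val_ge_sum hv) => i _; rewrite -mulr_natl; apply: (val_geMr hv); last first.
  by apply: (val_geMl hv); apply: (val_geX hv).
have /dvdnP [c ->] : (q.+1 %| 'C(q.+1, bump 0 i))%N.
  by apply: prime_dvd_bin => //; rewrite /bump /= add1n ltnS ltn_ord.
by rewrite natrM; apply: (val_geMl hv) => //; apply: val_ge_nat.
Qed.

Lemma val_ge1_expr_sum (I : Type) (r : seq I) (f : I -> F) :
  (forall i, val_ge v 0 (f i)) ->
  val_ge v 1 ((\sum_(i <- r) f i) ^+ p - \sum_(i <- r) f i ^+ p).
Proof.
move=> hf; elim: r => [|i r IH].
  by rewrite !big_nil expr0n gtn_eqF ?prime_gt0 // subr0 val_ge0.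
rewrite !big_cons; set S := \sum_(j <- r) f j in IH *.
have hS : val_ge v 0 S by apply: (val_ge_sum hv).
have := val_geD hv (val_ge1_exprD (hf i) hS) IH; congr (val_ge _ _ _); ring.
Qed.

End ResidueCharacteristic.

(** * Integers of a p-adic field: perfect residue field, finite generation, integrality *)

Section LocalField.
Variables (p : nat) (p_prime : prime p).
Variables (Qp : fieldType) (vp : Qp -> int) (iQ : {rmorphism rat -> Qp}).
Hypothesis Qp_completion : is_completion (padic_val p) vp iQ.
Variables (K : fieldExtType Qp) (w : K -> int) (hw : is_valuation w) (e0 : nat).
Hypothesis he0 : is_ramification_index vp w (in_alg K) e0.

Let hv : is_valuation vp := completion_valuation Qp_completion.

Lemma val_ge_alg n a : val_ge vp n a -> val_ge w (e0%:Z * n) a%:A.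
Proof.
have [_ he] := he0; have [->|a0] := eqVneq a 0; first by move=> *; rewrite scale0r val_ge0.
have a1 : a%:A != 0 :> K by rewrite scaler_eq0 oner_eq0 orbF.
rewrite !val_ge_neq0 // (he _ a0) => h.
by rewrite ler_wpM2l.
Qed.

Lemma val_ge_scale n a x : val_ge vp 0 a -> val_ge w n x -> val_ge w n (a *: x).
Proof.
move=> /val_ge_alg; rewrite mulr0 => ha hx; rewrite -mulr_algl.
exact: (val_geMl hw).
Qed.

Lemma val_p : w p%:R = e0%:Z.
Proof.
have [_ he] := he0; have := he p%:R (padic_natr_neq0 iQ (prime_gt0 p_prime)).
by rewrite (padic_val_p p_prime Qp_completion) /= scaler_nat mulr1 => ->.
Qed.

Lemma natr_neq0 n : (0 < n)%N -> n%:R != 0 :> K.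
Proof.
move=> n0; rewrite -(rmorph_nat (in_alg K)) fmorph_eq0.
exact: (padic_natr_neq0 iQ).
Qed.

Lemma val_ge_alg1 n a : n <= e0%:Z -> val_ge vp 1 a -> val_ge w n a%:A.
Proof. by move=> hn /val_ge_alg; rewrite mulr1; apply: val_ge_le. Qed.

(** Independence over F_p of the classes modulo the elements of valuation at least s; s = 1 gives
    the residue field and s = e0 the quotient by p. *)
Definition independent_mod (s : int) (r : nat) (e : 'I_r -> K) : Prop :=
  (forall i, val_ge w 0 (e i)) /\
  forall c : 'I_r -> Qp, (forall i, val_ge vp 0 (c i)) ->
    val_ge w s (\sum_i c i *: e i) -> forall i, val_ge vp 1 (c i).

(** A dependence relation over Q_p, divided by its coefficient of least valuation, becomes integral
    with one coefficient equal to 1. *)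
Lemma independent_mod_size s r (e : 'I_r -> K) :
  independent_mod s e -> (r <= \dim {:K})%N.
Proof.
move=> [_ ind]; rewrite leqNgt; apply/negP => hr.
pose X := [tuple e i | i < r].
have : ~~ free X.
  rewrite /free; apply/negP => /eqP hX.
  by have := dimvS (subvf <<X>>%VS); rewrite hX size_tuple leqNgt hr.
move/negP => nf; apply: nf; apply/freeP => k hk.
suff : [forall i, k i == 0] by move/forallP => h i; apply/eqP.
apply/negPn/negP => /forallPn [i1 hi1].
case: (@arg_minP _ _ _ i1 (fun i => k i != 0) (fun i => vp (k i)) hi1) => i0 hi0 hmin.
have := ind (fun i => k i / k i0) _ _ i0; rewrite divff // => h.
have : val_ge vp 1 1.
  apply: h => [i|].
    have [->|ki] := eqVneq (k i) 0; first by rewrite mul0r val_ge0.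
    by rewrite (val_ge_div hv) // val_ge_neq0 // add0r hmin.
  have -> : \sum_i (k i / k i0) *: e i = (k i0)^-1 *: \sum_i k i *: X`_i.
    rewrite scaler_sumr; apply: eq_bigr => i _.
    by rewrite scalerA mulrC -tnth_nth tnth_mktuple.
  by rewrite hk scaler0 val_ge0.
by rewrite val_ge_neq0 ?oner_neq0 // (val1 hv).
Qed.

Lemma maximal_independent_mod s :
  exists r (e : 'I_r -> K), independent_mod s e /\
  forall e' : 'I_r.+1 -> K, ~ independent_mod s e'.
Proof.
pose P r := `[< exists e : 'I_r -> K, independent_mod s e >].
have P0 : exists r, P r.
  by exists 0%N; apply/asboolP; exists (fun=> 0); split=> [[]|c _ _ []].
have Pb r : P r -> (r <= \dim {:K})%N.
  by move/asboolP => [e he]; apply: independent_mod_size he.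
case: (ex_maxnP P0 Pb) => r /asboolP [e he] hmax.
exists r, e; split=> // e' h.
have /hmax : P r.+1 by apply/asboolP; exists e'.
by rewrite ltnn.
Qed.

Lemma maximal_spanning s r (e : 'I_r -> K) : s <= e0%:Z ->
  independent_mod s e -> (forall e' : 'I_r.+1 -> K, ~ independent_mod s e') ->
  forall x, val_ge w 0 x -> exists c : 'I_r -> Qp,
    (forall i, val_ge vp 0 (c i)) /\ val_ge w s (x - \sum_i c i *: e i).
Proof.
move=> hs he hmax x hx.
pose e' (i : 'I_r.+1) := if unlift ord0 i is Some j then e j else x.
have nind := hmax e'.
have [c [hc hsum [i1 hi1]]] : exists c : 'I_r.+1 -> Qp,
   [/\ forall i, val_ge vp 0 (c i), val_ge w s (\sum_i c i *: e' i) &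
     exists i, ~~ val_ge vp 1 (c i)].
  apply: contra_notP nind => nex; split=> [i|c hc hsum i].
    by rewrite /e'; case: unlift => [j|//]; apply: he.1.
  by apply: contra_notT nex => hi; exists c; split=> //; exists i.
rewrite big_ord_recl {1}/e' unlift_none in hsum.
have eq1 : \sum_(i < r) c (lift ord0 i) *: e' (lift ord0 i) =
           \sum_(i < r) c (lift ord0 i) *: e i.
  by apply: eq_bigr => i _; rewrite /e' liftK.
rewrite eq1 in hsum.
have [hc0|hc0] := boolP (val_ge vp 1 (c ord0)).
  have h2 : val_ge w s (\sum_(i < r) c (lift ord0 i) *: e i).
    rewrite -[\sum_(_ < _) _](addKr (c ord0 *: x)); apply: (val_geD hw) => //.
    rewrite (val_geN hw) -mulr_algl; apply: (val_geMr hw) => //.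
    exact: val_ge_alg1.
  have h3 := he.2 _ (fun i => hc _) h2.
  move: hi1; case: (unliftP ord0 i1) => [j ->|->]; last by rewrite hc0.
  by rewrite h3.
have [c00 vc0] := not_val_ge1 (hc ord0) hc0.
exists (fun i => - (c ord0)^-1 * c (lift ord0 i)).
have hci : val_ge vp 0 (c ord0)^-1 by rewrite val_ge_neq0 ?invr_neq0 // valV // vc0.
split=> [i|].
  by apply: (val_geMl hv); rewrite ?(val_geN hv).
have -> : x - \sum_i (- (c ord0)^-1 * c (lift ord0 i)) *: e i =
   (c ord0)^-1 *: (c ord0 *: x + \sum_(i < r) c (lift ord0 i) *: e i).
  rewrite scalerDr scalerA mulVf // scale1r scaler_sumr -sumrN; congr (_ + _).
  by apply: eq_bigr => i _; rewrite scalerA mulNr scaleNr opprK.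
exact: val_ge_scale.
Qed.

Let e0_gt0 : (0 < e0)%N. Proof. by case: he0. Qed.

Lemma val_ge1_p : val_ge w 1 p%:R.
Proof. by rewrite val_ge_neq0 ?natr_neq0 ?prime_gt0 // val_p; lia. Qed.

(** Frobenius carries a maximal independent family e to the family of the e_i^p, again independent
    because c^p = c modulo p on Z_p. It has the same size, so it spans, and a combination of the
    e_i^p is the p-th power of one of the e_i. *)
Lemma residue_perfect x : val_ge w 0 x ->
  exists2 t, val_ge w 0 t & val_ge w 1 (x - t ^+ p).
Proof.
move=> hx; have [r [e [he hmax]]] := maximal_independent_mod 1.
have frob (c : 'I_r -> Qp) : (forall i, val_ge vp 0 (c i)) ->
  val_ge w 1 ((\sum_i c i *: e i) ^+ p - \sum_i c i *: e i ^+ p).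
  move=> hc; have hce i : val_ge w 0 (c i *: e i).
    by apply: val_ge_scale => //; apply: he.1.
  have h1 := val_ge1_expr_sum hw p_prime val_ge1_p (index_enum _) hce.
  set B := \sum_(i <- _) (c i *: e i) ^+ p in h1.
  have -> : forall a b : K, a - b = (a - B) + (B - b).
    by move=> a b; rewrite addrA subrK.
  apply: (val_geD hw) => //; rewrite -sumrB; apply: (val_ge_sum hw) => i _.
  rewrite exprZn -scalerBl -mulr_algl; apply: (val_geMr hw).
    by apply: val_ge_alg1; [lia|apply: (padic_fermat p_prime Qp_completion)].
  by apply: (val_geX hw); apply: he.1.
have he' : independent_mod 1 (fun i => e i ^+ p).
  split=> [i|c hc hs]; first by apply: (val_geX hw); apply: he.1.
  apply: he.2 => //; apply: (@val_ge1X _ _ hw _ p).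
    by apply: (val_ge_sum hw) => i _; apply: val_ge_scale => //; apply: he.1.
  by have := val_geD hw (frob c hc) hs; rewrite subrK.
have [|c [hc hx1]] := maximal_spanning _ he' hmax hx; first by lia.
exists (\sum_i c i *: e i).
  by apply: (val_ge_sum hw) => i _; apply: val_ge_scale => //; apply: he.1.
have := val_geB hw hx1 (frob c hc).
by congr (val_ge _ _ _); ring.
Qed.

(* Nakayama: a family spanning the valuation ring modulo p spans it, by        *)
(* completeness of Z_p.                                                        *)
Lemma val_ring_generated : exists r (e : 'I_r -> K),
  (forall i, val_ge w 0 (e i)) /\
  forall x, val_ge w 0 x -> exists2 c : 'I_r -> Qp,
    forall i, val_ge vp 0 (c i) & x = \sum_i c i *: e i.
Proof.
have [r [e [he hmax]]] := maximal_independent_mod e0%:Z.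
exists r, e; split; first exact: he.1.
move=> x hx; pose O := {y : K | val_ge w 0 y}.
have step (y : O) : exists cz : ('I_r -> Qp) * O,
    (forall i, val_ge vp 0 (cz.1 i)) /\
    sval y = \sum_i cz.1 i *: e i + p%:R * sval cz.2.
  case: y => y hy; have [c [hc hs]] := maximal_spanning (lexx _) he hmax hy.
  have p0 : p%:R != 0 :> K by rewrite natr_neq0 ?prime_gt0.
  have hz : val_ge w 0 ((y - \sum_i c i *: e i) / p%:R).
    by rewrite (val_ge_div hw) // add0r val_p.
  exists (c, exist (fun y : K => val_ge w 0 y) _ hz); split=> //=.
  by rewrite mulrC divfK // addrC subrK.
have [f hf] := choice step.
pose X := fix X n := if n is n'.+1 then (f (X n')).2 else exist (fun y : K => val_ge w 0 y) x hx.
pose c n i := (f (X n)).1 i.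
have hc n i : val_ge vp 0 (c n i) by apply: (hf _).1.
pose S i n := \sum_(l < n) p%:R ^+ l * c l i.
have hX n : x = \sum_i S i n *: e i + p%:R ^+ n * sval (X n).
  elim: n => [|n IH].
    rewrite expr0 mul1r big1 ?add0r // => i _.
    by rewrite /S big_ord0 scale0r.
  rewrite {1}IH {1}(hf (X n)).2 mulrDr addrA mulrA -exprSr; congr (_ + _).
  rewrite mulr_sumr -big_split; apply: eq_bigr => i _ /=.
  rewrite /S big_ord_recr /= scalerDl; congr (_ + _).
  by rewrite -scalerA -[in RHS]mulr_algl -in_algE rmorphXn rmorph_nat.
have hvp n y : val_ge vp 0 y -> val_ge vp n%:Z (p%:R ^+ n * y).
  move=> hy; apply: (val_geMr hv) => //.
  have hp1 : val_ge vp 1 p%:R.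
    rewrite val_ge_neq0 ?(padic_natr_neq0 iQ) ?prime_gt0 //.
    by rewrite (padic_val_p p_prime Qp_completion).
  by have := val_geXn hv n hp1; rewrite mulr1.
have hSS i n m : val_ge vp n%:Z (S i (n + m)%N - S i n).
  rewrite /S big_split_ord /= addrAC subrr add0r; apply: (val_ge_sum hv) => l _.
  by apply: (val_ge_le _ (hvp (n + l)%N _ (hc _ _))); lia.
have cauchy i : val_cauchy vp (S i).
  move=> n; exists `|n|%N => a b ha hb.
  have -> : S i a - S i b = (S i a - S i `|n|%N) - (S i b - S i `|n|%N) by ring.
  have := hSS i `|n|%N (a - `|n|)%N; have := hSS i `|n|%N (b - `|n|)%N.
  rewrite !subnKC // => h1 h2; apply: (@val_ge_le _ _ _ `|n|%N%:Z); first by lia.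
  exact: (val_geB hv).
have [l hl] := choice (fun i => completion_complete Qp_completion (cauchy i)).
have hSl i n : val_ge vp n%:Z (l i - S i n).
  have [N hN] := hl i n%:Z; have := hN (n + N)%N (leq_addl _ _).
  move=> h1; have := val_geB hv (hSS i n N) h1; congr (val_ge _ _ _); ring.
exists l => [i|].
  by have := hSl i 0%N; rewrite /S big_ord0 subr0.
apply/eqP; rewrite -subr_eq0; apply/eqP; apply: (@val_ge_inf _ w).
move=> n; rewrite [X in X - _](hX n) addrAC -sumrB; apply: (val_geD hw).
  apply: (val_ge_sum hw) => i _; rewrite -scalerBl -mulr_algl.
  apply: (val_geMr hw) (he.1 i).
  rewrite -opprB scaleNr (val_geN hw).
  by apply: (val_ge_le _ (val_ge_alg (hSl i n))); nia.
apply: (val_geMr hw); last exact: (svalP (X n)).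
by have := val_geXn hw n val_ge1_p; rewrite mulr1.
Qed.

(** Determinant trick: x is an eigenvalue of the integral matrix of multiplication by x on the
    generators. The eigenvector is nonzero since 1 lies in their span. *)
Lemma val_ring_integral x : val_ge w 0 x ->
  integralOver (in_alg K \o @vval _ _ hv) x.
Proof.
move=> hx; have [r [e [he span]]] := val_ring_generated.
have hxe i : val_ge w 0 (x * e i) by apply: (val_geMl hw).
have [c hc] := choice (fun i => let: ex_intro2 c h1 h2 := span _ (hxe i) in
  ex_intro (fun c => (forall j, val_ge vp 0 (c j)) /\ x * e i = \sum_j c j *: e j)
   c (conj h1 h2)).
pose M := \matrix_(j, i) @Vint _ _ hv (c i j) ((hc i).1 j).
exists (char_poly M); first exact: char_poly_monic.
rewrite map_char_poly -eigenvalue_root_char.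
apply/eigenvalueP; exists (\row_i e i).
  apply/rowP => i; rewrite !mxE (hc i).2; apply: eq_bigr => j _.
  by rewrite !mxE /= mulrC mulr_algl.
apply/eqP => e_eq0; have [c1 _ h1] := span 1 (val_ge1 hw).
have /eqP := oner_neq0 K; apply; rewrite h1 big1 // => i _.
by have /rowP/(_ i) := e_eq0; rewrite !mxE => ->; rewrite scaler0.
Qed.

End LocalField.

(** * Integral elements over Z_p *)

Section IntegralElements.
Variables (F : fieldType) (v : F -> int) (hv : is_valuation v).
Variables (C : fieldType) (i : {rmorphism F -> C}).

Definition integers (hv : is_valuation v) (i : {rmorphism F -> C}) : {pred C} :=
  fun y => `[< integralOver (i \o @vval _ _ hv) y >].
Local Notation O := (integers hv i).

Lemma integersP y : reflect (integralOver (i \o @vval _ _ hv) y) (y \in O).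
Proof. exact: asboolP. Qed.

Fact integers_subring : subring_closed O.
Proof.
split.
- by apply/integersP; apply: integral1.
- by move=> x y /integersP hx /integersP hy; apply/integersP; apply: integral_sub.
- by move=> x y /integersP hx /integersP hy; apply/integersP; apply: integral_mul.
Qed.
HB.instance Definition _ :=
  GRing.isSubringClosed.Build C O integers_subring.

Lemma integers_base a : (i a \in O) = val_ge v 0 a.
Proof.
apply/integersP/idP => [[q mq hq]|ha]; last first.
  exact: (integral_id (i \o @vval _ _ hv) (@Vint _ _ hv a ha)).
apply: contraT => ha; have a0 : a != 0.
  by apply: contraNneq ha => ->; rewrite val_ge0.
rewrite val_ge_neq0 // -ltNge in ha.
have : root (map_poly (@vval _ _ hv) q) a.
  by move: hq; rewrite map_poly_comp fmorph_root.
rewrite /root horner_coef size_map_poly_id0; last first.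
  by rewrite (monicP mq) rmorph1 oner_neq0.
have sq : (0 < size q)%N by rewrite size_poly_gt0 monic_neq0.
rewrite -(prednK sq) big_ord_recr /= coef_map /= -lead_coefE (monicP mq) rmorph1.
rewrite mul1r addr_eq0 => /eqP h.
(* If v(a) < 0, every lower term has larger valuation than the leading term a^d, which they would
   have to cancel. *)
have : val_ge v ((size q).-1%:Z * v a + 1) (\sum_(l < (size q).-1)
   (map_poly (@vval _ _ hv) q)`_l * a ^+ l).
  apply: (val_ge_sum hv) => l _; rewrite coef_map; apply: (val_geMl hv).
    exact: vint_ge.
  rewrite val_ge_neq0 ?expf_neq0 // valX //; move: (ltn_ord l) ha.
  move: (v a) (_.-1) (nat_of_ord l) => z d l' ld z0.
  have hz : (d%:Z - l'%:Z - 1) * z <= 0 by apply: mulr_ge0_le0; lia.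
  rewrite -subr_ge0; apply: (@le_trans _ _ (- ((d%:Z - l'%:Z - 1) * z) - z - 1)).
    by lia.
  by rewrite le_eqVlt; apply/orP; left; apply/eqP; ring.
by rewrite h (val_geN hv) val_ge_neq0 ?expf_neq0 // valX // gerDl.
Qed.

Lemma integers_root_monic (q : {poly C}) y : q \is monic -> q \is a polyOver O ->
  root q y -> y \in O.
Proof.
move=> mq /polyOverP hq hy; apply/integersP; apply: integral_root_monic hy _ => //.
by move=> z /(nthP 0) [l _ <-]; apply/integersP; apply: hq.
Qed.

Lemma integers_expn y n : (0 < n)%N -> y ^+ n \in O -> y \in O.
Proof.
move=> n0 hy; apply: (@integers_root_monic ('X^n - (y ^+ n)%:P)).
- exact: monicXnsubC.
- by rewrite rpredB ?rpredX ?polyOverX ?polyOverC.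
- by rewrite /root !hornerE subrr.
Qed.

Lemma integers_unity_root y n : (0 < n)%N -> y ^+ n = 1 -> y \in O.
Proof. by move=> n0 hy; apply: (integers_expn n0); rewrite hy rpred1. Qed.

Variables (p : nat) (p_prime : prime p).
Hypothesis p_neq0_F : p%:R != 0 :> F.
Hypothesis v_p : v p%:R = 1.

Lemma inv_p_integers : (p%:R^-1 \in O) = false.
Proof.
rewrite -(rmorph_nat i) -fmorphV integers_base val_ge_neq0 ?invr_neq0 //.
by rewrite valV // v_p.
Qed.

Lemma p_neq0 : p%:R != 0 :> C.
Proof. by rewrite -(rmorph_nat i) fmorph_eq0. Qed.

(* The maximal ideal of the integers, described without a valuation on C.        *)
Definition nilp (hv : is_valuation v) (i : {rmorphism F -> C}) : {pred C} :=
  fun y => `[< exists n, y ^+ n / p%:R \in integers hv i >].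
Local Notation N := (nilp hv i).

Lemma nilpP y : reflect (exists n, y ^+ n / p%:R \in O) (y \in N).
Proof. exact: asboolP. Qed.

Lemma nilp_integers y : y \in N -> y \in O.
Proof.
move=> /nilpP [[|n]]; first by rewrite expr0 div1r inv_p_integers.
move=> h; apply: (@integers_expn _ n.+1) => //.
by rewrite -[_ ^+ _](divfK p_neq0) rpredM ?rpred_nat.
Qed.

Lemma nilpM x y : x \in O -> y \in N -> x * y \in N.
Proof.
move=> hx /nilpP [n hn]; apply/nilpP; exists n.
by rewrite exprMn -mulrA rpredM ?rpredX.
Qed.

Lemma nilp_p : p%:R \in N.
Proof. by apply/nilpP; exists 1%N; rewrite expr1 divff ?p_neq0 ?rpred1. Qed.

Lemma nilp1 : (1 \in N) = false.
Proof.
by apply/nilpP => -[n]; rewrite expr1n div1r inv_p_integers.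
Qed.

Fact nilp_zmod : zmod_closed N.
Proof.
split; first by apply/nilpP; exists 1%N; rewrite expr1 mul0r rpred0.
suff addN x y : x \in N -> y \in N -> x + y \in N.
  move=> x y hx hy; apply: addN => //.
  by rewrite -mulN1r nilpM // rpredN1.
move=> hx hy; have Ox := nilp_integers hx; have Oy := nilp_integers hy.
case/nilpP: hx => m hm; case/nilpP: hy => n hn.
(* In each term of (x + y)^(m + n), either x has exponent at least m or y has exponent at least
   n. *)
apply/nilpP; exists (m + n)%N; rewrite exprDn mulr_suml.
suff h l : (l < (m + n).+1)%N -> x ^+ (m + n - l) * y ^+ l / p%:R \in O.
  by rewrite rpred_sum // => l _; rewrite mulrnAl rpredMn //; apply: h.
move=> llt; have [ln|nl] := leqP n l.
  have -> : y ^+ l = y ^+ (l - n) * y ^+ n by rewrite -exprD subnK.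
  rewrite -2!mulrA; apply: rpredM; first exact: rpredX.
  by apply: rpredM; first exact: rpredX.
have lm : (m <= m + n - l)%N by lia.
have -> : x ^+ (m + n - l) = x ^+ (m + n - l - m) * x ^+ m.
  by rewrite -exprD subnK.
rewrite -mulrA -mulrA; apply: rpredM; first exact: rpredX.
by rewrite mulrCA; apply: rpredM; first exact: rpredX.
Qed.
HB.instance Definition _ := GRing.isZmodClosed.Build C N nilp_zmod.

Lemma nilp_base a : (i a \in N) = val_ge v 1 a.
Proof.
apply/idP/idP => [hN|ha].
  apply: contraT => ha; have := nilp_integers hN.
  rewrite integers_base => ha0; have [a0 va] := not_val_ge1 ha0 ha.
  suff : 1 \in N by rewrite nilp1.
  have ia0 : i a != 0 by rewrite fmorph_eq0.
  rewrite -(mulVf ia0) nilpM // -fmorphV integers_base.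
  by rewrite val_ge_neq0 ?invr_neq0 // valV // va.
apply/nilpP; exists 1%N; rewrite expr1 -(rmorph_nat i) -fmorph_div.
by rewrite integers_base (val_ge_div hv) // v_p add0r.
Qed.

Lemma div_p_base a n : (i a / p%:R ^+ n \in O) = val_ge v n%:Z a.
Proof.
rewrite -(rmorph_nat i) -rmorphXn -fmorph_div integers_base.
by rewrite (val_ge_div hv) ?expf_neq0 // valX // v_p add0r mulr1.
Qed.

Lemma horner_congr_nilp f x y : f \is a polyOver O -> x \in O -> y \in O -> x - y \in N ->
  f.[x] - f.[y] \in N.
Proof.
move=> /polyOverP hf xO yO hxy; rewrite !horner_coef -sumrB; apply: (rpred_sum (S := N)) => l _.
rewrite -mulrBr; apply: nilpM; first exact: hf.
rewrite subrXX mulrC; apply: nilpM => //; apply: rpred_sum => a _.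
by apply: rpredM; apply: rpredX.
Qed.

End IntegralElements.

(** * Eisenstein polynomials: integral elements and minimality *)

Section Eisenstein.
Variables (F : fieldType) (v : F -> int) (hv : is_valuation v).
Variables (C : fieldType) (i : {rmorphism F -> C}).
Variables (p : nat).
Hypothesis p_neq0_F : p%:R != 0 :> F.
Hypothesis v_p : v p%:R = 1.
Local Notation O := (integers hv i).
Local Notation N := (nilp p hv i).

Variables (P : {poly F}) (t : C).
Hypothesis P_monic : P \is monic.
Hypothesis P_size : (1 < size P)%N.
Hypothesis P_coef : forall l, (l < (size P).-1)%N -> val_ge v 1 P`_l.
Hypothesis P_eisenstein : size P = 2 \/ ~~ val_ge v 2 P`_0.
Hypothesis Pt : root (map_poly i P) t.

Let d := (size P).-1.
Let d_gt0 : (0 < d)%N. Proof. by rewrite /d -subn1 subn_gt0. Qed.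
Let size_P : size P = d.+1. Proof. by rewrite /d prednK // ltnW. Qed.

Let pC_neq0 : p%:R != 0 :> C := p_neq0 i p_neq0_F.

Lemma eisenstein_root_expn : t ^+ d = - \sum_(l < d) i P`_l * t ^+ l.
Proof.
have := Pt; rewrite /root horner_coef size_map_poly size_P big_ord_recr /=.
rewrite coef_map /= -[P`_d]/(lead_coef P) (monicP P_monic) rmorph1 mul1r.
rewrite addr_eq0 => /eqP h; apply: oppr_inj; rewrite -h opprK.
by apply: eq_bigr => l _; rewrite coef_map.
Qed.

Lemma eisenstein_root_integer : t \in O.
Proof.
apply: (@integers_root_monic _ _ hv _ _ (map_poly i P)) => //.
  by rewrite map_monic.
apply/polyOverP => l; rewrite coef_map /= integers_base.
have [ld|dl] := ltnP l d; first by apply: val_ge_le (P_coef ld).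
have [->|ne] := eqVneq l d.
  by rewrite -[P`_d]/(lead_coef P) (monicP P_monic) val_ge1.
by rewrite nth_default ?val_ge0 // size_P ltn_neqAle eq_sym ne.
Qed.

Lemma eisenstein_coef_div_p l : (l < d)%N -> i P`_l / p%:R \in O.
Proof. by move=> /P_coef h; rewrite -[p%:R]expr1 (div_p_base hv). Qed.

Lemma eisenstein_expn_div_p l : (d <= l)%N -> t ^+ l / p%:R \in O.
Proof.
move=> dl; rewrite -(subnK dl) exprD -mulrA.
apply: rpredM; first by apply: rpredX; exact: eisenstein_root_integer.
rewrite eisenstein_root_expn mulNr rpredN mulr_suml.
apply: rpred_sum => j _; rewrite mulrAC; apply: rpredM.
  by apply: eisenstein_coef_div_p.
by apply: rpredX; exact: eisenstein_root_integer.
Qed.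

Lemma eisenstein_root_nilp : t \in N.
Proof. by apply/nilpP; exists d; apply: eisenstein_expn_div_p. Qed.

(** The powers of a root of an Eisenstein polynomial form an integral basis. The core [H] says that
    g(t) divisible by p forces p to divide every coefficient of g. Degree 1 is handled apart, since
    [psi Qp 0] is X, with constant term 0. *)
Lemma eisenstein_integral (f : {poly F}) : (size f <= d)%N ->
  (map_poly i f).[t] \in O -> forall l, val_ge v 0 f`_l.
Proof.
have [P2|hP0] := P_eisenstein.
  rewrite /d P2 /= => /size1_polyC ->; rewrite map_polyC hornerC integers_base.
  by move=> h [|l]; rewrite coefC //= val_ge0.
have H (g : {poly F}) : (size g <= d)%N -> (map_poly i g).[t] / p%:R \in O ->
    (forall l, val_ge v 0 g`_l) -> forall l, val_ge v 1 g`_l.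
  move=> sg hg g0; elim/ltn_ind => l IH.
  have [ld|dl] := ltnP l d; last first.
    by rewrite nth_default ?val_ge0 // (leq_trans sg).
  apply: contraT => gl; have [gl0 vgl] := not_val_ge1 (g0 l) gl.
  (* Multiplication by t^(d-1-l) moves the term of index l to t^(d-1): the terms before it are
     divisible by p by induction, those after it because they contain t^d. *)
  have h1 : t ^+ (d.-1 - l) * ((map_poly i g).[t] / p%:R) \in O.
    by apply: rpredM => //; apply: rpredX; exact: eisenstein_root_integer.
  have h2 : i g`_l * (t ^+ d.-1 / p%:R) \in O.
    have eg : (map_poly i g).[t] = \sum_(j < d) i g`_j * t ^+ j.
      rewrite (@horner_coef_wide _ d) ?(leq_trans (size_poly _ _)) //.
      by apply: eq_bigr => j _; rewrite coef_map.
    move: h1; rewrite eg mulr_suml mulr_sumr (bigD1 (Ordinal ld)) //= rpredDr.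
      move=> h; suff -> : i g`_l * (t ^+ d.-1 / p%:R) =
        t ^+ (d.-1 - l) * (i g`_l * t ^+ l / p%:R) by [].
      have -> : t ^+ d.-1 = t ^+ (d.-1 - l) * t ^+ l by rewrite -exprD subnK // -ltnS prednK.
      by ring.
    apply: rpred_sum => j; rewrite -(inj_eq val_inj) /= => jl.
    have [lt|ge] := ltnP j l.
      apply: rpredM; first by apply: rpredX; exact: eisenstein_root_integer.
      rewrite mulrAC; apply: rpredM.
        by rewrite -[p%:R]expr1 (div_p_base hv) // IH.
      by apply: rpredX; exact: eisenstein_root_integer.
    have -> : t ^+ (d.-1 - l) * (i g`_j * t ^+ j / p%:R) =
       i g`_j * (t ^+ (d.-1 - l + j) / p%:R) by rewrite exprD; ring.
    apply: rpredM; first by rewrite integers_base.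
    apply: eisenstein_expn_div_p; lia.
  have h3 : t ^+ d.-1 / p%:R \in O.
    rewrite -[_ / _](mulKf (x := i g`_l)) ?fmorph_eq0 //; apply: rpredM => //.
    by rewrite -fmorphV integers_base val_ge_neq0 ?invr_neq0 // valV // vgl.
  (* With t^(d-1)/p integral, dividing P(t) = 0 by p puts P_0/p into the maximal ideal, so p^2
     divides P_0. *)
  suff : i (P`_0 / p%:R) \in N.
    by rewrite nilp_base // (val_ge_div hv) // v_p => h; rewrite h in hP0.
  pose S := \sum_(j < d.-1) i P`_j.+1 * t ^+ j.
  have -> : i (P`_0 / p%:R) = - (t ^+ d.-1 / p%:R + S / p%:R) * t.
    have := eisenstein_root_expn; rewrite -(prednK d_gt0) big_ord_recl /= expr0 mulr1.
    have -> : \sum_(j < d.-1) i P`_(bump 0 j) * t ^+ bump 0 j = S * t.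
      rewrite mulr_suml; apply: eq_bigr => j _.
      by rewrite /bump /= add1n exprSr mulrA.
    rewrite exprSr => h; apply: (mulIf pC_neq0).
    rewrite fmorph_div rmorph_nat divfK //.
    have -> : - (t ^+ d.-1 / p%:R + S / p%:R) * t * p%:R =
      - (t ^+ d.-1 * t + S * t) * (p%:R / p%:R) by ring.
    by rewrite h divff // mulr1 opprD opprK addrK.
  apply: nilpM; last exact: eisenstein_root_nilp.
  rewrite rpredN; apply: rpredD => //; rewrite mulr_suml; apply: rpred_sum => j _.
  rewrite mulrAC; apply: rpredM; first by
    apply: eisenstein_coef_div_p; have := ltn_ord j; rewrite -ltnS (prednK d_gt0).
  by apply: rpredX; exact: eisenstein_root_integer.
(* A denominator p^s is removed one factor p at a time; the sum of the |v(f_j)| is a crude bound for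
   s. *)
move=> sf hf; suff Hs s (g : {poly F}) : (size g <= d)%N ->
    (map_poly i g).[t] \in O -> (forall l, val_ge v (- s%:Z) g`_l) ->
    forall l, val_ge v 0 g`_l.
  apply: (Hs (\sum_(j < size f) `|v f`_j|)%N) => // l.
  have [lf|fl] := ltnP l (size f); last by rewrite nth_default ?val_ge0.
  rewrite /val_ge; apply/orP; right.
  by rewrite (bigD1 (Ordinal lf)) //=; lia.
elim: s g => [|s IH] g sg hg h; first exact: h.
have vps n : v (p%:R ^+ n) = n%:Z by rewrite valX // v_p mulr1.
apply: IH => // l; have hl := h l; have : val_ge v 1 (p%:R ^+ s.+1 *: g)`_l.
  apply: H => [||l'].
  - by rewrite (leq_trans (size_scale_leq _ _)).
  - rewrite map_polyZ hornerZ rmorphXn rmorph_nat /= exprSr mulrAC mulfK //.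
    by apply: rpredM => //; apply: rpredX; apply: rpred_nat.
  - have hp : val_ge v s.+1%:Z (p%:R ^+ s.+1) by rewrite val_ge_neq0 ?expf_neq0 // vps.
    by have := val_geM hv hp (h l'); rewrite subrr coefZ.
rewrite coefZ; have [->|gl0] := eqVneq g`_l 0; first by rewrite val_ge0.
rewrite !val_ge_neq0 ?mulf_neq0 ?expf_neq0 // (valuationM hv) ?expf_neq0 //.
by rewrite vps; move: (v _) => z; lia.
Qed.

(** The remainder of g modulo P vanishes at t, and so do all its multiples by p^(-n); these have
    integral coefficients for every n, so the remainder is 0. *)
Lemma eisenstein_minimal (g : {poly F}) : root (map_poly i g) t -> P %| g.
Proof.
move=> hg; have P0 := monic_neq0 P_monic; rewrite /dvdp -size_poly_eq0.
rewrite size_poly_eq0; apply/eqP/polyP => l; rewrite coef0.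
have sr : (size (g %% P)%R <= d)%N by rewrite -ltnS -size_P ltn_modp.
have hr : (map_poly i (g %% P)).[t] = 0.
  have := divp_eq g P => /(congr1 (fun q => (map_poly i q).[t])).
  rewrite rmorphD rmorphM /= hornerD hornerM (rootP Pt) (rootP hg) mulr0 add0r.
  by move=> <-.
apply: (@val_ge_inf _ v) => n.
have := @eisenstein_integral ((p%:R ^+ n)^-1 *: (g %% P)) _ _ l.
rewrite coefZ mulrC (val_ge_div hv) ?expf_neq0 // valX // v_p add0r mulr1; apply.
  by rewrite (leq_trans (size_scale_leq _ _)).
by rewrite map_polyZ hornerZ hr mulr0 rpred0.
Qed.

End Eisenstein.

(** * Dwork's congruences *)

Lemma deriv_prod (R : comNzRingType) (I : finType) (P : I -> {poly R}) :
  (\prod_i P i)^`() = \sum_i (P i)^`() * \prod_(j | j != i) P j.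
Proof.
suff H (r : seq I) : uniq r -> (\prod_(i <- r) P i)^`() =
    \sum_(i <- r) (P i)^`() * \prod_(j <- r | j != i) P j.
  by have := H _ (index_enum_uniq I).
elim: r => [|k r IH] /=; first by rewrite !big_nil derivC.
move=> /andP[kr ur]; rewrite !big_cons derivM IH // eqxx /= mulr_sumr.
congr (_ * _ + _).
  rewrite [LHS]big_seq [RHS]big_seq_cond; apply: eq_bigl => j.
  by have [->|//] := eqVneq j k; rewrite ?andbT ?andbF ?(negPf kr) // andbT.
rewrite big_seq [RHS]big_seq; apply: eq_bigr => j jr; rewrite big_cons.
have -> : k != j by apply: contraNneq kr => ->.
by rewrite mulrCA.
Qed.

Lemma comp_poly_scaleX (R : comNzRingType) (c : R) (g : {poly R}) l :
  (g \Po (c *: 'X))`_l = c ^+ l * g`_l.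
Proof.
rewrite comp_polyE coef_sum.
under eq_bigr do rewrite exprZn coefZ coefZ coefXn.
have [lg|gl] := ltnP l (size g); last first.
  rewrite (nth_default 0 gl) mulr0 big1 // => j _.
  by rewrite gtn_eqF ?mulr0 // (leq_trans (ltn_ord j)).
rewrite (bigD1 (Ordinal lg)) //= eqxx mulr1 mulrC big1 ?addr0 // => j.
by rewrite -(inj_eq val_inj) /= eq_sym => /negPf ->; rewrite !mulr0.
Qed.

Section Dwork.
Variables (C : fieldType) (S : subringClosed C).
Variables (q : nat).
Let p := q.+1.
Hypothesis p_prime : prime p.
Variable om : C.
Hypothesis om_prim : p.-primitive_root om.
Hypothesis om_S : om \in S.

Definition twist (a : nat) (f : {poly C}) := f \Po (om ^+ a *: 'X).
HB.instance Definition _ a := GRing.RMorphism.copy (twist a) (comp_poly (om ^+ a *: 'X)).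

Lemma coef_twist a f l : (twist a f)`_l = om ^+ (a * l) * f`_l.
Proof. by rewrite /twist comp_poly_scaleX exprM. Qed.

Lemma twist_twist (a b : 'I_p) f : twist a (twist b f) = twist (a + b)%R f.
Proof.
apply/polyP => l; rewrite !coef_twist mulrA -exprD /=.
by congr (_ * _); rewrite -mulnDl exprM [RHS]exprM (prim_expr_mod om_prim).
Qed.

Lemma twist_polyOver a f : f \is a polyOver S -> twist a f \is a polyOver S.
Proof.
by move=> hf; rewrite polyOver_comp // polyOverZ ?polyOverX ?rpredX.
Qed.

Lemma sum_twist (f : {poly C}) :
  \sum_(a < p) twist a f = p%:R *: \poly_(l < size f) (if (p %| l)%N then f`_l else 0).
Proof.
apply/polyP => l; rewrite coef_sum coefZ coef_poly.
under eq_bigr do rewrite coef_twist.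
case: ltnP => [lf|fl]; last first.
  by rewrite mulr0 big1 // => a _; rewrite nth_default ?mulr0.
rewrite -mulr_suml; case: ifP => [|/negbT] pl.
  rewrite (eq_bigr (fun=> 1)) ?sumr_const ?card_ord // => a _.
  by apply/eqP; rewrite -(prim_order_dvd om_prim) dvdn_mull.
rewrite mulr0 (eq_bigr (fun a : 'I_p => (om ^+ l) ^+ a)) => [|a _]; last first.
  by rewrite -exprM mulnC.
apply/eqP; rewrite mulf_eq0; apply/orP; left.
have h : om ^+ l - 1 != 0 by rewrite subr_eq0 -(prim_order_dvd om_prim).
rewrite -(mulrI_eq0 _ (mulfI h)) -subrX1.
by rewrite -exprM mulnC exprM (prim_expr_order om_prim) expr1n subrr.
Qed.

Definition twist_prod (f : {poly C}) := \prod_(a < p) twist a f.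

(* Dwork's operator: (norm_op f)(X^p) is the product of the f(om^a X).           *)
Definition norm_op (f : {poly C}) : {poly C} :=
  \poly_(l < size (twist_prod f)) (twist_prod f)`_(p * l).

Lemma coef_norm_op f l : (norm_op f)`_l = (twist_prod f)`_(p * l).
Proof.
rewrite coef_poly; case: ltnP => // h; rewrite nth_default //.
by rewrite (leq_trans h) // leq_pmull.
Qed.

Lemma twist_prod_polyOver f : f \is a polyOver S -> twist_prod f \is a polyOver S.
Proof. by move=> hf; apply: rpred_prod => a _; apply: twist_polyOver. Qed.

Lemma norm_op_polyOver f : f \is a polyOver S -> norm_op f \is a polyOver S.
Proof.
move=> /twist_prod_polyOver/polyOverP h; apply/polyOverP => l.
by rewrite coef_norm_op.
Qed.

Lemma twist_prod_invariant f (b : 'I_p) : twist b (twist_prod f) = twist_prod f.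
Proof.
rewrite /twist_prod rmorph_prod [RHS](reindex_inj (addrI b)).
by apply: eq_bigr => a _; rewrite /= twist_twist.
Qed.

(** The product of all twists is invariant under X -> om X, so only exponents divisible by p
    survive. *)
Lemma twist_prodE f : twist_prod f = norm_op f \Po 'X^p.
Proof.
apply/polyP => l; rewrite coef_comp_poly_Xn // coef_norm_op.
have p_gt1 := prime_gt1 p_prime.
case: ifP => [pl|/negbT pl]; first by rewrite mulnC divnK.
have := congr1 (fun g : {poly C} => g`_l) (twist_prod_invariant f (Ordinal p_gt1)).
rewrite coef_twist mul1n -[RHS]mul1r => /eqP.
rewrite -subr_eq0 -mulrBl mulf_eq0 subr_eq0 -(prim_order_dvd om_prim) (negPf pl).
by move/eqP.
Qed.

Lemma horner_norm_op f y : (norm_op f).[y ^+ p] = \prod_(a < p) f.[om ^+ a * y].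
Proof.
have := congr1 (fun g => g.[y]) (twist_prodE f).
rewrite horner_comp hornerXn => <-; rewrite horner_prod.
by apply: eq_bigr => a _; rewrite horner_comp hornerZ hornerX.
Qed.

(** The outer variable stands for z in the product of the twists of f + z g; its coefficients
    separate the powers of z. *)
Definition twist_mix (f g : {poly C}) : {poly {poly C}} :=
  \prod_(a < p) ((twist a f)%:P + (twist a g) *: 'X).

Lemma horner_twist_mix f g z :
  (twist_mix f g).[z%:P] = twist_prod (f + z *: g).
Proof.
rewrite horner_prod; apply: eq_bigr => a _.
rewrite hornerD hornerC hornerZ hornerX rmorphD /=; congr (_ + _).
by rewrite /twist linearZ /= mulrC mul_polyC.
Qed.

Lemma size_twist_factor (u w : {poly C}) :
  (size (u%:P + w *: 'X)%R <= 2)%N.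
Proof.
rewrite (leq_trans (size_polyD _ _)) // geq_max (leq_trans (size_polyC_leq1 _)) //.
by rewrite (leq_trans (size_scale_leq _ _)) // size_polyX.
Qed.

Lemma size_twist_mix f g : (size (twist_mix f g) <= p.+1)%N.
Proof.
have [|h _] := @coef_prod_top _ p 1 (fun a : 'I_p => (twist a f)%:P + (twist a g) *: 'X).
  by move=> a; apply: size_twist_factor.
by rewrite muln1 in h.
Qed.

Lemma coef_twist_mix_top f g : (twist_mix f g)`_p = twist_prod g.
Proof.
have [|_ h] := @coef_prod_top _ p 1 (fun a : 'I_p => (twist a f)%:P + (twist a g) *: 'X).
  by move=> a; apply: size_twist_factor.
rewrite muln1 in h; rewrite h; apply: eq_bigr => a _.
by rewrite coefD coefC coefZ coefX mulr1 add0r.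
Qed.

Lemma coef_twist_mix_0 f g : (twist_mix f g)`_0 = twist_prod f.
Proof.
by rewrite -horner_coef0 -[0]/(0%:P) horner_twist_mix scale0r addr0.
Qed.

Let polyOver2 (G : {poly {poly C}}) := forall r, G`_r \is a polyOver S.

Let polyOver2M G H : polyOver2 G -> polyOver2 H -> polyOver2 (G * H).
Proof. by move=> hG hH r; rewrite coefM rpred_sum // => l _; rewrite rpredM. Qed.

Let polyOver2_prod (P : pred 'I_p) (G : 'I_p -> {poly {poly C}}) :
  (forall a, polyOver2 (G a)) -> polyOver2 (\prod_(a | P a) G a).
Proof.
move=> hG; elim/big_rec: _ => [r|a H _ hH]; last exact: polyOver2M.
by rewrite coef1; case: eqP => _; rewrite ?rpred1 ?rpred0.
Qed.

(* Euler's relation: the derivative in the mixing variable is a trace.         *)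
Lemma deriv_twist_mix f g :
  let D := g%:P * \prod_(b < p | b != ord0) ((twist b f)%:P + (twist b g) *: 'X) in
  (twist_mix f g)^`() = \sum_(a < p) map_poly (twist a) D.
Proof.
move=> D; rewrite deriv_prod; apply: eq_bigr => a _.
rewrite derivD derivC add0r derivZ derivX /D rmorphM /= map_polyC /=.
rewrite -alg_polyC; congr (_ * _).
rewrite rmorph_prod [LHS](reindex_inj (addrI a)) /=.
apply: eq_big => [b|b _]; first by rewrite -subr_eq0 addrC addKr.
by rewrite rmorphD /= map_polyC map_polyZ map_polyX /= !twist_twist.
Qed.

(** By [deriv_twist_mix], r times the coefficient is a sum over all twists, hence divisible by p
    ([sum_twist]); r is invertible modulo p, with inverse u. *)
Lemma coef_twist_mix_mid f g r : f \is a polyOver S -> g \is a polyOver S ->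
  (0 < r < p)%N -> exists2 E, E \is a polyOver S & (twist_mix f g)`_r = p%:R *: E.
Proof.
move=> hf hg /andP[r0 rp].
pose D := g%:P * \prod_(b < p | b != ord0) ((twist b f)%:P + (twist b g) *: 'X).
have hfac (a : nat) : polyOver2 ((twist a f)%:P + (twist a g) *: 'X).
  move=> l; rewrite coefD coefC coefZ coefX mulr_natr rpredD ?rpredMn //.
    by case: eqP => _; rewrite ?rpred0 // twist_polyOver.
  by rewrite twist_polyOver.
have hD : polyOver2 D.
  apply: polyOver2M; last exact: polyOver2_prod.
  by move=> l; rewrite coefC; case: eqP => _; rewrite ?rpred0.
have hG : polyOver2 (twist_mix f g) by exact: polyOver2_prod.
have hr : (twist_mix f g)`_r *+ r = \sum_(a < p) twist a D`_r.-1.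
  have : (twist_mix f g)^`() = \sum_(a < p) map_poly (twist a) D.
    exact: deriv_twist_mix.
  move/(congr1 (fun P : {poly {poly C}} => P`_r.-1)).
  rewrite coef_deriv prednK // coef_sum => ->.
  by apply: eq_bigr => a _; rewrite coef_map.
rewrite sum_twist in hr; set h := \poly_(l < _) _ in hr.
have hh : h \is a polyOver S.
  apply: polyOver_poly => l _; case: ifP => _; last exact: rpred0.
  by have /polyOverP := hD r.-1.
have cop : coprime r p by rewrite coprime_sym prime_coprime // gtnNdvd.
have [u hu] : exists u, (u * r = (u * r) %/ p * p + 1)%N.
  have pr : coprime p r by rewrite coprime_sym.
  have /dvdnP [u hu] : (r %| chinese p r 1 0)%N.
    by rewrite /dvdn (chinese_modr pr) mod0n.
  exists u; rewrite -hu {1}(divn_eq (chinese p r 1 0) p).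
  by rewrite (chinese_modl pr) modn_small // prime_gt1.
pose e := (twist_mix f g)`_r.
have he : e \is a polyOver S by exact: hG.
exists ((u%:R *: h) - ((u * r) %/ p)%:R *: e).
  by rewrite rpredB ?polyOverZ ?rpred_nat.
have -> : p%:R *: (u%:R *: h - (u * r %/ p)%:R *: e) =
    u%:R *: (p%:R *: h) - (p%:R * (u * r %/ p)%:R) *: e.
  by rewrite scalerBr !scalerA [u%:R * _]mulrC.
rewrite -hr -/e -scaler_nat scalerA -natrM -natrM -scalerBl {1}hu -natrB.
  by rewrite [(p * _)%N]mulnC addKn scale1r.
by rewrite mulnC leq_addr.
Qed.

Lemma norm_op_add f g z : f \is a polyOver S -> g \is a polyOver S -> z \in S ->
  exists2 E, E \is a polyOver S &
  norm_op (f + z *: g) = norm_op f + z ^+ p *: norm_op g + (z * p%:R) *: E.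
Proof.
move=> hf hg hz.
have hE r : exists E, E \is a polyOver S /\
    ((0 < r < p)%N -> (twist_mix f g)`_r = p%:R *: E).
  have [hr|hr] := boolP (0 < r < p)%N; last by exists 0; rewrite rpred0.
  by have [E h1 h2] := coef_twist_mix_mid hf hg hr; exists E.
have [E hE'] := choice hE.
pose T := \sum_(0 <= r < q) z ^+ r *: E r.+1.
have hT : T \is a polyOver S.
  by apply: rpred_sum => r _; rewrite polyOverZ ?rpredX //; apply: (hE' _).1.
have key : twist_prod (f + z *: g) =
    twist_prod f + z ^+ p *: twist_prod g + (z * p%:R) *: T.
  rewrite -horner_twist_mix (horner_coef_wide _ (size_twist_mix f g)).
  rewrite big_ord_recl /= expr0 mulr1 coef_twist_mix_0 -addrA; congr (_ + _).
  rewrite big_ord_recr /= /bump /= add1n coef_twist_mix_top addrC.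
  rewrite -rmorphXn mulrC mul_polyC; congr (_ + _).
  rewrite /T big_mkord scaler_sumr; apply: eq_bigr => r _.
  rewrite add1n (hE' r.+1).2 //=; last by rewrite ltnS ltn_ord.
  by rewrite -rmorphXn mulrC mul_polyC !scalerA exprS; congr (_ *: _); ring.
exists (\poly_(l < size T) T`_(p * l)).
  by apply: polyOver_poly => l _; move/polyOverP: hT.
apply/polyP => l; rewrite coef_norm_op key !coefD !coefZ !coef_norm_op coef_poly.
case: ltnP => // h; rewrite (@nth_default _ _ T) //.
by rewrite (leq_trans h) // leq_pmull.
Qed.

Definition poly_congr (k : nat) (f g : {poly C}) : Prop :=
  exists2 E, E \is a polyOver S & f = g + p%:R ^+ k *: E.

(** In [norm_op_add] with z = p^k the error terms carry z^p and z p, and k p >= k + 1. *)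
Lemma norm_op_congr k f g : (0 < k)%N -> g \is a polyOver S ->
  poly_congr k f g -> poly_congr k.+1 (norm_op f) (norm_op g).
Proof.
move=> k0 hg [E hE ->]; have pk : p%:R ^+ k \in S by rewrite rpredX ?rpred_nat.
have [E' hE' ->] := norm_op_add hg hE pk.
have p1 := prime_gt1 p_prime.
have kp : (k.+1 <= k * p)%N.
  have : (k * 2 <= k * p)%N by rewrite leq_mul2l p1 orbT.
  by lia.
exists (p%:R ^+ (k * p - k.+1) *: norm_op E + E').
  by rewrite rpredD ?polyOverZ ?norm_op_polyOver ?rpredX ?rpred_nat.
rewrite scalerDr scalerA -exprD subnKC // -exprM -exprSr; apply/eqP.
by rewrite addrA.
Qed.

Lemma norm_opM f g : norm_op (f * g) = norm_op f * norm_op g.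
Proof.
have h : twist_prod (f * g) = twist_prod f * twist_prod g.
  by rewrite /twist_prod -big_split; apply: eq_bigr => a _; rewrite rmorphM.
rewrite !twist_prodE -rmorphM /= in h.
apply/polyP => l; have := congr1 (fun P : {poly C} => P`_(l * p)) h.
by rewrite !coef_comp_poly_Xn // dvdn_mull // mulnK.
Qed.

Lemma norm_opC c : norm_op c%:P = (c ^+ p)%:P.
Proof.
have h : twist_prod c%:P = (c ^+ p)%:P.
  rewrite /twist_prod (eq_bigr (fun=> c%:P)) => [|a _].
    by rewrite prodr_const card_ord rmorphXn.
  exact: comp_polyC.
apply/polyP => l; rewrite coef_norm_op h !coefC.
by rewrite muln_eq0.
Qed.

(** The exact value is (-1)^(p+1) X, which differs from X only for p = 2, by a multiple of 2. *)
Lemma norm_opX : poly_congr 1 (norm_op 'X) 'X.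
Proof.
have h : twist_prod 'X = (\prod_(a < p) om ^+ a) *: 'X^p.
  rewrite /twist_prod (eq_bigr (fun a : 'I_p => om ^+ a *: 'X)) => [|a _].
    by rewrite scaler_prod prodr_const card_ord.
  exact: comp_polyX.
have hp : \prod_(a < p) om ^+ a = (-1) ^+ p.+1.
  have := congr1 (fun P : {poly C} => P.[0]) (factor_Xn_sub_1 om_prim).
  rewrite hornerD hornerXn hornerN hornerC expr0n sub0r big_mkord horner_prod.
  rewrite (eq_bigr (fun a : 'I_p => (-1) * om ^+ a)) => [|a _].
    rewrite big_split prodr_const card_ord /= => hh.
    by rewrite exprSr -[X in _ * X]hh mulrA -exprMn mulrNN mulr1 expr1n mul1r.
  by rewrite hornerXsubC sub0r mulN1r.
have hN : norm_op 'X = (-1) ^+ p.+1 *: 'X.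
  apply/polyP => l; rewrite coef_norm_op h hp !coefZ coefXn coefX.
  by have -> : (p * l == p)%N = (l == 1)%N by rewrite -[X in _ == X]muln1 eqn_pmul2l.
case: (even_prime p_prime) => [p2|podd].
  exists (- 'X); first by rewrite rpredN polyOverX.
  have p2C : p%:R = 2 :> C by rewrite p2.
  have -> : norm_op 'X = - 'X by rewrite hN p2 !exprS expr0 !mulN1r opprK scaleN1r.
  by rewrite expr1 p2C scalerN scaler_nat mulr2n opprD addrA subrr add0r.
exists 0; first exact: rpred0.
by rewrite hN exprS -signr_odd podd expr1 mulN1r opprK scale1r scaler0 addr0.
Qed.

(** Induction along Horner's scheme: modulo p the operator is additive, multiplicative, fixes X and
    acts on constants by c -> c^p. *)
Lemma norm_op_frobenius f : f \is a polyOver S ->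
  (forall l, exists2 e, e \in S & f`_l ^+ p = f`_l + p%:R * e) ->
  poly_congr 1 (norm_op f) f.
Proof.
elim/poly_ind: f => [|f c IH] hf hc.
  by exists 0; rewrite ?rpred0 // scaler0 addr0 -[0]/(0%:P) norm_opC expr0n.
have hcc : c \in S by move/polyOverP: hf => /(_ 0%N); rewrite coefD coefMX coefC add0r.
have hff : f \is a polyOver S.
  by apply/polyOverP => l; move/polyOverP: hf => /(_ l.+1);
    rewrite coefD coefMX coefC addr0.
have [|E1 hE1 h1] := IH hff.
  by move=> l; have := hc l.+1; rewrite coefD coefMX coefC addr0.
have [E2 hE2 h2] := norm_opX.
have [e he h3] : exists2 e, e \in S & c ^+ p = c + p%:R * e.
  by have := hc 0%N; rewrite coefD coefMX coefC add0r.
have hfX : f * 'X \is a polyOver S by rewrite rpredM ?polyOverX.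
have hcP : c%:P \is a polyOver S by rewrite polyOverC.
have [E hE] := norm_op_add hfX hcP (rpred1 S).
rewrite scale1r => ->; rewrite norm_opM norm_opC h1 h2 h3 !expr1 expr1n scale1r mul1r.
exists (E1 * 'X + f * E2 + p%:R *: (E1 * E2) + e%:P + E).
  by rewrite !rpredD ?polyOverZ ?rpredM ?polyOverX ?polyOverC ?rpred_nat.
rewrite -!mul_polyC !rmorphD /= !rmorphM /=; ring.
Qed.

Lemma iter_norm_op_polyOver n f : f \is a polyOver S ->
  iter n norm_op f \is a polyOver S.
Proof. by move=> hf; elim: n => //= n IH; apply: norm_op_polyOver. Qed.

Lemma iter_norm_op_congr n k f g : (0 < k)%N -> g \is a polyOver S ->
  poly_congr k f g -> poly_congr (n + k) (iter n norm_op f) (iter n norm_op g).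
Proof.
move=> k0 hg hfg; elim: n => [|n IH] //=; apply: norm_op_congr => //.
  by rewrite addn_gt0 k0 orbT.
exact: iter_norm_op_polyOver.
Qed.

Variable z : nat -> C.
Hypothesis z_zero : z 0 = 1.
Hypothesis z_one : z 1 = om.
Hypothesis z_expp : forall n, z n.+1 ^+ p = z n.

Lemma z_exp_pn n m : z (n + m) ^+ (p ^ n) = z m.
Proof. by elim: n => [|n IH]; rewrite ?expr1 // addSn expnS exprM z_expp. Qed.

Lemma horner_iter_norm_op n f y :
  (iter n norm_op f).[y ^+ (p ^ n)] = \prod_(a < p ^ n) f.[z n ^+ a * y].
Proof.
elim: n f y => [|n IH] f y.
  by rewrite /= expr1 big_ord1 expr0 mul1r.
rewrite iterSr expnS exprM IH.
have -> : \prod_(a < p * p ^ n) f.[z n.+1 ^+ a * y] =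
    \prod_(b < p) \prod_(a < p ^ n) f.[z n.+1 ^+ (b * p ^ n + a) * y].
  rewrite -(big_mkord xpredT (fun a => f.[z n.+1 ^+ a * y])) big_nat_mul big_mkord.
  apply: eq_bigr => b _; rewrite -{1}[(b * p ^ n)%N]add0n mulSn big_addn addnK.
  by rewrite big_mkord; apply: eq_bigr => a _; rewrite addnC.
rewrite exchange_big /=; apply: eq_bigr => a _.
have -> : z n ^+ a * y ^+ p = (z n.+1 ^+ a * y) ^+ p.
  by rewrite exprMn -exprM mulnC exprM z_expp.
rewrite horner_norm_op; apply: eq_bigr => b _.
have -> : om ^+ b = z n.+1 ^+ (b * p ^ n) by rewrite mulnC exprM -addn1 z_exp_pn z_one.
by rewrite exprD mulrA.
Qed.

Definition root_prod n (f : {poly C}) := \prod_(a < p ^ n) f.[z n ^+ a].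

Lemma root_prodE n f : root_prod n f = (iter n norm_op f).[1].
Proof.
rewrite -(expr1n _ (p ^ n)) horner_iter_norm_op.
by apply: eq_bigr => a _; rewrite mulr1.
Qed.

Lemma root_prod_congr1 n f : poly_congr 1 f 1 ->
  exists2 e, e \in S & root_prod n f = 1 + p%:R ^+ n.+1 * e.
Proof.
move=> h; have [|E hE] := @iter_norm_op_congr n 1 f 1 isT _ h; first exact: rpred1.
have -> : iter n norm_op 1 = 1.
  by elim: n {hE} => //= n ->; rewrite -[1]/(1%:P) norm_opC expr1n.
rewrite root_prodE addn1 => ->; exists E.[1].
  by rewrite rpred_horner ?rpred1.
by rewrite hornerD hornerZ hornerC.
Qed.

(** Dwork's congruence: iterate n times the congruence of [norm_op f] and f modulo p, gaining one
    power of p each time, and evaluate at 1. *)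
Lemma root_prod_succ n f : f \is a polyOver S ->
  (forall l, exists2 e, e \in S & f`_l ^+ p = f`_l + p%:R * e) ->
  exists2 e, e \in S & root_prod n.+1 f = root_prod n f + p%:R ^+ n.+1 * e.
Proof.
move=> hf hc; have h := norm_op_frobenius hf hc.
have [E hE h'] := @iter_norm_op_congr n 1 _ _ isT hf h.
exists E.[1]; first by rewrite rpred_horner ?rpred1.
by rewrite !root_prodE iterSr h' addn1 hornerD hornerZ.
Qed.

Lemma root_prod_congr_horner1 n f : f \is a polyOver S ->
  (forall l, exists2 e, e \in S & f`_l ^+ p = f`_l + p%:R * e) ->
  exists2 e, e \in S & root_prod n f = f.[1] + p%:R * e.
Proof.
move=> hf hc; elim: n => [|n [e he h]].
  by exists 0; rewrite ?rpred0 // /root_prod big_ord1 expr0 mulr0 addr0.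
have [e' he' ->] := root_prod_succ n hf hc.
exists (e + p%:R ^+ n * e'); first by rewrite rpredD ?rpredM ?rpredX ?rpred_nat.
by rewrite h exprS; ring.
Qed.

End Dwork.

(** * Cyclotomic extensions of Q_p *)

Section CyclotomicPoly.
Variables (q : nat).
Let p := q.+1.
Hypothesis p_prime : prime p.

(* cyclo R n is the cyclotomic polynomial of index p^(n + 1).                    *)
Definition cyclo (R : nzRingType) (n : nat) : {poly R} := \sum_(a < p) 'X^(p ^ n) ^+ a.

Lemma cycloM (R : comNzRingType) n :
  cyclo R n * ('X^(p ^ n) - 1) = 'X^(p ^ n.+1) - 1.
Proof. by rewrite mulrC -subrX1 -exprM expnSr. Qed.

Lemma map_cyclo (R R' : nzRingType) (f : {rmorphism R -> R'}) n :
  map_poly f (cyclo R n) = cyclo R' n.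
Proof.
rewrite rmorph_sum; apply: eq_bigr => a _.
by rewrite rmorphXn /= map_polyXn.
Qed.

Lemma monic_cyclo (R : idomainType) n : cyclo R n \is monic.
Proof.
have h m : 'X^(p ^ m) - 1 \is @monic R by rewrite monicXnsubC // expn_gt0.
by rewrite -(monicMr _ (h n)) cycloM.
Qed.

Lemma size_cyclo (R : idomainType) n : size (cyclo R n) = (p ^ n * q).+1.
Proof.
have h m : size ('X^(p ^ m) - 1 : {poly R}) = (p ^ m).+1.
  by rewrite size_XnsubC // expn_gt0.
have m0 : 'X^(p ^ n) - 1 != 0 :> {poly R} by rewrite -size_poly_eq0 h.
have := congr1 (fun P : {poly R} => size P) (cycloM R n).
rewrite size_monicM ?monic_cyclo // h size_XnsubC ?expn_gt0 // expnS mulSn.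
by move: (size _) => s; rewrite [(p ^ n * q)%N]mulnC; lia.
Qed.

(** In characteristic p, (X + 1)^(p^n) - 1 is X^(p^n), so the defining quotient becomes a quotient
    of powers of X. *)
Lemma cyclo_shift_Fp n : cyclo 'F_p n \Po ('X + 1) = 'X^(p ^ n * q).
Proof.
have pc : p \in [pchar {poly 'F_p}] by rewrite pchar_poly pchar_Fp.
have frob m : ('X + 1 : {poly 'F_p}) ^+ (p ^ m) = 'X^(p ^ m) + 1.
  by rewrite exprDn_pchar ?expr1n // pnatX pnatE // pc.
have h := congr1 (fun P => P \Po ('X + 1)) (cycloM 'F_p n).
have m0 : 'X^(p ^ n) != 0 :> {poly 'F_p} by rewrite -size_poly_eq0 size_polyXn.
apply: (mulIf m0); move: h; rewrite rmorphM !rmorphB !rmorph1 !rmorphXn /=.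
rewrite comp_polyX !frob !addrK => ->.
by rewrite -exprD addnC -mulnS mulnC expnS.
Qed.

Lemma cyclo_shift_coef n l : (l < p ^ n * q)%N ->
  (p %| (cyclo int n \Po ('X + 1))`_l)%Z.
Proof.
move=> hl; have := congr1 (fun P : {poly 'F_p} => P`_l) (cyclo_shift_Fp n).
have -> : cyclo 'F_p n \Po ('X + 1) = map_poly intr (cyclo int n \Po ('X + 1)).
  by rewrite map_comp_poly map_cyclo rmorphD rmorph1 /= map_polyX.
rewrite coefXn ltn_eqF //= coef_map => h.
by rewrite (dvdz_pcharf (pchar_Fp p_prime)); apply/eqP.
Qed.

Lemma cyclo_shift_coef0 n : (cyclo int n \Po ('X + 1))`_0 = p%:Z.
Proof.
rewrite -horner_coef0 horner_comp !hornerE horner_sum.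
rewrite (eq_bigr (fun=> 1)) => [|a _]; last by rewrite !hornerE !expr1n.
by rewrite sumr_const card_ord; rewrite -mulr_natr mul1r; apply/eqP; rewrite natz.
Qed.

End CyclotomicPoly.

Section CyclotomicExtension.
Variables (q : nat).
Let p := q.+1.
Hypothesis p_prime : prime p.
Variables (Qp : fieldType) (vp : Qp -> int) (iQ : {rmorphism rat -> Qp}).
Hypothesis Qp_completion : is_completion (padic_val p) vp iQ.
Variables (C : closedFieldType) (i : {rmorphism Qp -> C}).

Let hv : is_valuation vp := completion_valuation Qp_completion.
Let p_neq0_Qp : p%:R != 0 :> Qp := padic_natr_neq0 iQ (prime_gt0 p_prime).
Let v_p : vp p%:R = 1 := padic_val_p p_prime Qp_completion.
Local Notation O := (integers hv i).
Local Notation N := (nilp p hv i).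

Variable z : nat -> C.
Hypothesis z_zero : z 0 = 1.
Hypothesis z_one : z 1 != 1.
Hypothesis z_expp : forall n, z n.+1 ^+ p = z n.

Lemma zeta_exp_pn n m : z (n + m) ^+ (p ^ n) = z m.
Proof. by elim: n => [|n IH]; rewrite ?expr1 // addSn expnS exprM z_expp. Qed.

Lemma zeta_unity n : z n ^+ (p ^ n) = 1.
Proof. by rewrite -[n in z n]addn0 zeta_exp_pn. Qed.

Lemma zeta_prim n : (p ^ n).-primitive_root (z n).
Proof.
have pn0 : (0 < p ^ n)%N by rewrite expn_gt0.
have [d hd hdn] := prim_order_exists pn0 (zeta_unity n).
suff -> : (p ^ n)%N = d by [].
have /(dvdn_pfactor _ _ p_prime) [b bn ed] := hdn.
have [bn1|nb] := ltnP b n; last by rewrite ed; congr (_ ^ _)%N; lia.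
case/eqP: z_one; rewrite -(zeta_exp_pn n.-1 1) addn1 prednK; last by lia.
by apply/eqP; rewrite -(prim_order_dvd hd) ed dvdn_exp2l //; lia.
Qed.

Lemma zeta_integer n : z n \in O.
Proof. by apply: (@integers_unity_root _ _ hv _ _ _ (p ^ n)); rewrite ?zeta_unity ?expn_gt0. Qed.

Lemma root_cyclo n : root (cyclo q C n) (z n.+1).
Proof.
have h := congr1 (fun P : {poly C} => P.[z n.+1]) (cycloM q C n).
rewrite hornerM !hornerE /= zeta_unity subrr in h.
apply/eqP; move/eqP: h; rewrite mulf_eq0 => /orP[/eqP //|].
rewrite -{1}[n.+1]addn1 zeta_exp_pn subr_eq0; by rewrite (negPf z_one).
Qed.

Definition shifted_cyclo n : {poly Qp} := cyclo q Qp n \Po ('X + 1).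

Lemma size_shifted_cyclo n : size (shifted_cyclo n) = (p ^ n * q).+1.
Proof. by rewrite size_comp_poly2 ?size_cyclo // -[1]/(1%:P) size_XaddC. Qed.

Lemma monic_shifted_cyclo n : shifted_cyclo n \is monic.
Proof.
have sX : size ('X + 1 : {poly Qp}) = 2 by rewrite -[1]/(1%:P) size_XaddC.
rewrite monicE /shifted_cyclo lead_coef_comp ?sX //.
rewrite (monicP (monic_cyclo q _ n)) mul1r lead_coefDl ?lead_coefX ?expr1n //.
by rewrite size_polyX size_polyC oner_neq0.
Qed.

Lemma coef_shifted_cyclo n l :
  (shifted_cyclo n)`_l = ((cyclo q int n \Po ('X + 1))`_l)%:~R.
Proof.
rewrite -(coef_map intr); congr (_`_l).
by rewrite map_comp_poly map_cyclo rmorphD rmorph1 /= map_polyX.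
Qed.

Lemma root_shifted_cyclo n : root (map_poly i (shifted_cyclo n)) (z n.+1 - 1).
Proof.
rewrite map_comp_poly map_cyclo rmorphD rmorph1 /= map_polyX /root horner_comp.
by rewrite !hornerE subrK; apply: root_cyclo.
Qed.

Let q_gt0 : (0 < q)%N.
Proof. by have := prime_gt1 p_prime. Qed.

Let size_gt1 n : (1 < size (shifted_cyclo n))%N.
Proof. by rewrite size_shifted_cyclo ltnS muln_gt0 expn_gt0. Qed.

Let coef_ge1 n l : (l < (size (shifted_cyclo n)).-1)%N ->
  val_ge vp 1 (shifted_cyclo n)`_l.
Proof.
rewrite size_shifted_cyclo coef_shifted_cyclo => hl.
by apply: (padic_val_ge_int p_prime Qp_completion); apply: cyclo_shift_coef.
Qed.

Let eisenstein n :
  size (shifted_cyclo n) = 2 \/ ~~ val_ge vp 2 (shifted_cyclo n)`_0.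
Proof.
right; rewrite coef_shifted_cyclo cyclo_shift_coef0 -[_%:~R]/(p%:R).
by rewrite val_ge_neq0 // v_p.
Qed.

Lemma cyclo_minimal n (g : {poly Qp}) :
  root (map_poly i g) (z n.+1) -> cyclo q Qp n %| g.
Proof.
move=> hg; suff : shifted_cyclo n %| g \Po ('X + 1).
  by move/(dvdp_comp_poly ('X - 1)); rewrite /shifted_cyclo !comp_polyXaddC_K.
apply: (eisenstein_minimal hv p_neq0_Qp v_p (monic_shifted_cyclo n) (size_gt1 n)
  (@coef_ge1 n) (eisenstein n) (root_shifted_cyclo n)).
rewrite map_comp_poly rmorphD rmorph1 /= map_polyX /root horner_comp.
by rewrite !hornerE subrK.
Qed.

(** z_(n+1) - 1 is a root of the Eisenstein polynomial [shifted_cyclo n]; reduce f(X + 1) modulo it,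
    apply [eisenstein_integral] and shift back. *)
Lemma cyclo_integral n (f : {poly Qp}) : (map_poly i f).[z n.+1] \in O ->
  exists2 g : {poly Qp}, g \is a polyOver (val_pred hv) &
    (map_poly i f).[z n.+1] = (map_poly i g).[z n.+1].
Proof.
move=> hf; pose r := (f \Po ('X + 1)) %% shifted_cyclo n.
have hr : (map_poly i r).[z n.+1 - 1] = (map_poly i f).[z n.+1].
  have := divp_eq (f \Po ('X + 1)) (shifted_cyclo n).
  move/(congr1 (fun P => (map_poly i P).[z n.+1 - 1])).
  rewrite rmorphD rmorphM /= hornerD hornerM (rootP (root_shifted_cyclo n)).
  rewrite mulr0 add0r -/r => <-.
  rewrite map_comp_poly rmorphD rmorph1 /= map_polyX horner_comp.
  by rewrite !hornerE subrK.
have hsr : (size r <= (size (shifted_cyclo n)).-1)%N.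
  by rewrite -ltnS prednK ?ltn_modp ?monic_neq0 ?monic_shifted_cyclo // ltnW.
have hint := eisenstein_integral (hv := hv) p_neq0_Qp v_p (monic_shifted_cyclo n) (size_gt1 n)
  (@coef_ge1 n) (eisenstein n) (root_shifted_cyclo n) hsr.
rewrite hr in hint; exists (r \Po ('X - 1)).
  apply: polyOver_comp; first by apply/polyOverP => l; apply: hint.
  by rewrite rpredB ?polyOverX ?rpred1.
rewrite map_comp_poly rmorphB rmorph1 /= map_polyX horner_comp.
by rewrite !hornerE hr.
Qed.

Lemma zeta_sub1_nilp n : z n.+1 - 1 \in nilp p hv i.
Proof.
exact: (eisenstein_root_nilp hv p_neq0_Qp v_p (monic_shifted_cyclo n) (size_gt1 n)
  (@coef_ge1 n) (root_shifted_cyclo n)).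
Qed.

Definition prim_roots n : seq C :=
  flatten [seq [seq z n.+1 ^+ (b * p + c.+1) | c <- iota 0 q] | b <- iota 0 (p ^ n)].

(** An exponent below p^(n+1) is either prime to p, giving a member of [prim_roots], or of the form
    p b, and z_(n+1)^(p b) = z_n^b. *)
Lemma prod_prim_roots (R : comNzRingType) (G : C -> R) n :
  \prod_(a < p ^ n.+1) G (z n.+1 ^+ a) =
  \prod_(t <- prim_roots n) G t * \prod_(a < p ^ n) G (z n ^+ a).
Proof.
rewrite -(big_mkord xpredT (fun a => G (z n.+1 ^+ a))) expnSr big_nat_mul.
rewrite -[X in _ = _ * X](big_mkord xpredT (fun a => G (z n ^+ a))).
rewrite /prim_roots big_flatten big_map /index_iota !subn0 -big_split /=.
apply: eq_bigr => b _; rewrite big_map -{1}[(b * p)%N]add0n mulSn big_addn addnK.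
rewrite /index_iota subn0 /= big_cons add0n mulrC -(zeta_exp_pn 1 n) add1n.
rewrite expn1 -exprM mulnC; congr (_ * _).
rewrite (iotaDl 1 0) big_map; apply: eq_bigr => c _.
by rewrite add1n addnC mulnC.
Qed.

Lemma cyclo_factor n :
  map_poly i (cyclo q Qp n) = \prod_(t <- prim_roots n) ('X - t%:P).
Proof.
have h m : \prod_(a < p ^ m) ('X - (z m ^+ a)%:P) = 'X^(p ^ m) - 1.
  rewrite -(big_mkord xpredT (fun a => 'X - (z m ^+ a)%:P)).
  exact: factor_Xn_sub_1 (zeta_prim m).
have m0 : 'X^(p ^ n) - 1 != 0 :> {poly C}.
  by rewrite monic_neq0 // monicXnsubC // expn_gt0.
apply: (mulIf m0); rewrite map_cyclo cycloM.
by have := prod_prim_roots (fun t => 'X - t%:P) n; rewrite /= !h => ->.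
Qed.

End CyclotomicExtension.

(** * Determinants as products over conjugates *)

Lemma det_1_add_scale (C : closedFieldType) (n : nat) (A : 'M[C]_n) (rs : seq C) (s : C) :
  char_poly A = \prod_(t <- rs) ('X - t%:P) ->
  \det (1%:M + s *: A) = \prod_(t <- rs) (1 + s * t).
Proof.
move=> hA; have srs : size rs = n.
  by have := size_char_poly A; rewrite hA size_prod_XsubC => -[].
have [->|s0] := eqVneq s 0.
  rewrite scale0r addr0 det1 big1 // => t _; by rewrite mul0r addr0.
have -> : 1%:M + s *: A = (- s) *: ((- s^-1)%:M - A).
  by rewrite scalerBr scale_scalar_mx mulrNN divff // scaleNr opprK.
rewrite detZ -horner_char_poly hA horner_prod -srs.
have -> : (- s) ^+ size rs = \prod_(t <- rs) (- s).
  by rewrite big_const_seq count_predT iter_mulr_1.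
rewrite -big_split /=; apply: eq_bigr => t _.
by rewrite hornerXsubC mulrBr mulrNN divff // mulNr opprK.
Qed.

(** Factor 1 + s X^2 as (1 + r X)(1 - r X) with r^2 = -s. *)
Lemma det_1_add_scale_sqr (C : closedFieldType) (n : nat) (A : 'M[C]_n) (rs : seq C) (s : C) :
  char_poly A = \prod_(t <- rs) ('X - t%:P) ->
  \det (1%:M + s *: (A *m A)) = \prod_(t <- rs) (1 + s * t ^+ 2).
Proof.
move=> hA; have /closed_rootP [r] : size ('X^2 + s%:P : {poly C}) != 1%N.
  by rewrite size_XnaddC.
rewrite rootE !hornerE addr_eq0 => /eqP hr.
have -> : 1%:M + s *: (A *m A) = (1%:M + r *: A) *m (1%:M + (- r) *: A).
  rewrite mulmxDl !mulmxDr !mul1mx mulmx1 -scalemxAl -scalemxAr scalerA mulrN -expr2 hr opprK.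
  by rewrite scaleNr addrA subrK.
rewrite det_mulmx !(det_1_add_scale _ hA) -big_split; apply: eq_bigr => t _ /=.
have -> : s = - r ^+ 2 by rewrite hr opprK.
by ring.
Qed.

Section ConjugateRoots.
Variables (F K : fieldType) (C : closedFieldType) (e : {rmorphism F -> K}) (n : nat).
Variables (rho : {rmorphism K -> 'M[F]_n}) (jF : {rmorphism F -> C}).
Hypothesis rho_scalar : forall a, rho (e a) = a%:M.

(** The substitute for conjugates: eigenvalues of [rho x] satisfy every equation over F that x
    satisfies. *)
Lemma char_poly_rep_roots x : exists rs : seq C,
  map_poly jF (char_poly (rho x)) = \prod_(t <- rs) ('X - t%:P) /\
  forall g : {poly F}, root (map_poly e g) x ->
  forall t, t \in rs -> root (map_poly jF g) t.
Proof.
have [rs hrs] := closed_field_poly_normal (map_poly jF (char_poly (rho x))).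
exists rs; split.
  by rewrite hrs (monicP _) ?scale1r // map_monic char_poly_monic.
move=> g hg t trs; have := char_poly_rep_dvd rho_scalar hg.
rewrite -(dvdp_map jF) rmorphXn /= => /dvdpP [h hh].
have : root (map_poly jF g ^+ n) t.
  rewrite hh rootM hrs orbC rootZ ?root_prod_XsubC ?trs //.
  by rewrite lead_coef_eq0 map_poly_eq0 monic_neq0 // char_poly_monic.
by apply: contraTT => h1; rewrite /root horner_exp expf_neq0.
Qed.

End ConjugateRoots.

(** * Extraction of p-power roots near 1 *)

Section PowersNearOne.
Variables (F : fieldType) (v : F -> int) (hv : is_valuation v).
Variables (p : nat) (p_prime : prime p).
Hypothesis p_neq0_F : p%:R != 0 :> F.
Hypothesis v_p : v p%:R = 1.

Let vp1 : val_ge v 1 p%:R.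
Proof. by rewrite val_ge_neq0 // v_p. Qed.

Lemma expr1D_p b y : 1 <= b -> val_ge v b y ->
  exists R, (1 + y) ^+ p - 1 = p%:R * y + y ^+ p + R /\ val_ge v (1 + b + b) R.
Proof.
move=> b1 hy; case: p p_prime vp1 => [|[|q]] // q_prime hq.
rewrite exprDn; under eq_bigr do rewrite expr1n mul1r.
rewrite big_ord_recl big_ord_recr big_ord_recl /= /bump /= !add1n.
rewrite bin0 bin1 binn !mulr1n expr0 expr1.
set R := \sum_(_ < _) _; exists R; split; first by rewrite mulr_natl; ring.
apply: (val_ge_sum hv) => l _; rewrite -mulr_natl -addrA.
have ly := ltn_ord l; apply: (val_geM hv).
  have /dvdnP [c ->] : (q.+2 %| 'C(q.+2, (bump 0 l).+1))%N.
    by apply: prime_dvd_bin => //; rewrite /bump /=; lia.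
  by rewrite natrM; apply: (val_geMl hv) => //; apply: (val_ge_nat hv).
rewrite !exprS; apply: (val_geM hv) => //; apply: (val_geMr hv) => //.
by apply: (val_geX hv); apply: val_ge_le hy; lia.
Qed.

(** The term p (y - 1) dominates y^p - 1, so v(y^p - 1) = v(y - 1) + 1. For p = 2 the competing term
    (y - 1)^2 is smaller only when v(y - 1) >= 2. *)
Lemma val_ge_expp b c y : 1 <= b -> (p = 2%N -> 2 <= b) -> val_ge v b (y - 1) ->
  val_ge v (c + 1) (y ^+ p - 1) -> val_ge v c (y - 1).
Proof.
move=> b1 b2 hb hc; have [->|y0] := eqVneq (y - 1) 0; first exact: val_ge0.
apply: contraT; rewrite val_ge_neq0 // -ltNge => lt_c.
have hb' : b <= v (y - 1) by rewrite -val_ge_neq0.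
have [|R [hR vR]] := @expr1D_p (v (y - 1)) (y - 1) (le_trans b1 hb').
  by rewrite val_ge_neq0.
have e1 : 1 + (y - 1) = y by rewrite addrC subrK.
rewrite e1 in hR; rewrite hR in hc.
have : val_ge v (v (y - 1) + 2) (p%:R * (y - 1)).
  have -> : p%:R * (y - 1) = (p%:R * (y - 1) + (y - 1) ^+ p + R) - (y - 1) ^+ p - R.
    by ring.
  apply: (val_geB hv); last by apply: (val_ge_le _ vR); lia.
  apply: (val_geB hv); first by apply: (val_ge_le _ hc); lia.
  rewrite val_ge_neq0 ?expf_neq0 // valX //.
  have [p2|] := eqVneq p 2; first by have := b2 p2; rewrite p2; lia.
  have := prime_gt1 p_prime; move: (v _) hb' => z; nia.
by rewrite val_ge_neq0 ?mulf_neq0 // (valuationM hv) // v_p; lia.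
Qed.

Lemma val_ge_exppn b c s y : 1 <= b -> (p = 2%N -> 2 <= b) -> val_ge v b (y - 1) ->
  val_ge v (c + s%:Z) (y ^+ (p ^ s) - 1) -> val_ge v c (y - 1).
Proof.
move=> b1 b2; elim: s c y => [|s IH] c y hb; first by rewrite addr0 expr1.
rewrite expnSr exprM => hc; apply: (IH c y) => //.
have hb' : val_ge v b (y ^+ (p ^ s) - 1).
  rewrite subrX1; apply: (val_geMr hv) => //; apply: (val_ge_sum hv) => l _.
  apply: (val_geX hv); rewrite -(subrK 1 y); apply: (val_geD hv).
    by apply: val_ge_le hb; lia.
  exact: val_ge1.
by apply: (val_ge_expp b1 b2 hb'); apply: val_ge_le hc; lia.
Qed.

Lemma val_ge2_expp y : val_ge v 1 (y - 1) -> val_ge v 2 (y ^+ p - 1).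
Proof.
move=> hy; have [|R [hR vR]] := @expr1D_p 1 (y - 1) _ hy; first by [].
have e1 : 1 + (y - 1) = y by rewrite addrC subrK.
rewrite e1 in hR; rewrite hR.
apply: (val_geD hv); last by apply: val_ge_le vR.
apply: (val_geD hv); first exact: (val_geM hv vp1 hy).
by apply: (val_ge_le _ (val_geXn hv p hy)); have := prime_gt1 p_prime; lia.
Qed.

End PowersNearOne.

(** * Unramified Kummer extensions *)

Section ValuedRootsOfUnity.
Variables (E : fieldType) (v : E -> int) (hv : is_valuation v).
Variables (q : nat).
Let p := q.+1.
Hypothesis p_prime : prime p.
Variable zeta : E.
Hypothesis zeta_prim : p.-primitive_root zeta.
Let p1 : (1 < p)%N := prime_gt1 p_prime.

Lemma prod_1_sub_zeta : \prod_(a < q) (1 - zeta ^+ a.+1) = p%:R.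
Proof.
have h : cyclo q E 0 = \prod_(a < q) ('X - (zeta ^+ a.+1)%:P).
  have X1 : 'X - 1 != 0 :> {poly E} by rewrite -[1]/(1%:P) polyXsubC_eq0.
  apply: (mulIf X1); have := cycloM q E 0; rewrite expr1 => ->.
  rewrite expn1 -(factor_Xn_sub_1 zeta_prim) big_mkord big_ord_recl expr0 mulrC.
  by congr (_ * _).
have := congr1 (fun P : {poly E} => P.[1]) h.
rewrite horner_prod /cyclo horner_sum [X in X = _](eq_bigr (fun=> 1)) => [|a _]; last first.
  by rewrite horner_exp hornerXn !expr1n.
rewrite sumr_const card_ord => ->; apply: eq_bigr => a _.
by rewrite hornerXsubC.
Qed.

Lemma exprB_prod x y : x ^+ p - y ^+ p = \prod_(a < p) (x - zeta ^+ a * y).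
Proof.
have [->|y0] := eqVneq y 0.
  rewrite expr0n subr0 (eq_bigr (fun=> x)) => [|a _]; last by rewrite mulr0 subr0.
  by rewrite prodr_const card_ord.
have := congr1 (fun P : {poly E} => P.[x / y]) (factor_Xn_sub_1 zeta_prim).
rewrite big_mkord horner_prod !hornerE => /esym/(congr1 (fun t => t * y ^+ p)).
rewrite mulrBl mul1r expr_div_n divfK ?expf_neq0 // => ->.
have -> : y ^+ p = \prod_(a < p) y by rewrite prodr_const card_ord.
rewrite -big_split; apply: eq_bigr => a _ /=.
by rewrite hornerXsubC mulrBl divfK.
Qed.

Lemma val_ge_zeta a : val_ge v 0 (zeta ^+ a).
Proof.
have z0 : zeta != 0 by rewrite (prim_root_eq0 zeta_prim).
have := valX hv p z0; rewrite (prim_expr_order zeta_prim) (val1 hv) => h.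
have vz : v zeta = 0 by move: h; rewrite /p; nia.
by rewrite val_ge_neq0 ?expf_neq0 // valX // vz mulr0.
Qed.

Lemma zeta_neq1 : 1 - zeta != 0.
Proof.
by rewrite subr_eq0 eq_sym -[zeta]expr1 -(prim_order_dvd zeta_prim) dvdn1 gtn_eqF.
Qed.

Local Notation l := (v (1 - zeta)).

Lemma subr1X y a : 1 - y ^+ a = (1 - y) * \sum_(b < a) y ^+ b :> E.
Proof. by rewrite -opprB subrX1 -mulNr opprB. Qed.

Lemma val_ge_1_sub_zeta a : val_ge v l (1 - zeta ^+ a).
Proof.
rewrite subr1X; apply: (val_geMr hv); first by rewrite val_ge_neq0 ?zeta_neq1.
by apply: (val_ge_sum hv) => b _; apply: val_ge_zeta.
Qed.

(** zeta is in turn a power of zeta^a, so 1 - zeta and 1 - zeta^a divide each other. *)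
Lemma val_1_sub_zeta a : (0 < a < p)%N -> v (1 - zeta ^+ a) = l.
Proof.
move=> /andP[a0 ap].
have za : 1 - zeta ^+ a != 0.
  by rewrite subr_eq0 eq_sym -(prim_order_dvd zeta_prim) gtnNdvd.
apply/eqP; rewrite eq_le; apply/andP; split; last first.
  by rewrite -val_ge_neq0 //; apply: val_ge_1_sub_zeta.
have cop : coprime a p by rewrite coprime_sym prime_coprime // gtnNdvd.
have prim' : p.-primitive_root (zeta ^+ a) by rewrite prim_root_exp_coprime.
have [b hb] := prim_rootP prim' (prim_expr_order zeta_prim).
rewrite -val_ge_neq0 ?zeta_neq1 //.
have -> : 1 - zeta = (1 - zeta ^+ a) * \sum_(c < b) (zeta ^+ a) ^+ c.
  by rewrite -subr1X -hb.
apply: (val_geMr hv); first by rewrite val_ge_neq0.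
apply: (val_ge_sum hv) => c _; rewrite -exprM; exact: val_ge_zeta.
Qed.

Lemma val_p_zeta : v p%:R = q%:Z * l.
Proof.
rewrite -prod_1_sub_zeta.
have : forall s : seq 'I_q, v (\prod_(a <- s) (1 - zeta ^+ a.+1)) = (size s)%:Z * l /\
    \prod_(a <- s) (1 - zeta ^+ a.+1) != 0.
  elim=> [|a s [IH1 IH2]]; first by rewrite big_nil (val1 hv) mul0r oner_neq0.
  have za : 1 - zeta ^+ a.+1 != 0.
    by rewrite subr_eq0 eq_sym -(prim_order_dvd zeta_prim) gtnNdvd // ltnS.
  rewrite big_cons (valuationM hv) // mulf_neq0 // IH1 val_1_sub_zeta ?ltnS //=.
  by split=> //; rewrite -add1n PoszD mulrDl mul1r.
move=> /(_ (index_enum _)) [-> _]; congr (_%:Z * _).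
by rewrite -[RHS](card_ord q) cardE enumT.
Qed.

Hypothesis v_p : val_ge v 1 p%:R.
Hypothesis p_neq0 : p%:R != 0 :> E.

Lemma val_1_sub_zeta_gt0 : 1 <= l.
Proof. by move: v_p; rewrite val_ge_neq0 // val_p_zeta; nia. Qed.

Lemma val_ge_prod_congr n (I : Type) (r : seq I) (f g : I -> E) :
  (forall i, val_ge v 0 (f i)) -> (forall i, val_ge v 0 (g i)) ->
  (forall i, val_ge v n (f i - g i)) ->
  val_ge v n (\prod_(i <- r) f i - \prod_(i <- r) g i).
Proof.
move=> hf hg hfg; elim: r => [|i r IH]; first by rewrite !big_nil subrr val_ge0.
rewrite !big_cons; set P := \prod_(j <- r) f j in IH *; set Q := \prod_(j <- r) g j in IH *.
have -> : f i * P - g i * Q = (f i - g i) * P + g i * (P - Q) by ring.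
apply: (val_geD hv); last exact: (val_geMl hv).
by apply: (val_geMr hv) => //; apply: (val_ge_prod hv).
Qed.

Lemma val_ge1_prod (I : Type) (r : seq I) (f : I -> E) :
  (forall i, val_ge v 0 (f i)) -> val_ge v 1 (\prod_(i <- r) f i) ->
  exists i, val_ge v 1 (f i).
Proof.
move=> hf; elim: r => [|i r IH].
  by rewrite big_nil val_ge_neq0 ?oner_neq0 // (val1 hv).
have hP : val_ge v 0 (\prod_(j <- r) f j) by apply: (val_ge_prod hv).
rewrite big_cons => /(val_ge1M hv (hf i) hP).
by case/orP => [h|/IH//]; exists i.
Qed.

(** Some factor x - zeta^a y lies in the maximal ideal, and all these factors are congruent
    there. *)
Lemma val_ge1_expB x y : val_ge v 0 x -> val_ge v 0 y ->
  val_ge v 1 (x ^+ p - y ^+ p) -> val_ge v 1 (x - y).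
Proof.
move=> hx hy; rewrite exprB_prod => /val_ge1_prod [a|a ha].
  by apply: (val_geB hv) => //; apply: (val_geMl hv) => //; apply: val_ge_zeta.
have -> : x - y = (x - zeta ^+ a * y) - (1 - zeta ^+ a) * y by ring.
apply: (val_geB hv) => //; apply: (val_geMr hv) => //.
exact: (val_ge_le val_1_sub_zeta_gt0 (val_ge_1_sub_zeta _)).
Qed.

End ValuedRootsOfUnity.

Lemma int_succ_mul_ge1 (q : nat) (l : int) : 1 <= l -> 1 <= q.+1%:Z * l.
Proof. by move=> h; nia. Qed.

(* Kummer theory: if K(beta)/K has ramification index 1, the distance from     *)
(* beta to K can be improved up to the valuation of 1 - zeta.                  *)
Section PrimaryDecomposition.
Variables (q : nat).
Let p := q.+1.
Hypothesis p_prime : prime p.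
Variables (K : fieldType) (w : K -> int) (hw : is_valuation w).
Variable zeta : K.
Hypothesis zeta_prim : p.-primitive_root zeta.
Hypothesis w_p : val_ge w 1 p%:R.
Hypothesis p_neq0 : p%:R != 0 :> K.
Hypothesis perfect : forall x, val_ge w 0 x ->
  exists2 t, val_ge w 0 t & val_ge w 1 (x - t ^+ p).
Variables (alpha : K) (alpha_unit : is_local_unit w alpha).
Variables (L : fieldExtType K) (beta : L) (beta_root : beta ^+ p = alpha%:A).
Hypothesis L_unramified : is_unramified w L.

Local Notation l := (w (1 - zeta)).

Lemma primary_decomposition : exists x c : K,
  [/\ x != 0, w x = 0, val_ge w 0 c &
      alpha = x ^+ p * (1 + p%:R * (1 - zeta) * c)].
Proof.
have [w' [hw' [_ hram]]] := L_unramified.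
have tr n a : val_ge w' n a%:A = val_ge w n a.
  have [->|a0] := eqVneq a 0; first by rewrite scale0r !val_ge0.
  by rewrite !val_ge_neq0 ?scaler_eq0 ?oner_eq0 ?orbF // (hram a a0) mul1r.
have zetaL_prim : p.-primitive_root (zeta%:A : L).
  by rewrite -in_algE fmorph_primitive_root.
have [alpha0 valpha] := alpha_unit.
have w_pL : val_ge w' 1 p%:R by rewrite -(rmorph_nat (in_alg L)) tr.
have p_neq0L : p%:R != 0 :> L by rewrite -(rmorph_nat (in_alg L)) fmorph_eq0.
have l1 : 1 <= l := val_1_sub_zeta_gt0 hw p_prime zeta_prim w_p p_neq0.
have lL : w' (1 - zeta%:A) = l.
  have -> : 1 - zeta%:A = (1 - zeta)%:A :> L by rewrite scalerBl scale1r.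
  by rewrite (hram _ (zeta_neq1 p_prime zeta_prim)) mul1r.
have hbeta : val_ge w' 0 beta.
  have b0 : beta != 0.
    apply: contraNneq alpha0 => b0; have := beta_root.
    by rewrite b0 expr0n => /esym/eqP; rewrite scaler_eq0 oner_eq0 orbF.
  rewrite val_ge_neq0 //; have := valX hw' p b0.
  by rewrite beta_root (hram _ alpha0) valpha mulr0 /p; nia.
have factors x : (alpha - x ^+ p)%:A =
    \prod_(a < p) ((beta - x%:A) + (1 - zeta%:A ^+ a) * x%:A) :> L.
  rewrite -in_algE rmorphB rmorphXn /= -beta_root (exprB_prod zetaL_prim).
  by apply: eq_bigr => a _; ring.
have hz a x : val_ge w 0 x -> val_ge w' l ((1 - zeta%:A ^+ a) * x%:A).
  move=> hx; apply: (val_geMr hw'); last by rewrite tr.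
  by rewrite -lL; apply: (val_ge_1_sub_zeta hw' p_prime zetaL_prim).
have [pi pi0 wpi] := valuation_normalized hw.
have approx n : n%:Z <= l -> exists2 x, val_ge w 0 x & val_ge w' n%:Z (beta - x%:A).
  elim: n => [_|n IH nl].
    by exists 0; rewrite ?val_ge0 // scale0r subr0.
  have [|x hx hd] := IH; first by apply: le_trans nl; rewrite lez_nat.
  have [hd1|hd1] := boolP (val_ge w' n.+1%:Z (beta - x%:A)); first by exists x.
  set delta := beta - x%:A in hd hd1 *.
  have piL0 : pi%:A ^+ n != 0 :> L.
    by rewrite expf_neq0 // scaler_eq0 oner_eq0 orbF.
  have wpiL : w' (pi%:A ^+ n) = n%:Z.
    rewrite valX ?scaler_eq0 ?oner_eq0 ?orbF //.
    by have := hram _ pi0; rewrite /= => ->; rewrite wpi !mulr1.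
  pose u := delta / pi%:A ^+ n.
  have hu : val_ge w' 0 u by rewrite (val_ge_div hw') // add0r wpiL.
  (* Since n < l, all the (beta - zeta^a x)/pi^n agree with u modulo the maximal ideal. Hence (alpha
     - x^p)/pi^(n p), an element of K, is congruent to u^p; a p-th root t of it modulo the maximal
     ideal improves x to x + pi^n t. *)
  pose eps (a : 'I_p) := (1 - zeta%:A ^+ a) * x%:A / pi%:A ^+ n : L.
  have heps a : val_ge w' 1 (eps a).
    rewrite /eps (val_ge_div hw') // wpiL.
    by apply: (val_ge_le _ (hz a x hx)); rewrite addrC; move: nl; rewrite -addn1 PoszD.
  pose a0 := (alpha - x ^+ p) / pi ^+ (n * p).
  have ha0 : a0%:A = \prod_(a < p) (u + eps a).
    have e2 : (pi ^+ (n * p))%:A = (pi%:A ^+ n) ^+ p :> L.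
      by rewrite -exprM -!in_algE rmorphXn.
    rewrite -in_algE fmorph_div /= factors e2.
    have -> : (pi%:A ^+ n) ^+ p = \prod_(a < p) pi%:A ^+ n :> L.
      by rewrite prodr_const card_ord.
    by rewrite -prodf_div; apply: eq_bigr => a _; rewrite mulrDl.
  have hue a : val_ge w' 0 (u + eps a).
    by apply: (val_geD hw') => //; apply: val_ge_le (heps a).
  have [|t ht hat] := perfect (x := a0).
    by rewrite -tr ha0; apply: (val_ge_prod hw') => a _.
  have hut : val_ge w' 1 (u - t%:A).
    apply: (val_ge1_expB hw' p_prime zetaL_prim w_pL p_neq0L) => //.
      by rewrite tr.
    have -> : u ^+ p - t%:A ^+ p = (a0 - t ^+ p)%:A - (a0%:A - u ^+ p).
      by rewrite -!in_algE rmorphB rmorphXn /=; ring.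
    apply: (val_geB hw'); first by rewrite tr.
    rewrite ha0; have -> : u ^+ p = \prod_(a < p) u by rewrite prodr_const card_ord.
    apply: (val_ge_prod_congr hw') => // a.
    by rewrite addrAC subrr add0r.
  exists (x + pi ^+ n * t).
    apply: (val_geD hw) => //; apply: (val_geMl hw) => //; apply: (val_geX hw).
    by rewrite val_ge_neq0 // wpi.
  have -> : beta - (x + pi ^+ n * t)%:A = pi%:A ^+ n * (u - t%:A).
    rewrite mulrBr [_ * u]mulrC divfK // -!in_algE rmorphD rmorphM rmorphXn /=.
    by rewrite /delta; ring.
  have -> : n.+1%:Z = n%:Z + 1 by rewrite -addn1 PoszD.
  by apply: (val_geM hw') => //; rewrite val_ge_neq0 // wpiL.
have el : `|l|%N%:Z = l by rewrite gez0_abs // (le_trans _ l1).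
have [|x hx hd] := approx `|l|%N; first by rewrite el.
rewrite el in hd.
(* Each of the p factors has valuation at least l, and p l = w(p) + l because w(p) = (p - 1) l. *)
have hA : val_ge w (p%:Z * l) (alpha - x ^+ p).
  rewrite -tr factors.
  have -> : p%:Z * l = \sum_(a < p) l by
    rewrite sumr_const card_ord -mulr_natl; congr (_ * _); rewrite natz.
  elim/big_rec2: _ => [|a y1 y2 _ IH]; first exact: val_ge1.
  by apply: (val_geM hw') => //; apply: (val_geD hw') => //; apply: hz.
have pl : 1 <= p%:Z * l := int_succ_mul_ge1 q l1.
have hxp : val_ge w 0 (x ^+ p) by apply: (val_geX hw).
have [x0 wx] : x != 0 /\ w x = 0.
  apply: not_val_ge1 => //; apply/negP => hx1.
  have : val_ge w 1 alpha.
    rewrite -[alpha](subrK (x ^+ p)); apply: (val_geD hw).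
      exact: val_ge_le hA.
    by rewrite exprS; apply: (val_geMr hw) => //; apply: (val_geX hw).
  by rewrite val_ge_neq0 // valpha.
have zn := zeta_neq1 p_prime zeta_prim.
exists x, ((alpha - x ^+ p) / (x ^+ p * (p%:R * (1 - zeta)))); split=> //.
  rewrite (val_ge_div hw) ?mulf_neq0 ?expf_neq0 //.
  rewrite !(valuationM hw) ?mulf_neq0 ?expf_neq0 // valX // wx mulr0.
  rewrite (val_p_zeta hw p_prime zeta_prim); apply: val_ge_le hA.
  by rewrite !add0r -[X in _ + X]mul1r -mulrDl -PoszD addn1.
have xp0 : x ^+ p != 0 by rewrite expf_neq0.
by field; rewrite zn p_neq0.
Qed.

End PrimaryDecomposition.

(** * The dyadic norm operator *)

Section DyadicNorm.
Variables (C : fieldType) (S : subringClosed C).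
Hypothesis two_neq0 : 2 != 0 :> C.

(** Norm along y -> y^2 - 2: for f = E(X^2) + X O(X^2), f(y) f(-y) = E(y^2)^2 - y^2 O(y^2)^2, and
    substituting X + 2 makes it a polynomial in y^2 - 2. *)
Definition dnorm (f : {poly C}) : {poly C} :=
  (even_poly f ^+ 2 - 'X * odd_poly f ^+ 2) \Po ('X + 2).

(** Half the polarization of [dnorm]: twice its value at y^2 - 2 is f(y) g(-y) + f(-y) g(y). *)
Definition dcross (f g : {poly C}) : {poly C} :=
  (even_poly f * even_poly g - 'X * (odd_poly f * odd_poly g)) \Po ('X + 2).

Lemma horner_even_odd (f : {poly C}) y :
  f.[y] = (even_poly f).[y ^+ 2] + y * (odd_poly f).[y ^+ 2].
Proof.
rewrite -{1}(poly_even_odd f) hornerD hornerM hornerX !horner_comp !hornerXn.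
by rewrite mulrC.
Qed.

Let hornerX2 (y : C) : ('X + 2).[y] = y + 2.
Proof. by rewrite hornerD hornerX -polyC_natr hornerC. Qed.

Lemma horner_dnorm f y : (dnorm f).[y ^+ 2 - 2] = f.[y] * f.[- y].
Proof.
rewrite /dnorm horner_comp hornerX2 subrK (horner_even_odd f y) (horner_even_odd f (- y)) sqrrN.
rewrite hornerD hornerN (hornerM 'X) hornerX !horner_exp.
by ring.
Qed.

Lemma even_poly_polyOver f : f \is a polyOver S -> even_poly f \is a polyOver S.
Proof. by move=> /polyOverP h; apply/polyOverP => l; rewrite coef_even_poly. Qed.

Lemma odd_poly_polyOver f : f \is a polyOver S -> odd_poly f \is a polyOver S.
Proof. by move=> /polyOverP h; apply/polyOverP => l; rewrite coef_odd_poly. Qed.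

Let X2_over : 'X + 2 \is a polyOver S.
Proof. by rewrite rpredD ?polyOverX ?rpred_nat. Qed.

Lemma dnorm_polyOver f : f \is a polyOver S -> dnorm f \is a polyOver S.
Proof.
move=> hf; apply: polyOver_comp => //.
by rewrite rpredB ?rpredM ?rpredX ?polyOverX ?even_poly_polyOver ?odd_poly_polyOver.
Qed.

Lemma dcross_polyOver f g : f \is a polyOver S -> g \is a polyOver S ->
  dcross f g \is a polyOver S.
Proof.
move=> hf hg; apply: polyOver_comp => //.
by rewrite rpredB ?rpredM ?polyOverX ?even_poly_polyOver ?odd_poly_polyOver.
Qed.

Lemma dnorm_add f g z :
  dnorm (f + z *: g) = dnorm f + z ^+ 2 *: dnorm g + (2 * z) *: dcross f g.
Proof.
rewrite /dnorm /dcross -!comp_polyZ -!comp_polyD; congr (_ \Po _).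
rewrite even_polyD even_polyZ odd_polyD odd_polyZ -!mul_polyC !polyCM polyC_natr.
by ring.
Qed.

Lemma dnorm1 : dnorm 1 = 1.
Proof.
have -> : dnorm 1 = ((1 ^+ 2 - 'X * 0 ^+ 2) \Po ('X + 2)).
  rewrite /dnorm; congr ((_ ^+ 2 - _ * _ ^+ 2) \Po _); apply/polyP => l.
    by rewrite coef_even_poly !coef1; case: l.
  by rewrite coef_odd_poly coef1 coef0.
by rewrite expr0n mulr0 subr0 expr1n rmorph1.
Qed.

Local Notation even x := (exists2 s, s \in S & x = 2 * s).

Lemma even_dcross2 f g : f \is a polyOver S -> g \is a polyOver S ->
  even g.[2] -> even (dcross f g).[2].
Proof.
move=> hf hg [s hs]; rewrite (horner_even_odd g) => e2.
have he : (even_poly g).[2 ^+ 2] = 2 * (s - (odd_poly g).[2 ^+ 2]).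
  by rewrite mulrBr -e2 addrK.
rewrite /dcross horner_comp hornerX2.
have -> : 2 + 2 = 2 ^+ 2 :> C by ring.
have h4 (P : {poly C}) : P \is a polyOver S -> P.[2 ^+ 2] \in S.
  by move=> hP; rewrite rpred_horner ?rpredX ?rpred_nat.
exists ((even_poly f).[2 ^+ 2] * (s - (odd_poly g).[2 ^+ 2]) -
   2 * ((odd_poly f).[2 ^+ 2] * (odd_poly g).[2 ^+ 2])).
  by rewrite rpredB ?rpredM ?rpredB ?rpred_nat ?h4 ?even_poly_polyOver ?odd_poly_polyOver.
rewrite hornerD hornerN (hornerM (even_poly f)) (hornerM 'X) (hornerM (odd_poly f)).
by rewrite hornerX he; ring.
Qed.

Lemma iter_dnorm_polyOver k f : f \is a polyOver S -> iter k dnorm f \is a polyOver S.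
Proof. by move=> hf; elim: k => //= k IH; apply: dnorm_polyOver. Qed.

Hypothesis frob : forall c, c \in S -> even (c ^+ 2 - c).

(** Modulo 2, squaring a polynomial over S is the substitution X -> X^2, signs disappear and X + 2
    is X. *)
Lemma dnorm_frobenius f : f \is a polyOver S -> exists2 h, h \is a polyOver S &
  dnorm f = f + 2 *: h.
Proof.
move=> hf.
have [h1 hh1 e1] : exists2 h, h \is a polyOver S &
    (even_poly f ^+ 2 - 'X * odd_poly f ^+ 2) = f + 2 *: h.
  have sq g : g \is a polyOver S -> exists2 h, h \is a polyOver S &
      g ^+ 2 = g \Po 'X^2 + 2 *: h.
    elim/poly_ind: g => [|g c IH] hg.
      by exists 0; rewrite ?rpred0 // comp_poly0 expr0n scaler0 addr0.
    have hc : c \in S by move/polyOverP: hg => /(_ 0%N); rewrite coefD coefMX coefC add0r.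
    have hg' : g \is a polyOver S.
      by apply/polyOverP => l; move/polyOverP: hg => /(_ l.+1);
        rewrite coefD coefMX coefC addr0.
    have [h hh e] := IH hg'; have [s hs es] := frob hc.
    exists (h * 'X^2 + g * 'X * c%:P + s%:P).
      by rewrite !rpredD ?rpredM ?polyOverXn ?polyOverX ?polyOverC.
    rewrite comp_polyD comp_polyM comp_polyX comp_polyC sqrrD exprMn e.
    have -> : c%:P ^+ 2 = c%:P + 2 *: s%:P.
      rewrite -polyC_exp -mul_polyC -polyCM -polyCD -es; congr (_%:P); ring.
    by rewrite -!mul_polyC polyC_natr; ring.
  have [h hh e] := sq _ (even_poly_polyOver hf).
  have [h' hh' e'] := sq _ (odd_poly_polyOver hf).
  exists (h - 'X * h' - 'X * (odd_poly f \Po 'X^2)).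
    rewrite !rpredB ?rpredM ?polyOverX // polyOver_comp ?polyOverXn //.
    exact: odd_poly_polyOver.
  rewrite e e' -{3}(poly_even_odd f) -!mul_polyC polyC_natr; ring.
have [h2 hh2 e2] : exists2 h, h \is a polyOver S & f \Po ('X + 2) = f + 2 *: h.
  elim/poly_ind: f hf {h1 hh1 e1} => [|g c IH] hg.
    by exists 0; rewrite ?rpred0 // comp_poly0 scaler0 addr0.
  have hg' : g \is a polyOver S.
    by apply/polyOverP => l; move/polyOverP: hg => /(_ l.+1);
      rewrite coefD coefMX coefC addr0.
  have [h hh e] := IH hg'.
  exists (h * 'X + g + 2 *: h).
    by rewrite !rpredD ?rpredM ?polyOverX ?polyOverZ ?rpred_nat.
  rewrite comp_polyD comp_polyM comp_polyX comp_polyC e -!mul_polyC polyC_natr; ring.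
exists (h2 + (h1 \Po ('X + 2))).
  by rewrite rpredD // polyOver_comp.
by rewrite /dnorm e1 comp_polyD comp_polyZ e2 scalerDr -[LHS]addrA.
Qed.

Lemma even_diff_horner f x y : f \is a polyOver S -> x \in S -> y \in S ->
  even (x - y) -> even (f.[x] - f.[y]).
Proof.
move=> hf hx hy [s hs e]; elim/poly_ind: f hf => [|g c IH] hg.
  by exists 0; rewrite ?rpred0 // !horner0 subrr mulr0.
have hg' : g \is a polyOver S.
  by apply/polyOverP => l; move/polyOverP: hg => /(_ l.+1);
    rewrite coefD coefMX coefC addr0.
have [t ht e'] := IH hg'.
exists (t * x + g.[y] * s).
  by rewrite rpredD ?rpredM ?rpred_horner.
have ey : x = y + 2 * s by rewrite -e addrC subrK.
have eg : g.[x] = g.[y] + 2 * t by rewrite -e' addrC subrK.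
by rewrite !hornerMXaddC eg ey; ring.
Qed.

Lemma even_dnorm2 f : f \is a polyOver S -> even ((dnorm f).[2] - f.[2]).
Proof.
move=> hf; have [h hh ->] := dnorm_frobenius hf; exists h.[2].
  by rewrite rpred_horner ?rpred_nat.
by rewrite hornerD hornerZ addrAC subrr add0r.
Qed.

(** 2 is the fixed point in which the orbit 0, -2, 2, 2, ... of 0 under y -> y^2 - 2 ends; the next
    lemma covers its first step. *)
Lemma horner2_dnorm f : (dnorm f).[2] = f.[2] * f.[-2].
Proof. by rewrite -horner_dnorm; congr (_.[_]); ring. Qed.

Lemma hornerN2_dnorm f : (dnorm f).[-2] = f.[0] ^+ 2.
Proof.
have := horner_dnorm f 0; rewrite oppr0 -expr2 => <-.
by congr (_.[_]); rewrite expr0n sub0r.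
Qed.

Lemma odd_sqr x : x \in S -> even (x - 1) -> exists2 s, s \in S & x ^+ 2 = 1 + 8 * s.
Proof.
move=> hx [s hs e]; have [t ht e'] := frob hs.
exists (t + s); first by rewrite rpredD.
have -> : x = 1 + 2 * s by rewrite -e addrC subrK.
have e2 : s ^+ 2 = s + 2 * t by rewrite -e' addrC subrK.
have -> : (1 + 2 * s) ^+ 2 = 1 + 4 * s + 4 * s ^+ 2 by ring.
by rewrite e2; ring.
Qed.

Let pow2_sqr k : (2 ^+ k.+2) ^+ 2 = 2 ^+ k.+3 * (2 ^+ k * 2) :> C.
Proof. by rewrite -exprM -exprSr -exprD; congr (_ ^+ _); lia. Qed.

(** Each application of [dnorm] doubles the modulus, the cross term carrying 2 z. Evenness of the
    error at 2 is the extra gain; [even_dcross2] propagates it. *)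
Lemma iter_dnorm_succ f k : f \is a polyOver S -> even (f.[0] - 1) ->
  exists2 h, h \is a polyOver S & even h.[2] /\
    iter k.+2 dnorm f = iter k.+1 dnorm f + 2 ^+ k.+2 *: h.
Proof.
move=> hf f0; elim: k => [|k [h hh [h2 e]]].
  have [h hh e] := dnorm_frobenius hf.
  exists (dnorm h + dcross f h); first by rewrite rpredD ?dnorm_polyOver ?dcross_polyOver.
  have e2 : dnorm (dnorm f) = dnorm f + 2 ^+ 2 *: (dnorm h + dcross f h).
    by rewrite {1}e dnorm_add -addrA scalerDr -expr2.
  split=> //.
  have [s hs es] := odd_sqr (rpred_horner hf (rpred0 S)) f0.
  have hD2 : (dnorm f).[2] \in S by rewrite rpred_horner ?dnorm_polyOver ?rpred_nat.
  exists ((dnorm f).[2] * s); first by rewrite rpredM.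
  (* At 2 the difference is (dnorm f)(2) (f(0)^2 - 1), and f(0)^2 = 1 modulo 8 because f(0) is
     odd. *)
  have := congr1 (fun P : {poly C} => P.[2]) e2.
  rewrite hornerD hornerZ horner2_dnorm hornerN2_dnorm es => h4.
  have n4 : 2 ^+ 2 != 0 :> C by rewrite expf_neq0.
  apply: (mulfI n4); apply: (addrI (dnorm f).[2]); rewrite -h4; ring.
have hg := iter_dnorm_polyOver k.+1 hf.
exists (2 ^+ k *: (2 *: dnorm h) + dcross (iter k.+1 dnorm f) h).
  apply: rpredD; last exact: dcross_polyOver.
  apply: polyOverZ; first by rewrite rpredX ?rpred_nat.
  by apply: polyOverZ; rewrite ?rpred_nat ?dnorm_polyOver.
split.
  have [s hs es] := even_dcross2 hg hh h2.
  exists (2 ^+ k * (dnorm h).[2] + s).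
    apply: rpredD => //; apply: rpredM; first by rewrite rpredX ?rpred_nat.
    by apply: rpred_horner; [exact: dnorm_polyOver|exact: rpred_nat].
  by rewrite hornerD !hornerZ es; ring.
have -> : iter k.+3 dnorm f = dnorm (iter k.+2 dnorm f) by [].
rewrite {1}e dnorm_add -iterS -addrA scalerDr !scalerA -exprS pow2_sqr.
by rewrite mulrA.
Qed.

(** Two steps along the orbit of 0 give (dnorm^(m+2) f)(2) = g (dnorm^m f)(0)^2 with g =
    (dnorm^(m+1) f)(2); compare with [iter_dnorm_succ] at 2. *)
Lemma iter_dnorm_sqr f m : f \is a polyOver S -> even (f.[0] - 1) ->
  exists g s, [/\ g \in S, s \in S, even (g - 1) &
    g * ((iter m dnorm f).[0] ^+ 2 - 1) = 2 ^+ m.+3 * s].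
Proof.
move=> hf f0; have [h hh [[s hs es] e]] := iter_dnorm_succ m hf f0.
exists (iter m.+1 dnorm f).[2], s; split=> //.
- by rewrite rpred_horner ?iter_dnorm_polyOver ?rpred_nat.
- have f2 : even (f.[2] - 1).
    have [t ht et] : even (f.[2] - f.[0]).
      by apply: even_diff_horner; rewrite ?rpred_nat ?rpred0 //;
        exists 1; rewrite ?rpred1 // subr0 mulr1.
    have [u hu eu] := f0; exists (t + u); first by rewrite rpredD.
    by rewrite mulrDr -et -eu; ring.
  elim: (m.+1) => [//|k [t ht et]].
  have [u hu eu] := even_dnorm2 (iter_dnorm_polyOver k hf).
  exists (t + u); first by rewrite rpredD.
  by rewrite mulrDr -et -eu /=; ring.
- have := congr1 (fun P : {poly C} => P.[2]) e.
  rewrite hornerD hornerZ iterS horner2_dnorm [in X in _ * X]iterS hornerN2_dnorm es.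
  move=> h4; apply: (addrI (iter m.+1 dnorm f).[2]).
  by rewrite mulrBr mulr1 addrC subrK h4 [in RHS]exprSr mulrA.
Qed.

Lemma iter_dnorm_1_add4 h m : h \is a polyOver S -> even h.[0] ->
  exists2 h', h' \is a polyOver S & even h'.[0] /\
    iter m dnorm (1 + 2 ^+ 2 *: h) = 1 + 2 ^+ m.+2 *: h'.
Proof.
move=> hh h0; elim: m => [|m [h' hh' [[s hs es] e]]]; first by exists h.
exists (2 ^+ m *: (2 *: dnorm h') + dcross 1 h').
  apply: rpredD; last by apply: dcross_polyOver; rewrite ?rpred1.
  apply: polyOverZ; first by rewrite rpredX ?rpred_nat.
  by apply: polyOverZ; rewrite ?rpred_nat ?dnorm_polyOver.
split.
  have [t ht et] : even ((even_poly h').[2] - (even_poly h').[0]).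
    apply: even_diff_horner; rewrite ?even_poly_polyOver ?rpred_nat ?rpred0 //.
    by exists 1; rewrite ?rpred1 // subr0 mulr1.
  exists (2 ^+ m * (dnorm h').[0] + t + s).
    apply: rpredD => //; apply: rpredD => //; apply: rpredM.
      by rewrite rpredX ?rpred_nat.
    by apply: rpred_horner; [exact: dnorm_polyOver|exact: rpred0].
  have ->: dcross 1 h' = even_poly h' \Po ('X + 2).
    by rewrite /dcross even_polyC odd_polyC mul0r mulr0 subr0 mul1r.
  rewrite hornerD !hornerZ (horner_comp (even_poly h')) (hornerX2 0) add0r.
  have e0 : (even_poly h').[0] = 2 * s by rewrite -es !horner_coef0 coef_even_poly.
  by have -> : (even_poly h').[2] = 2 * t + 2 * s; [rewrite -et e0 subrK|ring].
rewrite iterS e dnorm_add dnorm1 -addrA scalerDr !scalerA -exprS pow2_sqr.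
by rewrite mulrA.
Qed.

End DyadicNorm.

(* The minimal polynomial of 2 cos (2 pi / 2^(m + 2)).                         *)
Definition psi (R : nzRingType) (m : nat) : {poly R} :=
  iter m (fun P => P \Po ('X^2 - 2%:P)) 'X.

Lemma map_psi (R R' : nzRingType) (f : {rmorphism R -> R'}) m :
  map_poly f (psi R m) = psi R' m.
Proof.
elim: m => [|m IH]; first exact: map_polyX.
by rewrite /= map_comp_poly IH rmorphB /= map_polyXn map_polyC /= rmorph_nat.
Qed.

Lemma psi_monic_size (R : idomainType) m :
  psi R m \is monic /\ size (psi R m) = (2 ^ m).+1.
Proof.
have s2 : size ('X^2 - 2%:P : {poly R}) = 3 by rewrite size_XnsubC.
elim: m => [|m [IH1 IH2]]; first by rewrite monicX size_polyX.
have s : size (psi R m.+1) = (2 ^ m.+1).+1.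
  rewrite [psi R m.+1]/(psi R m \Po ('X^2 - 2%:P)).
  have P0 : psi R m \Po ('X^2 - 2%:P) != 0.
    by rewrite comp_poly_eq0 ?s2 // monic_neq0.
  by rewrite polySpred // size_comp_poly IH2 s2 expnSr.
split=> //; rewrite monicE [psi R m.+1]/(psi R m \Po ('X^2 - 2%:P)).
rewrite lead_coef_comp ?s2 // (monicP IH1) mul1r.
by rewrite (monicP (monicXnsubC _ _)) ?expr1n.
Qed.

Lemma psi_F2 m : psi 'F_2 m = 'X^(2 ^ m).
Proof.
elim: m => [//|m IH] /=; rewrite IH.
have -> : (2 : 'F_2)%:P = 0 :> {poly 'F_2}.
  have -> : 2 = 0 :> 'F_2 by apply/val_inj.
  by [].
by rewrite subr0 comp_Xn_poly -exprM -expnS.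
Qed.

Lemma psi_coef m l : (l < 2 ^ m)%N -> (2 %| (psi int m)`_l)%Z.
Proof.
move=> hl; have := congr1 (fun P : {poly 'F_2} => P`_l) (psi_F2 m).
rewrite -(map_psi (intmul 1 : {rmorphism int -> 'F_2}) m).
rewrite coefXn ltn_eqF //= coef_map => h.
by rewrite (dvdz_pcharf (pchar_Fp (isT : prime 2))); apply/eqP.
Qed.

Lemma horner0_psi m : (0 < m)%N -> (psi int m).[0] = 2 \/ (psi int m).[0] = -2.
Proof.
have hs k x : (psi int k.+1).[x] = (psi int k).[x ^+ 2 - 2].
  by rewrite /= horner_comp hornerD hornerN hornerXn hornerC.
have h2 k : (psi int k).[2] = 2.
  by elim: k => [|k IH]; [rewrite /= hornerX|rewrite hs].
case: m => [//|[|m]] _; first by right; rewrite hs /= hornerX.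
by left; rewrite !hs; have -> : (0 ^+ 2 - 2) ^+ 2 - 2 = 2 :> int by [].
Qed.

Lemma horner_psi_add_inv (F : fieldType) m (y : F) : y != 0 ->
  (psi F m).[y + y^-1] = y ^+ (2 ^ m) + y ^- (2 ^ m).
Proof.
elim: m y => [|m IH] y y0; first by rewrite /= hornerX !expr1.
rewrite /= horner_comp hornerD hornerN hornerXn hornerC.
have -> : (y + y^-1) ^+ 2 - 2 = y ^+ 2 + (y ^+ 2)^-1.
  by rewrite sqrrD divff // exprVn; ring.
by rewrite IH ?expf_neq0 // -!exprM -expnS.
Qed.

Lemma comp_poly_prod (R : comNzRingType) (I : Type) (r : seq I) (P : I -> {poly R})
    (Q : {poly R}) : (\prod_(x <- r) P x) \Po Q = \prod_(x <- r) (P x \Po Q).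
Proof.
elim: r => [|x r IH]; first by rewrite !big_nil comp_polyC.
by rewrite !big_cons comp_polyM IH.
Qed.

(** A root t of [psi C m] has above it the two roots s and -s of the next polynomial, with s^2 = t +
    2; pairing them applies [dnorm] once. *)
Lemma prod_psi_roots (C : closedFieldType) m : exists rs : seq C,
  psi C m = \prod_(t <- rs) ('X - t%:P) /\
  forall f, \prod_(t <- rs) f.[t] = (iter m (@dnorm C) f).[0].
Proof.
elim: m => [|m [rs [IH1 IH2]]].
  by exists [:: 0]; split=> [|f]; rewrite big_seq1 // subr0.
have sqrt (t : C) : exists r, r ^+ 2 = t + 2.
  have /closed_rootP [r] : size ('X^2 - (t + 2)%:P : {poly C}) != 1%N.
    by rewrite size_XnsubC.
  by rewrite rootE !hornerE subr_eq0 => /eqP hr; exists r.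
have [s hs] := choice sqrt.
exists (flatten [seq [:: s t; - s t] | t <- rs]); split=> [|f].
  rewrite [LHS]/(psi C m \Po ('X^2 - 2%:P)) IH1.
  transitivity (\prod_(t <- rs) (('X - t%:P) \Po ('X^2 - 2%:P))).
    exact: comp_poly_prod.
  rewrite big_flatten big_map.
  apply: eq_bigr => t _; rewrite big_cons big_seq1 comp_polyB comp_polyX comp_polyC.
  have -> : 'X^2 - 2%:P - t%:P = 'X^2 - (s t ^+ 2)%:P by rewrite hs polyCD; ring.
  suff : 'X^2 - (s t ^+ 2)%:P = ('X - (s t)%:P) * ('X - (- s t)%:P) :> {poly C} by [].
  by rewrite polyCN opprK -subr_sqr polyC_exp.
rewrite iterSr -IH2 big_flatten big_map; apply: eq_bigr => t _.
rewrite big_cons big_seq1; suff : f.[s t] * f.[- s t] = (dnorm f).[t] by [].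
by rewrite -horner_dnorm hs addrK.
Qed.

(** * Integers of the dyadic layers, by the Eisenstein criterion *)

Section DyadicTower.
Variables (Qp : fieldType) (vp : Qp -> int) (iQ : {rmorphism rat -> Qp}).
Hypothesis Qp_completion : is_completion (padic_val 2) vp iQ.
Variables (C : closedFieldType) (i : {rmorphism Qp -> C}).

Let hv : is_valuation vp := completion_valuation Qp_completion.
Let two_neq0 : 2 != 0 :> Qp := padic_natr_neq0 iQ (ltn0Sn 1).
Let v_2 : vp 2 = 1 := padic_val_p (isT : prime 2) Qp_completion.
Local Notation O := (integers hv i).
Local Notation N := (nilp 2 hv i).

Variables (m : nat) (t : C).
Hypothesis psi_t : root (psi C m) t.

Let P_monic : psi Qp m \is monic := (psi_monic_size Qp m).1.
Let P_sizeE : size (psi Qp m) = (2 ^ m).+1 := (psi_monic_size Qp m).2.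
Let P_size : (1 < size (psi Qp m))%N.
Proof. by rewrite P_sizeE ltnS expn_gt0. Qed.
Let psi_int l : (psi Qp m)`_l = ((psi int m)`_l)%:~R.
Proof. by rewrite -(map_psi (intmul 1 : {rmorphism int -> Qp})) coef_map. Qed.
Let P_coef l : (l < (size (psi Qp m)).-1)%N -> val_ge vp 1 (psi Qp m)`_l.
Proof.
rewrite P_sizeE psi_int => hl.
by apply: (padic_val_ge_int (isT : prime 2) Qp_completion); apply: psi_coef.
Qed.
Let P_eisenstein : size (psi Qp m) = 2 \/ ~~ val_ge vp 2 (psi Qp m)`_0.
Proof.
have [->|m0] := posnP m; first by left; rewrite size_polyX.
right; rewrite psi_int -horner_coef0.
by case: (horner0_psi m0) => ->; rewrite ?rmorphN ?(val_geN hv)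
  val_ge_neq0 // v_2.
Qed.
Let Pt : root (map_poly i (psi Qp m)) t.
Proof. by rewrite map_psi. Qed.

Lemma psi_minimal (g : {poly Qp}) : root (map_poly i g) t -> psi Qp m %| g.
Proof.
exact: (eisenstein_minimal hv two_neq0 v_2 P_monic P_size P_coef P_eisenstein Pt).
Qed.

Lemma psi_integral (f : {poly Qp}) : (map_poly i f).[t] \in O ->
  exists2 g : {poly Qp}, g \is a polyOver (val_pred hv) &
    (map_poly i f).[t] = (map_poly i g).[t].
Proof.
move=> hf; pose r := f %% psi Qp m.
have hr : (map_poly i r).[t] = (map_poly i f).[t].
  have := divp_eq f (psi Qp m) => /(congr1 (fun P => (map_poly i P).[t])).
  by rewrite rmorphD rmorphM /= hornerD hornerM (rootP Pt) mulr0 add0r => <-.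
have hsr : (size r <= (size (psi Qp m)).-1)%N.
  by rewrite -ltnS prednK ?ltn_modp ?monic_neq0 // ltnW.
exists r => //; apply/polyOverP => l.
apply: (eisenstein_integral (hv := hv) two_neq0 v_2 P_monic P_size P_coef P_eisenstein Pt hsr).
by rewrite hr.
Qed.

Lemma psi_root_nilp : t \in N.
Proof.
exact: (eisenstein_root_nilp hv two_neq0 v_2 P_monic P_size P_coef Pt).
Qed.

End DyadicTower.

(** * Norms to a subfield of the cyclotomic tower *)

Section LocalEmbedding.
Variables (p : nat) (p_prime : prime p).
Variables (Qp : fieldType) (vp : Qp -> int) (iQ : {rmorphism rat -> Qp}).
Hypothesis Qp_completion : is_completion (padic_val p) vp iQ.
Variables (C : closedFieldType) (i : {rmorphism Qp -> C}).
Variables (K : fieldExtType Qp) (w : K -> int) (hw : is_valuation w) (e0 : nat).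
Hypothesis he0 : is_ramification_index vp w (in_alg K) e0.
Variables (j : {rmorphism K -> C}) (j_Qp : forall a : Qp, j a%:A = i a).

Let hv : is_valuation vp := completion_valuation Qp_completion.
Let p_neq0_Qp : p%:R != 0 :> Qp := padic_natr_neq0 iQ (prime_gt0 p_prime).
Let v_p : vp p%:R = 1 := padic_val_p p_prime Qp_completion.
Local Notation O := (integers hv i).
Local Notation N := (nilp p hv i).

Lemma embed_integer x : val_ge w 0 x -> j x \in O.
Proof.
move=> /(val_ring_integral p_prime Qp_completion hw he0) [g mg hg].
apply/integersP; exists g => //.
have -> : map_poly (i \o @vval _ _ hv) g = map_poly j (map_poly (in_alg K \o @vval _ _ hv) g).
  by rewrite -map_poly_comp; apply: eq_map_poly => a /=; rewrite j_Qp.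
by rewrite fmorph_root.
Qed.

Lemma val_expn_div_p x : val_ge w 1 x -> val_ge w 0 (x ^+ e0 / p%:R).
Proof.
move=> hx; rewrite (val_ge_div hw) ?(natr_neq0 iQ) ?prime_gt0 //.
rewrite (val_p p_prime Qp_completion he0) add0r.
by have := val_geXn hw e0 hx; rewrite mulr1.
Qed.

Lemma embed_nilp x : val_ge w 1 x -> j x \in N.
Proof.
move=> /val_expn_div_p /embed_integer h; apply/nilpP; exists e0.
by move: h; rewrite fmorph_div rmorphXn rmorph_nat.
Qed.

Let nilp1F : (1 \in N) = false := nilp1 hv i p_neq0_Qp v_p.

(** If w(x) < 0 then x^-1 lies in the maximal ideal, and 1 = x x^-1 would lie there too. *)
Lemma integer_embed x : j x \in O -> val_ge w 0 x.
Proof.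
move=> hx; apply: contraT => nx.
have x0 : x != 0 by apply: contraNneq nx => ->; rewrite val_ge0.
have : j x * j x^-1 \in N.
  apply: nilpM => //; apply: embed_nilp; rewrite val_ge_neq0 ?invr_neq0 // valV //.
  by move: nx; rewrite val_ge_neq0 //; lia.
by rewrite -rmorphM mulfV // rmorph1 nilp1F.
Qed.

Lemma nilp_embed x : j x \in N -> val_ge w 1 x.
Proof.
move=> hx; apply: contraT => nx.
have h0 := integer_embed (nilp_integers p_neq0_Qp v_p hx).
have [x0 wx] := not_val_ge1 h0 nx.
have : j x^-1 * j x \in N.
  apply: nilpM => //; apply: embed_integer.
  by rewrite val_ge_neq0 ?invr_neq0 // valV // wx.
by rewrite -rmorphM mulVf // rmorph1 nilp1F.
Qed.

Section Conjugates.
Variables (F : fieldType) (b : {rmorphism Qp -> F}) (e : {rmorphism F -> K}).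
Hypothesis e_b : forall a, e (b a) = a%:A.
Variables (n : nat) (rho : {rmorphism K -> 'M[F]_n}).
Hypothesis rho_scalar : forall a, rho (e a) = a%:M.
Let jF : {rmorphism F -> C} := j \o e.

Lemma conjugate_roots x : exists rs : seq C,
  [/\ map_poly jF (char_poly (rho x)) = \prod_(t <- rs) ('X - t%:P),
      val_ge w 0 x -> forall t, t \in rs -> t \in O &
      val_ge w 1 x -> forall t, t \in rs -> t \in N].
Proof.
have [rs [h1 h2]] := char_poly_rep_roots jF rho_scalar x; exists rs.
(* An integral equation for c x^l is an equation for x over Q_p, so each conjugate satisfies it. It
   serves with c = l = 1, and with c = 1/p, l = e0 when x is in the maximal ideal. *)
have key c l : val_ge w 0 (c%:A * x ^+ l) -> forall t, t \in rs -> i c * t ^+ l \in O.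
  move=> /(val_ring_integral p_prime Qp_completion hw he0) [g mg hg] t trs.
  pose G := map_poly (@vval _ _ hv) g \Po (c *: 'X^l).
  have hx : root (map_poly e (map_poly b G)) x.
    have -> : map_poly e (map_poly b G) = map_poly (in_alg K) G.
      by rewrite -map_poly_comp; apply: eq_map_poly => a /=; rewrite e_b.
    rewrite map_comp_poly map_polyZ map_polyXn /root horner_comp hornerZ hornerXn.
    by move: hg; rewrite /root map_poly_comp.
  have := h2 _ hx t trs.
  have -> : map_poly jF (map_poly b G) = map_poly i G.
    by rewrite -map_poly_comp; apply: eq_map_poly => a /=; rewrite e_b j_Qp.
  rewrite map_comp_poly map_polyZ map_polyXn /root horner_comp hornerZ hornerXn.
  move=> ht; apply/integersP; exists g => //.
  by rewrite /root (map_poly_comp i (@vval _ _ hv)).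
split=> // hx t trs.
  have := @key 1 1 _ t trs; rewrite rmorph1 mul1r expr1; apply.
  by rewrite scale1r mul1r.
have hxp : val_ge w 0 ((p%:R^-1)%:A * x ^+ e0).
  by rewrite -in_algE fmorphV rmorph_nat mulrC; apply: val_expn_div_p.
have := key _ _ hxp t trs; rewrite fmorphV rmorph_nat mulrC => h.
by apply/nilpP; exists e0.
Qed.

Lemma rep_1_add s y : rho (1 + e s * y) = 1%:M + s *: rho y.
Proof.
rewrite rmorphD rmorph1 rmorphM rho_scalar; congr (_ + _).
exact: mul_scalar_mx.
Qed.

Lemma det_rep_1_add s y : exists rs : seq C,
  [/\ jF (\det (rho (1 + e s * y))) = \prod_(t <- rs) (1 + jF s * t),
      val_ge w 0 y -> forall t, t \in rs -> t \in O &
      val_ge w 1 y -> forall t, t \in rs -> t \in N].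
Proof.
have [rs [h1 h2 h3]] := conjugate_roots y; exists rs; split=> //.
rewrite -det_map_mx rep_1_add.
rewrite map_mxD map_mxZ map_mx1; apply: det_1_add_scale.
by rewrite -map_char_poly.
Qed.

Lemma det_rep_1_add_sqr s y : exists rs : seq C,
  [/\ jF (\det (rho (1 + e s * y ^+ 2))) = \prod_(t <- rs) (1 + jF s * t ^+ 2),
      jF (\tr (rho y)) = \sum_(t <- rs) t &
      val_ge w 1 y -> forall t, t \in rs -> t \in N].
Proof.
have [rs [h1 h2 h3]] := conjugate_roots y; exists rs; split=> //.
  have -> : rho (1 + e s * y ^+ 2) = 1%:M + s *: (rho y *m rho y).
    by rewrite rep_1_add expr2 rmorphM.
  rewrite -det_map_mx.
  rewrite map_mxD map_mxZ map_mx1 map_mxM; apply: det_1_add_scale_sqr.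
  by rewrite -map_char_poly.
have srs : size rs = n.
  have := congr1 (fun P : {poly C} => size P) h1.
  by rewrite size_map_poly size_char_poly size_prod_XsubC => -[].
case: (posnP n) => [n0|n_gt0].
  rewrite (size0nil (etrans srs n0)) big_nil /mxtrace big1 ?rmorph0 // => a _.
  by have := leq_trans (ltn_ord a) (eq_leq n0).
have := congr1 (fun P : {poly C} => P`_(n.-1)) h1.
have -> : (\prod_(t <- rs) ('X - t%:P))`_n.-1 = - \sum_(t <- rs) t.
  by rewrite -coefPn_prod_XsubC srs // -lt0n.
by rewrite coef_map char_poly_trace // raddfN => /oppr_inj.
Qed.

End Conjugates.

End LocalEmbedding.

Lemma power_tower (C : closedFieldType) (p : nat) (y : C) : (0 < p)%N -> y ^+ p = 1 ->
  exists z : nat -> C, [/\ z 0 = 1, z 1 = y & forall n, z n.+1 ^+ p = z n].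
Proof.
move=> p0 hy.
have root_ex (t : C) : exists r, r ^+ p = t.
  have /closed_rootP [r] : size ('X^p - t%:P : {poly C}) != 1%N.
    by rewrite size_XnsubC // eqSS -lt0n.
  by rewrite rootE !hornerE subr_eq0 => /eqP hr; exists r.
have [s hs] := choice root_ex.
exists (fun n => if n is n'.+1 then iter n' s y else 1); split=> // -[//|n].
by rewrite iterS.
Qed.

Section CyclotomicNorm.
Variables (q : nat).
Let p := q.+1.
Hypothesis p_prime : prime p.
Variables (Qp : fieldType) (vp : Qp -> int) (iQ : {rmorphism rat -> Qp}).
Hypothesis Qp_completion : is_completion (padic_val p) vp iQ.
Variables (C : closedFieldType) (i : {rmorphism Qp -> C}).

Let hv : is_valuation vp := completion_valuation Qp_completion.
Let p_neq0_Qp : p%:R != 0 :> Qp := padic_natr_neq0 iQ (prime_gt0 p_prime).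
Let v_p : vp p%:R = 1 := padic_val_p p_prime Qp_completion.
Local Notation O := (integers hv i).
Local Notation N := (nilp p hv i).

Variable z : nat -> C.
Hypothesis z_zero : z 0 = 1.
Hypothesis z_one : z 1 != 1.
Hypothesis z_expp : forall n, z n.+1 ^+ p = z n.

Definition in_level n (y : C) := exists f : {poly Qp}, y = (map_poly i f).[z n.+1].

Lemma in_level_le n n' y : (n <= n')%N -> in_level n y -> in_level n' y.
Proof.
move=> le [f ->]; exists (f \Po 'X^(p ^ (n' - n))).
rewrite map_comp_poly map_polyXn horner_comp hornerXn; congr (_.[_]).
have := zeta_exp_pn z_expp (n' - n) n.+1.
by rewrite addnS subnK.
Qed.

(** Minimality of [cyclo] makes f coprime to it; a Bezout relation evaluated at z_(n+1) provides the
    inverse. *)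
Lemma in_levelV n y : in_level n y -> in_level n y^-1.
Proof.
have [->|y0] := eqVneq y 0; first by rewrite invr0.
move=> [f hy].
have cop : coprimep f (cyclo q Qp n).
  rewrite /coprimep; have [g hg] := dvdpP _ _ (dvdp_gcdr f (cyclo q Qp n)).
  have : root (map_poly i (cyclo q Qp n)) (z n.+1).
    by rewrite map_cyclo; apply: root_cyclo.
  rewrite {1}hg rmorphM /= rootM => /orP[gz|dz]; last first.
    have [h hh] := dvdpP _ _ (dvdp_gcdl f (cyclo q Qp n)).
    by case/eqP: y0; rewrite hy hh rmorphM /= hornerM (rootP dz) mulr0.
  have := cyclo_minimal p_prime Qp_completion z_zero z_one z_expp gz.
  have g0 : g != 0.
    by apply: contraTneq (monic_neq0 (monic_cyclo q Qp n)) => g0; rewrite hg g0 mul0r eqxx.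
  have c0 : cyclo q Qp n != 0 by rewrite monic_neq0 ?monic_cyclo.
  rewrite {1}hg => /(dvdp_leq g0); rewrite size_mul //; last first.
    by apply: contraNneq c0 => d0; rewrite hg d0 mulr0.
  have : (0 < size (gcdp f (cyclo q Qp n)))%N.
    by rewrite size_poly_gt0; apply: contraNneq c0 => d0; rewrite hg d0 mulr0.
  have : (0 < size g)%N by rewrite size_poly_gt0.
  by move: (size _) (size _) => a b; lia.
have [[a b] /= hab] := Bezout_eq1_coprimepP _ _ cop.
exists a; apply: (mulIf y0); rewrite mulVf // [X in _ * X]hy -hornerM -rmorphM /=.
have -> : a * f = 1 - b * cyclo q Qp n by rewrite -hab addrK.
rewrite rmorphB rmorph1 rmorphM /= map_cyclo hornerD hornerN hornerM.
by rewrite (rootP (root_cyclo z_zero z_one z_expp n)) mulr0 subr0 hornerC.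
Qed.

Lemma in_levelB n x y : in_level n x -> in_level n y -> in_level n (x - y).
Proof. by move=> [f ->] [g ->]; exists (f - g); rewrite rmorphB hornerD hornerN. Qed.

Lemma in_levelM n x y : in_level n x -> in_level n y -> in_level n (x * y).
Proof. by move=> [f ->] [g ->]; exists (f * g); rewrite rmorphM hornerM. Qed.

Lemma cyclotomic_tower_level y n0 : in_cyclotomic_tower i p y ->
  exists2 n, (n0 <= n)%N & in_level n y.
Proof.
pose S : {pred C} := fun y => `[< exists n, in_level n y >].
move=> /(_ S) hS; suff /asboolP [n hn] : y \in S.
  exists (maxn n n0); first exact: leq_maxr.
  by apply: in_level_le hn; apply: leq_maxl.
apply: hS => [|t].
- split; first by apply/asboolP; exists 0%N, 1; rewrite rmorph1 hornerC.
  + move=> x t /asboolP [n hn] /asboolP [n' hn']; apply/asboolP; exists (maxn n n').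
    by apply: in_levelB; [apply: in_level_le hn|apply: in_level_le hn'];
      rewrite ?leq_maxl ?leq_maxr.
  + move=> x t /asboolP [n hn] /asboolP [n' hn']; apply/asboolP; exists (maxn n n').
    apply: in_levelM; first by apply: in_level_le hn; rewrite leq_maxl.
    by apply: in_levelV; apply: in_level_le hn'; rewrite leq_maxr.
- move=> [[a ->]|[n hn]]; apply/asboolP.
    by exists 0%N, a%:P; rewrite map_polyC hornerC.
  have [a ->] := prim_rootP (zeta_prim p_prime Qp_completion z_zero z_one z_expp n) hn.
  exists n, ('X^p ^+ a); rewrite rmorphXn /= map_polyXn horner_exp hornerXn.
  by rewrite z_expp.
Qed.

End CyclotomicNorm.

Section Conjugation.
Variables (F : fieldType) (C : closedFieldType) (i : {rmorphism F -> C}).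
Variables (E : fieldExtType F) (j : {rmorphism E -> C}).
Hypothesis j_F : forall a : F, j a%:A = i a.

Lemma horner_embed (g : {poly F}) x : (map_poly i g).[j x] = j (map_poly (in_alg E) g).[x].
Proof.
have -> : map_poly i g = map_poly j (map_poly (in_alg E) g).
  by rewrite -map_poly_comp; apply: eq_map_poly => a /=; rewrite j_F.
by rewrite horner_map.
Qed.

Variables (P : {poly F}) (t : C).
Hypotheses (P_monic : P \is monic) (P_root : root (map_poly i P) t).
Hypothesis P_minimal : forall g : {poly F}, root (map_poly i g) t -> P %| g.

Lemma dim_adjoin_minimal x : j x = t -> \dim <<1; x>> = (size P).-1.
Proof.
move=> jx; rewrite dim_Fadjoin dimv1 muln1.
have /polyOver1P [g hg] := minPolyOver 1 x.
have -> : adjoin_degree 1 x = (size g).-1.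
  by rewrite -(size_map_poly (in_alg E)) -hg size_minPoly.
have gP : g %| P.
  rewrite -(dvdp_map (in_alg E)) -hg.
  apply: minPoly_dvdp; first exact: alg_polyOver.
  by move: P_root; rewrite /root -jx horner_embed fmorph_eq0.
have Pg : P %| g.
  apply: P_minimal; rewrite /root -jx horner_embed fmorph_eq0 -hg.
  exact: root_minPoly.
by rewrite (eqp_size (_ : g %= P)) // /eqp gP.
Qed.

(** The values of f at the roots of P are the conjugates of u, each taken n times as often as in the
    norm. *)
Lemma norm_conjugates n (rs : seq C) (f : {poly F}) u :
    (0 < n)%N -> (size P).-1 = (n * \dim {:E})%N ->
    map_poly i P = \prod_(s <- rs) ('X - s%:P) -> j u = (map_poly i f).[t] ->
  i (field_norm u) ^+ n = \prod_(s <- rs) (map_poly i f).[s].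
Proof.
move=> n_gt0 sP hP hu; rewrite field_normE.
have [g [irr mg gu]] := min_poly_exists u.
apply: (det_rep_prod_roots (e := in_alg E) _ irr mg gu P_monic) => //.
- exact: reg_rep_scalar.
- by rewrite muln_gt0 n_gt0 adim_gt0.
apply: P_minimal; rewrite map_comp_poly /root horner_comp -hu horner_embed fmorph_eq0.
exact: gu.
Qed.

End Conjugation.

(** * Norm congruences through k, for every p *)

Section CyclotomicSubfield.
Variables (q : nat).
Let p := q.+1.
Hypothesis p_prime : prime p.
Variables (Qp : fieldType) (vp : Qp -> int) (iQ : {rmorphism rat -> Qp}).
Hypothesis Qp_completion : is_completion (padic_val p) vp iQ.
Variables (C : closedFieldType) (i : {rmorphism Qp -> C}).
Variables (K : fieldExtType Qp) (j : {rmorphism K -> C}).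
Hypothesis j_Qp : forall a : Qp, j a%:A = i a.
Variables (zeta : K) (zeta_prim_root : p.-primitive_root zeta).
Variables (m : nat) (k : {subfield K}).
Hypothesis k_cyclotomic : forall x : K, x \in k -> in_cyclotomic_tower i p (j x).
Hypothesis k_mu_p : (<<1; zeta>> <= k)%VS.
Hypothesis k_degree : \dim_<<1; zeta>> k = (p ^ m)%N.

Let hv : is_valuation vp := completion_valuation Qp_completion.
Let p_neq0_Qp : p%:R != 0 :> Qp := padic_natr_neq0 iQ (prime_gt0 p_prime).
Let v_p : vp p%:R = 1 := padic_val_p p_prime Qp_completion.
Local Notation O := (integers hv i).
Local Notation N := (nilp p hv i).
Let p_neq0_C : p%:R != 0 :> C := p_neq0 i p_neq0_Qp.

Variable z : nat -> C.
Hypothesis z_zero : z 0 = 1.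
Hypothesis z_zeta : z 1 = j zeta.
Hypothesis z_expp : forall n, z n.+1 ^+ p = z n.

Local Notation jk := (j \o @vsval _ _ k).

Lemma zeta_neq1_embed : z 1 != 1.
Proof.
rewrite z_zeta fmorph_eq1; apply: contraTneq zeta_prim_root => ->.
by apply/negP => /prim_order_dvd/(_ 1%N); rewrite expr1 eqxx dvdn1 eqn_leq leqNgt prime_gt1.
Qed.
Let z_one := zeta_neq1_embed.

Lemma z_one_prim : p.-primitive_root (z 1).
Proof. by rewrite z_zeta fmorph_primitive_root. Qed.

Lemma z_integer n : z n \in O.
Proof. exact: zeta_integer. Qed.

Lemma dim_cyclotomic_subfield : \dim {: subvs_of k} = (p ^ m * q)%N.
Proof.
have mk : map_poly i (cyclo q Qp 0) = cyclo q C 0 by rewrite map_cyclo.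
rewrite dimvf [LHS](_ : _ = \dim k) // (dim_sup_field k_mu_p) k_degree; congr (_ * _)%N.
rewrite (@dim_adjoin_minimal Qp C i K j j_Qp (cyclo q Qp 0) (z 1)) //.
- by rewrite size_cyclo // expn0 mul1n.
- by rewrite mk; apply: root_cyclo.
- by move=> g; apply: (cyclo_minimal p_prime Qp_completion z_zero z_one z_expp).
Qed.

Lemma jk_base a : jk a%:A = i a.
Proof. by rewrite /= algid1. Qed.

(** The primitive roots contribute the norm of u from Q_p(z_(n+1)), a field of degree p^(n-m) over
    k. *)
Lemma norm_level n u f : (m <= n)%N -> jk u = (map_poly i f).[z n.+1] ->
  root_prod q z n.+1 (map_poly i f) =
  i (field_norm u) ^+ (p ^ (n - m)) * root_prod q z n (map_poly i f).
Proof.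
move=> mn hu; rewrite /root_prod (prod_prim_roots z_expp (fun t => (map_poly i f).[t])).
congr (_ * _); symmetry.
apply: (norm_conjugates jk_base (monic_cyclo q Qp n)
  (cyclo_minimal p_prime Qp_completion z_zero z_one z_expp (n := n))) => //.
- by rewrite expn_gt0.
- by rewrite size_cyclo // dim_cyclotomic_subfield mulnA -expnD subnK.
- exact: (cyclo_factor p_prime Qp_completion i z_zero z_one z_expp n).
Qed.

Lemma integral_level n0 u : jk u \in O -> exists n f, [/\ (n0 <= n)%N,
  f \is a polyOver (val_pred hv) & jk u = (map_poly i f).[z n.+1]].
Proof.
move=> hu; have [n le_n [f hf]] := cyclotomic_tower_level p_prime Qp_completion
  z_zero z_one z_expp n0 (k_cyclotomic (subvsP u)).
move: (hu); rewrite /= hf => h.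
have [g hg hfg] := cyclo_integral p_prime z_zero z_one z_expp h.
by exists n, g; split=> //=; rewrite hf.
Qed.

Lemma polyOver_base f : f \is a polyOver (val_pred hv) -> map_poly i f \is a polyOver O.
Proof.
move=> /polyOverP hf; apply/polyOverP => l; rewrite coef_map integers_base.
exact: hf.
Qed.

Lemma frobenius_base f : f \is a polyOver (val_pred hv) ->
  forall l, exists2 e, e \in O & (map_poly i f)`_l ^+ p = (map_poly i f)`_l + p%:R * e.
Proof.
move=> /polyOverP hf l; have := padic_fermat p_prime Qp_completion (hf l).
rewrite -(@div_p_base _ _ hv _ i _ p_neq0_Qp v_p _ 1) expr1 => h.
exists (i (f`_l ^+ p - f`_l) / p%:R) => //.
by rewrite mulrCA divff // mulr1 coef_map rmorphB rmorphXn /= addrC subrK.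
Qed.

Let z_sub1_nilp n : z n.+1 - 1 \in N.
Proof. exact: zeta_sub1_nilp. Qed.

(** Dwork's congruence makes F_n(f) (N(u)^(p^(n-m)) - 1) divisible by p^(n+1), and F_n(f) is a unit:
    it is f(1) modulo p, and f(1) is u modulo the maximal ideal. *)
Lemma norm_unit_congr u : u != 0 -> jk u \in O -> jk u^-1 \in O ->
  val_ge vp (m + 2)%:Z (field_norm u ^+ p - 1).
Proof.
move=> u0 uO uVO.
have [n [f [le_n hf hu]]] := integral_level m.+1 uO.
pose fC := map_poly i f.
have fO : fC \is a polyOver O := polyOver_base hf.
have frob := frobenius_base hf.
have omO := z_integer 1.
have [e eO he] := root_prod_succ p_prime z_one_prim omO (erefl (z 1)) z_expp n fO frob.
have [e' e'O he'] := root_prod_congr_horner1 p_prime z_one_prim omO (erefl (z 1)) z_expp n fO frob.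
have f1 : val_ge vp 0 f.[1].
  by apply: (rpred_horner (S := val_pred hv)) => //; apply: rpred1.
have f1N : i f.[1] \notin N.
  have -> : i f.[1] = fC.[1] by rewrite -[1 in RHS](rmorph1 i) horner_map.
  apply/negP => h.
  have : fC.[z n.+1] - fC.[1] \in N.
    by apply: horner_congr_nilp; rewrite ?z_integer ?rpred1 ?z_sub1_nilp.
  move=> h'; have huN : jk u \in N.
    by rewrite hu -(subrK fC.[1] _.[_]); apply: (rpredD (S := N)).
  have := nilpM uVO huN.
  by rewrite -rmorphM mulVf // rmorph1 nilp1.
pose D := field_norm u ^+ (p ^ (n - m)) - 1.
have hD : val_ge vp n.+1%:Z D.
  apply: contraT => nD; have D0 : D != 0 by apply: contraNneq nD => ->; rewrite val_ge0.
  case/negP: f1N.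
  (* Were D less divisible, p^(n+1)/D would lie in the maximal ideal, and with it F_n(f) = e
     p^(n+1)/D and then f(1). *)
  have : i (p%:R ^+ n.+1 / D) \in N.
    rewrite nilp_base // val_ge_div // (val_ge_neq0 vp _ (expf_neq0 _ p_neq0_Qp)) valX // v_p.
    by rewrite mulr1 lez1D; move: nD; rewrite val_ge_neq0 // -ltNge.
  move=> hN; have := nilpM (eO : e \in O) hN; rewrite fmorph_div rmorphXn rmorph_nat.
  have iD0 : i D != 0 by rewrite fmorph_eq0.
  have -> : e * (p%:R ^+ n.+1 / i D) = root_prod q z n fC.
    apply: (mulIf iD0); rewrite mulrA divfK // [e * _]mulrC.
    apply/(addrI (root_prod q z n fC)); rewrite -he (norm_level _ hu) 1?ltnW //.
    by rewrite /D rmorphB rmorph1 rmorphXn; ring.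
  rewrite he' => h.
  have -> : i f.[1] = fC.[1] by rewrite -[1 in RHS](rmorph1 i) horner_map.
  have : e' * p%:R \in N by apply: nilpM => //; apply: nilp_p.
  by rewrite mulrC => h'; rewrite -(addrK (p%:R * e') _.[1]); apply: (rpredB (S := N)).
have Nge0 : val_ge vp 0 (field_norm u).
  have /(val_ge_le (_ : 0 <= n.+1%:Z)) /= := hD.
  move/(_ isT)/(val_geD hv (val_ge1 hv)); rewrite addrC subrK => h.
  have [-> |N0] := eqVneq (field_norm u) 0; first exact: val_ge0.
  move: h; rewrite !val_ge_neq0 ?expf_neq0 // valX //.
  by rewrite pmulr_rge0 // ltz_nat expn_gt0.
have N1 : val_ge vp 1 (field_norm u - 1).
  have hF t : val_ge vp 1 (field_norm u ^+ (p ^ t) - field_norm u).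
    elim: t => [|t IH]; first by rewrite expr1 subrr val_ge0.
    rewrite expnSr exprM -(subrK (field_norm u ^+ (p ^ t)) (_ ^+ p)) -addrA.
    by apply: (val_geD hv) => //; apply: (padic_fermat p_prime Qp_completion); apply: (val_geX hv).
  have -> : field_norm u - 1 = D - (field_norm u ^+ (p ^ (n - m)) - field_norm u).
    by rewrite /D; ring.
  by apply: (val_geB hv) => //; apply: val_ge_le hD.
(* Only n - m - 1 roots are extracted, from p^(n+1) to p^(m+2). Keeping one exponent p starts the
   extraction at N(u)^p = 1 modulo p^2, as p = 2 requires. *)
have sE : (n - m = (n - m.+1).+1)%N by rewrite subnS prednK // subn_gt0.
apply: (val_ge_exppn hv p_prime p_neq0_Qp v_p (b := 2) (s := n - m.+1)) => //.
  exact: val_ge2_expp.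
rewrite -exprM -expnS -sE; apply: val_ge_le hD.
by clear -le_n; lia.
Qed.

Let zk : subvs_of k := vsproj k zeta.

Lemma vsval_zk : vsval zk = zeta.
Proof. by rewrite vsprojK //; apply: (subvP k_mu_p); apply: memv_adjoin. Qed.

Lemma norm_principal_level c : jk c \in O -> exists2 n, (m <= n)%N &
  val_ge vp n.+2%:Z (field_norm (1 + p%:R * (1 - zk) * c) ^+ (p ^ (n - m)) - 1).
Proof.
move=> cO; have [n [f [mn hf hc]]] := integral_level m cO; exists n => //.
set u := 1 + _.
(* The factor 1 - X^(p^n) takes the value 1 - zeta at z_(n+1) and vanishes at every p^n-th root of
   unity, so F_n(g) = 1. *)
pose g : {poly Qp} := 1 + p%:R *: ((1 - 'X^(p ^ n)) * f).
have gE t : (map_poly i g).[t] = 1 + p%:R * ((1 - t ^+ (p ^ n)) * (map_poly i f).[t]).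
  rewrite rmorphD /= rmorph1 map_polyZ rmorph_nat rmorphM rmorphB /= rmorph1 map_polyXn.
  by rewrite hornerD hornerZ hornerM hornerD hornerN hornerXn !hornerC.
have hu : jk u = (map_poly i g).[z n.+1].
  rewrite gE -hc /u rmorphD rmorph1 !rmorphM rmorph_nat rmorphB rmorph1 -mulrA.
  by rewrite -[n.+1]addn1 (zeta_exp_pn z_expp) z_zeta /= vsval_zk.
have := norm_level mn hu; rewrite [X in _ * X]/root_prod big1 ?mulr1 => [|a _]; last first.
  by rewrite gE -exprM mulnC exprM (zeta_unity z_zero z_expp) expr1n subrr mul0r mulr0 addr0.
have [] := root_prod_congr1 p_prime z_one_prim (z_integer 1) (erefl (z 1)) z_expp n.+1
  (f := map_poly i g).
  exists (map_poly i ((1 - 'X^(p ^ n)) * f)).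
    apply: polyOver_base; apply: rpredM => //.
    by apply: rpredB; rewrite ?rpred1 ?polyOverXn.
  by rewrite /g rmorphD /= rmorph1 map_polyZ rmorph_nat.
move=> e eO -> he; rewrite -(@div_p_base _ _ hv _ i _ p_neq0_Qp v_p).
rewrite rmorphB rmorphXn rmorph1 -he addrC addKr mulrC mulKf ?expf_neq0 //.
Qed.

Variables (w : K -> int) (hw : is_valuation w) (e0 : nat).
Hypothesis he0 : is_ramification_index vp w (in_alg K) e0.

Let vsval_base a : @vsval _ _ k (in_alg (subvs_of k) a) = a%:A.
Proof. by rewrite /= algid1. Qed.

Lemma prod_1_add_integers (rs : seq C) s : s \in O -> (forall t, t \in rs -> t \in O) ->
  exists2 e, e \in O & \prod_(t <- rs) (1 + s * t) = 1 + s * e.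
Proof.
move=> sO; elim: rs => [|t rs IH] h.
  by exists 0; rewrite ?rpred0 // big_nil mulr0 addr0.
have [e eO he] := IH (fun r hr => h r (mem_behead (s := t :: rs) hr)).
have tO := h t (mem_head t rs).
exists (t + e + s * (t * e)); first by rewrite !rpredD ?rpredM.
by rewrite big_cons he; ring.
Qed.

Lemma rel_norm_integer x : val_ge w 0 x -> jk (rel_norm k x) \in O.
Proof.
move=> hx.
have [rs [h1 h2 h3]] := det_rep_1_add p_prime Qp_completion hw he0 j_Qp vsval_base
  (@rel_rep_scalar _ _ k) 1 (x - 1).
have hx1 : 1 + vsval (1 : subvs_of k) * (x - 1) = x by rewrite rmorph1 mul1r addrC subrK.
rewrite hx1 in h1; rewrite /rel_norm [X in X \in _]h1 big_seq; apply: rpred_prod => t trs.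
rewrite [X in X * _]rmorph1 mul1r; apply: (rpredD (S := O)); first exact: rpred1.
by apply: h2 => //; apply: (val_geB hw) => //; apply: val_ge1.
Qed.

Lemma rel_normV x : x != 0 -> rel_norm k x != 0 /\ (rel_norm k x)^-1 = rel_norm k x^-1.
Proof.
move=> x0; have h : rel_norm k x * rel_norm k x^-1 = 1.
  by rewrite -rel_normM mulfV // rel_norm1.
have u0 : rel_norm k x != 0.
  by apply: contra_eq_neq h => ->; rewrite mul0r eq_sym oner_neq0.
by split=> //; apply: (mulfI u0); rewrite h mulfV.
Qed.

Lemma norm_unit_expp x : x != 0 -> w x = 0 -> val_ge vp (m + 2)%:Z (field_norm x ^+ p - 1).
Proof.
move=> x0 wx; have [hx hxV] := unit_val_ge hw x0 wx.
have [u0 uV] := rel_normV x0.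
rewrite (field_norm_tower k); apply: norm_unit_congr => //.
  exact: rel_norm_integer.
by rewrite uV; apply: rel_norm_integer.
Qed.

(** Supplies the initial congruence, modulo p or modulo 4, under which [norm_principal] may extract
    roots. *)
Lemma norm_1_add_base (s : nat) y : val_ge w 0 y ->
  val_ge vp s%:Z (field_norm (1 + p%:R ^+ s * y) - 1).
Proof.
move=> hy; have e_b a : in_alg K (@idfun Qp a) = a%:A by [].
have [rs [h1 h2 _]] := det_rep_1_add p_prime Qp_completion hw he0 j_Qp e_b
  (@reg_rep_scalar Qp K) (p%:R ^+ s) y.
have jE a : (j \o in_alg K) a = i a by exact: j_Qp.
have pE : in_alg K (p%:R ^+ s) = p%:R ^+ s by rewrite rmorphXn rmorph_nat.
have pO : (j \o in_alg K) (p%:R ^+ s) \in O by rewrite rmorphXn rmorph_nat rpredX ?rpred_nat.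
have [e eO he] := prod_1_add_integers pO (h2 hy).
have hN : i (field_norm (1 + p%:R ^+ s * y)) = 1 + p%:R ^+ s * e.
  by rewrite -pE -jE [LHS]h1 he jE rmorphXn rmorph_nat.
rewrite -(@div_p_base _ _ hv _ i _ p_neq0_Qp v_p) rmorphB hN rmorph1 addrC addKr.
by rewrite mulrC mulKf ?expf_neq0.
Qed.

Lemma norm_principal c : val_ge w 0 c ->
  val_ge vp (m + 2)%:Z (field_norm (1 + p%:R * (1 - zeta) * c) - 1).
Proof.
move=> hc; pose s : subvs_of k := p%:R * (1 - zk).
have sE : vsval s = p%:R * (1 - zeta).
  by rewrite /s rmorphM rmorph_nat rmorphB rmorph1 -[in RHS]vsval_zk.
have p_neq0_K : p%:R != 0 :> K by apply: (natr_neq0 iQ); apply: prime_gt0.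
have zeta1 : 1 - zeta != 0.
  by rewrite subr_eq0 eq_sym -(fmorph_eq1 j) -z_zeta.
have s0 : s != 0.
  by apply: contra_neq (mulf_neq0 p_neq0_K zeta1) => s0; rewrite -sE s0 linear0.
have [rs [h1 h2 _]] := det_rep_1_add p_prime Qp_completion hw he0 j_Qp vsval_base
  (@rel_rep_scalar _ _ k) s c.
have sO : jk s \in O.
  have -> : jk s = p%:R * (1 - z 1).
    by rewrite [LHS](congr1 j sE) rmorphM rmorph_nat rmorphB rmorph1 z_zeta.
  by rewrite rpredM ?rpred_nat // (rpredB (S := O)) ?rpred1 // z_integer.
have [e eO he] := prod_1_add_integers sO (h2 hc).
rewrite he in h1.
pose c' := (rel_norm k (1 + vsval s * c) - 1) / s.
have c'E : rel_norm k (1 + vsval s * c) = 1 + s * c'.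
  by rewrite /c' mulrCA divff // mulr1 [RHS]addrC subrK.
have c'O : jk c' \in O.
  suff -> : jk c' = e by [].
  have js0 : jk s != 0 by rewrite fmorph_eq0.
  apply: (mulfI js0); apply: (addrI 1); rewrite -h1 -rmorphM.
  by rewrite -[X in X + _](rmorph1 jk) -rmorphD -c'E.
have [n mn hn] := norm_principal_level c'O.
rewrite -sE (field_norm_tower k) c'E.
(* For p = 2, zeta = -1 and p (1 - zeta) = 4, so the norm is already 1 modulo 4. *)
pose b : int := if p == 2%N then 2 else 1.
apply: (val_ge_exppn hv p_prime p_neq0_Qp v_p (b := b) (s := n - m)).
- by rewrite /b; case: eqP.
- by rewrite /b => ->.
- rewrite -c'E -field_norm_tower sE /b; case: eqP => p2.
  have zetaN : zeta = -1.
    have := prim_expr_order zeta_prim_root; rewrite p2 => /eqP.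
    by rewrite sqrf_eq1 -subr_eq0 -oppr_eq0 opprB (negPf zeta1) => /eqP.
  have -> : 1 - zeta = p%:R by rewrite zetaN opprK p2.
  by rewrite -expr2; apply: norm_1_add_base.
  by rewrite -mulrA -[p%:R]expr1; apply: (norm_1_add_base 1);
    apply: (val_geMl hw) => //; apply: (val_geB hw); rewrite ?(val_ge1 hw) //
      (val_ge_zeta hw p_prime zeta_prim_root 1).
- by apply: val_ge_le hn; clear -mn; lia.
Qed.

End CyclotomicSubfield.

Lemma map_dnorm (F C : fieldType) (i : {rmorphism F -> C}) (f : {poly F}) :
  map_poly i (dnorm f) = dnorm (map_poly i f).
Proof.
have -> : map_poly i (dnorm f) =
    (map_poly i (even_poly f) ^+ 2 - 'X * map_poly i (odd_poly f) ^+ 2) \Po ('X + 2).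
  rewrite map_comp_poly raddfB /= expr2 rmorphM [X in _ - X]rmorphM expr2 rmorphM -!expr2 /=.
  rewrite map_polyX; congr (_ \Po _).
  by rewrite rmorphD /= map_polyX rmorph_nat.
congr ((_ ^+ 2 - _ * _ ^+ 2) \Po _); apply/polyP => l.
  by rewrite coef_map !coef_even_poly coef_map.
by rewrite coef_map !coef_odd_poly coef_map.
Qed.

(** * Norms from Q_2^(m) to Q_2 *)

Section DyadicSubfield.
Variables (Qp : fieldType) (vp : Qp -> int) (iQ : {rmorphism rat -> Qp}).
Hypothesis Qp_completion : is_completion (padic_val 2) vp iQ.
Variables (C : closedFieldType) (i : {rmorphism Qp -> C}).
Variables (E : fieldExtType Qp) (j : {rmorphism E -> C}).
Hypothesis j_Qp : forall a : Qp, j a%:A = i a.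
Variables (m : nat) (theta : E).
Hypothesis theta_root : root (psi C m) (j theta).
Hypothesis dim_E : \dim {:E} = (2 ^ m)%N.

Let hv : is_valuation vp := completion_valuation Qp_completion.
Let two_neq0_Qp : 2 != 0 :> Qp := padic_natr_neq0 iQ (isT : 0 < 2)%N.
Let v_2 : vp 2 = 1 := padic_val_p (isT : prime 2) Qp_completion.
Local Notation O := (integers hv i).
Local Notation N := (nilp 2 hv i).

Let psi_root : root (map_poly i (psi Qp m)) (j theta).
Proof. by rewrite map_psi. Qed.

Let minimal (g : {poly Qp}) : root (map_poly i g) (j theta) -> psi Qp m %| g.
Proof. exact: (psi_minimal Qp_completion theta_root). Qed.

Lemma poly_theta u : exists f : {poly Qp}, j u = (map_poly i f).[j theta].
Proof.
have uT : u \in <<1; theta>>%VS.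
  suff -> : <<1; theta>>%VS = fullv by rewrite memvf.
  apply/eqP; rewrite -(dimv_leqif_eq (subvf _)) dim_E.
  rewrite (dim_adjoin_minimal j_Qp psi_root minimal (erefl _)).
  by rewrite (psi_monic_size Qp m).2.
have [f0 /polyOver1P [f ->] ->] := Fadjoin_polyP uT.
by exists f; rewrite horner_embed.
Qed.

Lemma integral_poly_theta u : j u \in O -> exists2 f : {poly Qp},
  f \is a polyOver (val_pred hv) & j u = (map_poly i f).[j theta].
Proof.
move=> hu; have [f hf] := poly_theta u; rewrite hf in hu *.
have [g hg hfg] := psi_integral theta_root hu.
by exists g.
Qed.

Lemma norm_theta u f : j u = (map_poly i f).[j theta] ->
  field_norm u = (iter m (@dnorm Qp) f).[0].
Proof.
move=> hu; have [rs [hrs hprod]] := prod_psi_roots C m.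
have [pm ps] := psi_monic_size Qp m.
have := norm_conjugates j_Qp pm minimal (n := 1) (rs := rs) isT _ _ hu.
rewrite map_psi ps dim_E mul1n expr1 => /(_ erefl hrs) hN.
apply: (fmorph_inj i); rewrite hN hprod -[RHS]horner_map rmorph0; congr (_.[_]).
by elim: m => [//|l IH] /=; rewrite map_dnorm IH.
Qed.

Lemma horner0_congr f : f \is a polyOver (val_pred hv) ->
  (map_poly i f).[j theta] - i f.[0] \in N.
Proof.
move=> hf; have -> : i f.[0] = (map_poly i f).[0].
  by rewrite -[0 in RHS](rmorph0 i) horner_map.
have tN := psi_root_nilp Qp_completion i theta_root.
apply: horner_congr_nilp => //.
- apply/polyOverP => l; rewrite coef_map integers_base; exact: (polyOverP hf).
- exact: nilp_integers tN.
- exact: rpred0.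
- by rewrite subr0.
Qed.

Lemma frobenius_2 c : c \in val_pred hv ->
  exists2 s, s \in val_pred hv & c ^+ 2 - c = 2 * s.
Proof.
move=> hc; exists ((c ^+ 2 - c) / 2); last by rewrite mulrCA divff // mulr1.
rewrite [_ \in _](val_ge_div hv _ _ two_neq0_Qp) v_2.
exact: (padic_fermat (isT : prime 2) Qp_completion hc).
Qed.

(** theta lies in the maximal ideal, so f(theta) being a unit forces f(0) to be odd; then
    [iter_dnorm_sqr] applies, and its factor g is a unit. *)
Lemma norm_unit_sqr_theta u : u != 0 -> j u \in O -> j u^-1 \in O ->
  val_ge vp (m + 3)%:Z (field_norm u ^+ 2 - 1).
Proof.
move=> u0 uO uVO; have [f hf hu] := integral_poly_theta uO.
rewrite (norm_theta hu).
have f0 : val_ge vp 0 f.[0] by apply: (rpred_horner (S := val_pred hv)) => //; apply: rpred0.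
have f0u : ~~ val_ge vp 1 f.[0].
  rewrite -(nilp_base hv i two_neq0_Qp v_2); apply/negP => h.
  have huN : j u \in N.
    by rewrite hu -(subrK (i f.[0]) _.[_]); apply: (rpredD (S := N)) => //; apply: horner0_congr.
  have := nilpM uVO huN; rewrite -rmorphM mulVf // rmorph1 nilp1 //.
have f01 : exists2 s, s \in val_pred hv & f.[0] - 1 = 2 * s.
  exists ((f.[0] - 1) / 2); last by rewrite mulrCA divff // mulr1.
  rewrite [_ \in _](val_ge_div hv _ _ two_neq0_Qp) v_2.
  have := padic_fermat (isT : prime 2) Qp_completion f0.
  have -> : f.[0] ^+ 2 - f.[0] = f.[0] * (f.[0] - 1) by ring.
  by move/(val_ge1M hv f0 (val_geB hv f0 (val_ge1 hv))); rewrite (negPf f0u).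
have [g [s [gO sO [s0 s0O hg] h]]] := iter_dnorm_sqr two_neq0_Qp frobenius_2 m hf f01.
have g1 : g != 0 /\ vp g = 0.
  apply: (not_val_ge1 (v := vp) gO); apply/negP => g1.
  have : val_ge vp 1 (1 : Qp).
    have -> : (1 : Qp) = g - 2 * s0 by rewrite -hg; ring.
    by apply: (val_geB hv) => //; apply: (val_geMr hv) => //; rewrite val_ge_neq0 // v_2.
  by rewrite val_ge_neq0 ?oner_neq0 // val1.
have [gn0 vg] := g1; have [_ gV] := unit_val_ge hv gn0 vg.
rewrite -(mulKf gn0 (_ - 1)) h; apply: (val_geMl hv) => //; apply: (val_geMr hv) => //.
by rewrite val_ge_neq0 ?expf_neq0 // valX // v_2 mulr1 addn3.
Qed.

Lemma norm_1_add4_theta y : j y \in N ->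
  val_ge vp (m + 3)%:Z (field_norm (1 + 4 * y) - 1).
Proof.
move=> yN; have [f hf hy] := integral_poly_theta (nilp_integers two_neq0_Qp v_2 yN).
have f0 : exists2 s, s \in val_pred hv & f.[0] = 2 * s.
  exists (f.[0] / 2); last by rewrite mulrCA divff // mulr1.
  rewrite [_ \in _](val_ge_div hv _ _ two_neq0_Qp) v_2.
  rewrite -(nilp_base hv i two_neq0_Qp v_2).
  have -> : i f.[0] = j y - ((map_poly i f).[j theta] - i f.[0]) by rewrite -hy opprB addrC subrK.
  by apply: (rpredB (S := N)) => //; apply: horner0_congr.
have hu : j (1 + 4 * y) = (map_poly i (1 + 2 ^+ 2 *: f)).[j theta].
  rewrite rmorphD rmorph1 rmorphM rmorph_nat hy rmorphD /= rmorph1 map_polyZ rmorphXn rmorph_nat.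
  by rewrite hornerD hornerZ hornerC -natrX.
rewrite (norm_theta hu).
have [h hO [[s sO hs] ->]] := iter_dnorm_1_add4 two_neq0_Qp m hf f0.
rewrite hornerD hornerZ hornerC hs addrC addKr mulrA -exprSr.
apply: (val_geMr hv) => //.
by rewrite val_ge_neq0 ?expf_neq0 // valX // v_2 mulr1 addn3.
Qed.

End DyadicSubfield.

(** * Even ramification *)

(** For x a primitive root of unity of order 2^(m+2), x + x^-1 is real since x^-1 is the conjugate
    of x, and [psi] maps it to y + y^-1 with y = x^(2^m), which is 0 as y^2 = -1. *)
Lemma layer_generator (F C : fieldType) (i : F -> C) (iota : {rmorphism algC -> C}) m :
  exists y, in_layer i iota m y /\ root (psi C m) y.
Proof.
have n0 : (0 < 2 ^ m.+2)%N by rewrite expn_gt0.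
have [x xP] := C_prim_root_exists n0.
have x0 : x != 0 by rewrite (prim_root_eq0 xP) -lt0n.
have xN : x^-1 = x^*.
  rewrite invC_norm; suff -> : `|x| = 1 by rewrite expr1n invr1 mul1r.
  by apply/eqP; rewrite -(@pexpr_eq1 _ _ (2 ^ m.+2)) // -normrX (prim_expr_order xP) normr1.
exists (iota (x + x^-1)); split.
  move=> S _; apply; right; exists (x + x^-1) => //; split.
    move=> T [T1 TB TV] hT.
    have xT : x \in T.
      apply: hT; rewrite [(4 * _)%N](_ : _ = 2 ^ m.+2)%N ?(prim_expr_order xP) //.
      by rewrite !expnS mulnA.
    have T0 : 0 \in T by rewrite -(subrr 1) TB.
    rewrite -[x^-1]opprK TB // -[x^-1]mul1r -[- _]add0r TB //.
    exact: TV.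
  by rewrite CrealE xN rmorphD /= conjCK addrC.
rewrite /root rmorphD fmorphV horner_psi_add_inv ?fmorph_eq0 //.
set y := iota x ^+ _; have y2 : y ^+ 2 = -1.
  have yP : (2 ^ m.+2).-primitive_root (iota x) by rewrite fmorph_primitive_root.
  have y4 : (y ^+ 2) ^+ 2 = 1.
    by rewrite /y -!exprM [X in _ ^+ X](_ : _ = 2 ^ m.+2)%N ?(prim_expr_order yP) // !expnSr ?mulnA.
  move/eqP: y4; rewrite sqrf_eq1 => /orP[/eqP y21|/eqP //].
  have := prim_order_dvd yP (2 ^ m * 2); rewrite exprM -/y y21 eqxx => /dvdn_leq.
  by rewrite -expnSr expn_gt0 leq_exp2l // ltnn => /(_ isT).
have y0 : y != 0 by rewrite expf_neq0 // fmorph_eq0.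
apply/eqP; apply: (mulIf y0); rewrite mulrDl mulVf // -expr2 y2 mul0r addNr //.
Qed.

Section EvenRamification.
Variables (Qp : fieldType) (vp : Qp -> int) (iQ : {rmorphism rat -> Qp}).
Hypothesis Qp_completion : is_completion (padic_val 2) vp iQ.
Variables (C : closedFieldType) (i : {rmorphism Qp -> C}).
Variables (K : fieldExtType Qp) (w : K -> int) (hw : is_valuation w) (e0 : nat).
Hypothesis he0 : is_ramification_index vp w (in_alg K) e0.
Variables (j : {rmorphism K -> C}) (j_Qp : forall a : Qp, j a%:A = i a).
Variables (k : {subfield K}) (u : subvs_of k -> int) (e : nat).
Hypothesis hu : is_valuation u.
Hypothesis he : is_ramification_index u w vsval e.
Hypothesis e_even : ~~ odd e.

Let hv : is_valuation vp := completion_valuation Qp_completion.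
Let two_neq0_Qp : 2 != 0 :> Qp := padic_natr_neq0 iQ (isT : (0 < 2)%N).
Let v_2 : vp 2 = 1 := padic_val_p (isT : prime 2) Qp_completion.
Let w_2 : val_ge w 1 2 := val_ge1_p (isT : prime 2) Qp_completion he0.
Local Notation O := (integers hv i).
Local Notation N := (nilp 2 hv i).
Local Notation jk := (j \o @vsval _ _ k).

Lemma prod_1_add_nilp (rs : seq C) s : s \in O -> (forall t, t \in rs -> t \in N) ->
  exists2 d, d \in N & \prod_(t <- rs) (1 + s * t) = 1 + s * d.
Proof.
move=> sO; elim: rs => [|t rs IH] h.
  by exists 0; rewrite ?(rpred0 N) // big_nil mulr0 addr0.
have [d dN hd] := IH (fun r hr => h r (mem_behead (s := t :: rs) hr)).
have tN := h t (mem_head t rs).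
exists (t + d + s * (t * d)); last by rewrite big_cons hd; ring.
apply: (rpredD (S := N)); first exact: (rpredD (S := N)).
by apply: nilpM => //; apply: nilpM => //; apply: nilp_integers tN.
Qed.

(** The term linear in s is the sum of the t^2: the square of the sum minus twice the second
    symmetric function d. *)
Lemma prod_1_add_sqr_nilp (rs : seq C) s : s \in O -> (forall t, t \in rs -> t \in N) ->
  exists d d', [/\ d \in N, d' \in N &
    \prod_(t <- rs) (1 + s * t ^+ 2) =
      1 + s * ((\sum_(t <- rs) t) ^+ 2 - 2 * d) + s ^+ 2 * d'].
Proof.
move=> sO; elim: rs => [|t rs IH] h.
  exists 0, 0; split; [exact: (rpred0 N)|exact: (rpred0 N)|].
  by rewrite !big_nil expr0n !mulr0 subr0 mulr0 !addr0.
have [d [d' [dN d'N hd]]] := IH (fun r hr => h r (mem_behead (s := t :: rs) hr)).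
have tN := h t (mem_head t rs).
have TN : \sum_(r <- rs) r \in N.
  rewrite big_seq; apply: (rpred_sum (S := N)) => r hr; apply: h.
  by rewrite inE hr orbT.
have tO := nilp_integers two_neq0_Qp v_2 tN.
have TO := nilp_integers two_neq0_Qp v_2 TN.
have dO := nilp_integers two_neq0_Qp v_2 dN.
set T := \sum_(r <- rs) r in TN TO hd.
exists (d + t * T), (d' + (T ^+ 2 - 2 * d + s * d') * t * t); split.
- by apply: (rpredD (S := N)) => //; apply: nilpM.
- apply: (rpredD (S := N)) => //; apply: nilpM => //; apply: rpredM => //.
  apply: rpredD; last by apply: rpredM => //; exact: nilp_integers d'N.
  by apply: rpredB; rewrite ?rpredX ?rpredM ?rpred_nat.
by rewrite !big_cons hd -/T; ring.
Qed.

Let e_gt0 : (0 < e)%N := he.1.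

(** For e even, pi0^e is a square, and the unit varpi/pi0^e is a square t^2 modulo the maximal ideal
    by [residue_perfect]. *)
Lemma dyadic_uniformizer : exists (varpi : subvs_of k) (rho : K),
  [/\ varpi != 0, u varpi = 1, val_ge w 1 rho & val_ge w e.+1%:Z (vsval varpi - rho ^+ 2)].
Proof.
have [varpi varpi0 uvarpi] := valuation_normalized hu.
have [pi0 pi_neq0 wpi] := valuation_normalized hw.
have eE : e = (e./2 * 2)%N by rewrite muln2 -[LHS]odd_double_half (negPf e_even).
have vv0 : vsval varpi != 0 by rewrite fmorph_eq0.
have pe0 : pi0 ^+ e != 0 by rewrite expf_neq0.
have h0 : val_ge w 0 (vsval varpi / pi0 ^+ e).
  rewrite (val_ge_div hw) // val_ge_neq0 // (valX hw) // wpi (he.2 _ varpi0) uvarpi.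
  by rewrite add0r.
have [t ht htt] := residue_perfect (isT : prime 2) Qp_completion hw he0 h0.
exists varpi, (pi0 ^+ e./2 * t); split=> //.
  apply: (val_geMr hw) => //; rewrite val_ge_neq0 ?expf_neq0 // (valX hw) // wpi mulr1.
  by rewrite lez_nat half_gt0; case: (e) e_even e_gt0 => [|[]].
have -> : vsval varpi - (pi0 ^+ e./2 * t) ^+ 2 =
    pi0 ^+ e * (vsval varpi / pi0 ^+ e - t ^+ 2).
  by rewrite mulrBr mulrCA divff // mulr1 exprMn -exprM -eE.
have -> : e.+1%:Z = e%:Z + 1 by rewrite -addn1 PoszD.
by apply: (val_geM hw) => //; rewrite val_ge_neq0 // (valX hw) // wpi mulr1.
Qed.

Lemma val_ge1_sub x : val_ge w 1 (vsval x) -> val_ge u 1 x.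
Proof.
have [->|x0] := eqVneq x 0; first by move=> _; exact: val_ge0.
rewrite !val_ge_neq0 ?fmorph_eq0 ?x0 // he.2 // -!gtz0_ge1.
by rewrite pmulr_rgt0.
Qed.

Lemma sub_integer x : val_ge u 0 x -> jk x \in O.
Proof.
move=> hx; apply: (embed_integer (isT : prime 2) Qp_completion hw he0 j_Qp).
move: hx; have [->|x0] := eqVneq x 0; first by move=> _; rewrite linear0 val_ge0.
rewrite !val_ge_neq0 ?fmorph_eq0 ?x0 // he.2 //.
by rewrite pmulr_rge0.
Qed.

Lemma sub_nilp x : val_ge u 1 x -> jk x \in N.
Proof.
move=> hx; apply: (embed_nilp (isT : prime 2) Qp_completion hw he0 j_Qp).
move: hx; have [->|x0] := eqVneq x 0; first by move=> _; rewrite linear0 val_ge0.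
rewrite !val_ge_neq0 ?fmorph_eq0 ?x0 // he.2 // -!gtz0_ge1.
by rewrite pmulr_rgt0.
Qed.

Let vsval_base a : @vsval _ _ k (in_alg (subvs_of k) a) = a%:A.
Proof. by rewrite /= algid1. Qed.

Lemma rel_norm_1_add4_nilp x : val_ge w 1 x ->
  exists2 y, jk y \in N & rel_norm k (1 + 4 * x) = 1 + 4 * y.
Proof.
move=> hx; have [rs [h1 _ h2]] := det_rep_1_add (isT : prime 2) Qp_completion hw he0 j_Qp
  vsval_base (@rel_rep_scalar _ _ k) 4 x.
have j4 : jk 4 = 4 by rewrite rmorph_nat.
have v4 : vsval (4 : subvs_of k) = 4 by rewrite rmorph_nat.
have hN : jk (rel_norm k (1 + 4 * x)) = \prod_(t <- rs) (1 + 4 * t).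
  by rewrite -v4 -j4 [LHS]h1.
have [d dN hd] := prod_1_add_nilp (rpred_nat _ 4 : 4 \in O) (h2 hx).
have four_neq0 : 4 != 0 :> subvs_of k by apply: (natr_neq0 iQ (subvs_of k)).
exists ((rel_norm k (1 + 4 * x) - 1) / 4); last first.
  by rewrite mulrCA divff // mulr1 [RHS]addrC subrK.
have -> : jk ((rel_norm k (1 + 4 * x) - 1) / 4) = (jk (rel_norm k (1 + 4 * x)) - 1) / 4.
  by rewrite fmorph_div rmorphB rmorph1 rmorph_nat.
rewrite hN hd addrC addKr mulrC mulKf //.
by rewrite -j4 fmorph_eq0.
Qed.

(** With T the trace of x to k, y = T^2/varpi - (2/varpi) d + (4/varpi^2) d'. The first term has
    positive valuation because T has; 2/varpi and 4/varpi^2 are integral because u(2) >= 1. *)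
Lemma rel_norm_1_add4_sqr varpi x : varpi != 0 -> u varpi = 1 -> val_ge w 1 x ->
  exists2 y, jk y \in N & rel_norm k (1 + vsval (4 / varpi) * x ^+ 2) = 1 + 4 * y.
Proof.
move=> varpi0 uvarpi hx.
have [rs [h1 h2 h3]] := det_rep_1_add_sqr (isT : prime 2) Qp_completion hw he0 j_Qp
  vsval_base (@rel_rep_scalar _ _ k) (4 / varpi) x.
have u2 : val_ge u 1 2 by apply: val_ge1_sub; rewrite rmorph_nat.
have u4 : val_ge u 2 4.
  by have := val_geM hu u2 u2; rewrite -natrM.
have sO : jk (4 / varpi) \in O.
  apply: sub_integer; rewrite (val_ge_div hu) // uvarpi.
  exact: val_ge_le u4.
have [d [d' [dN d'N hd]]] := prod_1_add_sqr_nilp sO (h3 hx).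
have four_neq0 : 4 != 0 :> subvs_of k by apply: (natr_neq0 iQ (subvs_of k)).
set T := \tr (rel_rep k x) in h2.
have TN : jk T \in N.
  rewrite h2 big_seq; apply: (rpred_sum (S := N)) => t ht; exact: (h3 hx).
have uT : val_ge u 1 T.
  apply: val_ge1_sub; exact: (nilp_embed (isT : prime 2) hw he0 j_Qp TN).
rewrite -h2 in hd.
set n := rel_norm k _.
have nE : jk n = 1 + jk (4 / varpi) * (jk T ^+ 2 - 2 * d) + jk (4 / varpi) ^+ 2 * d'.
  by rewrite -hd -h1.
exists ((n - 1) / 4); last by rewrite mulrCA divff // mulr1 [RHS]addrC subrK.
have j40 : jk 4 != 0 by rewrite fmorph_eq0.
have jv0 : jk varpi != 0 by rewrite fmorph_eq0.
have -> : jk ((n - 1) / 4) =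
    jk (T ^+ 2 / varpi) - jk (2 / varpi) * d + jk (4 / varpi ^+ 2) * d'.
  have jV (a b : subvs_of k) : jk (a / b) = jk a / jk b by exact: fmorph_div.
  have jnat l : jk l%:R = l%:R by exact: rmorph_nat.
  have jX a l : jk (a ^+ l) = jk a ^+ l by exact: rmorphXn.
  have -> : jk ((n - 1) / 4) = (jk n - 1) / 4 by rewrite jV jnat [jk (n - 1)]rmorphB rmorph1.
  rewrite nE !jV !jX !jnat; rewrite jnat in j40.
  by field; apply/andP; split.
have uinv a n' : val_ge u n' a -> val_ge u (n' - 1) (a / varpi).
  by move=> ha; rewrite (val_ge_div hu) // uvarpi subrK.
apply: (rpredD (S := N)); first apply: (rpredB (S := N)).
- apply: sub_nilp; have := uinv _ _ (val_geXn hu 2 uT); by [].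
- by apply: nilpM => //; apply: sub_integer; have := uinv _ _ u2; by [].
- apply: nilpM => //; apply: sub_integer.
  by rewrite expr2 invfM mulrA; have := uinv _ _ (uinv _ _ u4).
Qed.

Lemma val_ge_1_addV y : val_ge w 1 y -> 1 + y != 0 /\ val_ge w 0 (1 + y)^-1.
Proof.
move=> hy; have h0 : val_ge w 0 (1 + y).
  by apply: (val_geD hw); [exact: val_ge1|exact: val_ge_le hy].
have h1 : ~~ val_ge w 1 (1 + y).
  apply/negP => h; have := val_geB hw h hy.
  by rewrite addrK val_ge_neq0 ?oner_neq0 // val1.
have [n0 wy] := not_val_ge1 h0 h1.
by split=> //; have [] := unit_val_ge hw n0 wy.
Qed.

(** Modulo the maximal ideal, c is a square b^2 and hence also r = (rho b)^2/varpi. So 1 + 4 c = (1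
    + 4 r)(1 + 4 z) with z in the maximal ideal, and 4 r = (4/varpi)(rho b)^2 falls under
    [rel_norm_1_add4_sqr]. *)
Lemma rel_norm_1_add4 c : val_ge w 0 c -> exists y y',
  [/\ jk y \in N, jk y' \in N & rel_norm k (1 + 4 * c) = (1 + 4 * y) * (1 + 4 * y')].
Proof.
move=> hc; have [varpi [rho [varpi0 uvarpi hrho hvr]]] := dyadic_uniformizer.
have [b hb hcb] := residue_perfect (isT : prime 2) Qp_completion hw he0 hc.
have vv0 : vsval varpi != 0 by rewrite fmorph_eq0.
pose r := (rho * b) ^+ 2 / vsval varpi.
have hbr : val_ge w 1 (b ^+ 2 - r).
  have -> : b ^+ 2 - r = b ^+ 2 * (vsval varpi - rho ^+ 2) / vsval varpi.
    by rewrite /r exprMn; field.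
  rewrite (val_ge_div hw) // (he.2 _ varpi0) uvarpi mulr1 -PoszD add1n.
  by apply: (val_geMl hw) => //; apply: (val_geX hw).
have hr : val_ge w 0 r.
  have -> : r = b ^+ 2 - (b ^+ 2 - r) by ring.
  by apply: (val_geB hw); [apply: (val_geX hw)|apply: val_ge_le hbr].
have h4 : val_ge w 1 4.
  have -> : 4 = 2 * 2 :> K by rewrite -natrM.
  by apply: (val_geMl hw) => //; apply: val_ge_le w_2.
have [d0 dV] := val_ge_1_addV (val_geMr hw h4 hr).
have [y yN hy] := rel_norm_1_add4_sqr varpi0 uvarpi (val_geMr hw hrho hb).
have hz : val_ge w 1 ((c - r) / (1 + 4 * r)).
  apply: (val_geMr hw) => //.
  have -> : c - r = (c - b ^+ 2) + (b ^+ 2 - r) by ring.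
  exact: (val_geD hw).
have [y' y'N hy'] := rel_norm_1_add4_nilp hz.
exists y, y'; split=> //; rewrite -hy -hy' -rel_normM; congr (rel_norm k _).
have -> : vsval (4 / varpi) * (rho * b) ^+ 2 = 4 * r.
  by rewrite /r fmorph_div rmorph_nat mulrAC mulrA.
by field.
Qed.

End EvenRamification.

(** * Assembly of the congruences *)

Lemma congr_mod_expn (F : fieldType) (v : F -> int) (p n : nat) (x : F) :
    is_valuation v -> p%:R != 0 :> F -> v p%:R = 1 -> val_ge v n%:Z (x - 1) ->
  congr_mod v (p ^ n)%:R x 1.
Proof.
move=> hv p0 vp hx; have pn0 : (p ^ n)%:R != 0 :> F by rewrite natrX expf_neq0.
exists ((x - 1) / (p ^ n)%:R); last by rewrite mulrCA divff // mulr1.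
rewrite [_ \in _](val_ge_div hv) // natrX (valX hv) // vp mulr1 add0r.
exact: hx.
Qed.

Lemma val_ge_mul1 (F : fieldType) (v : F -> int) (n : nat) (x y : F) : is_valuation v ->
  val_ge v n%:Z (x - 1) -> val_ge v n%:Z (y - 1) -> val_ge v n%:Z (x * y - 1).
Proof.
move=> hv hx hy; have -> : x * y - 1 = (x - 1) * (y - 1) + (x - 1) + (y - 1) by ring.
apply: (val_geD hv) => //; apply: (val_geD hv) => //; apply: (val_geMr hv) => //.
exact: val_ge_le hy.
Qed.

Theorem theorem1
  (p : nat) (p_prime : prime p)
  (* the field Q_p, and an algebraic closure of it *)
  (Qp : fieldType) (vp : Qp -> int) (iQ : {rmorphism rat -> Qp})
  (Qp_completion : is_completion (padic_val p) vp iQ)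
  (Qpbar : closedFieldType) (i : {rmorphism Qp -> Qpbar})
  (Qpbar_algebraic : forall y : Qpbar, algebraicOver i y)
  (* the number field K and its place v above p *)
  (K : fieldExtType rat) (v : K -> int)
  (v_valuation : is_valuation v) (v_above_p : 0 < v p%:R)
  (* the completion K_v, as an extension of Q_p inside the algebraic closure *)
  (Kv : fieldExtType Qp) (w : Kv -> int) (iK : {rmorphism K -> Kv})
  (Kv_completion : is_completion v w iK)
  (Kv_over_Qp : exists e : nat, is_ramification_index vp w (in_alg Kv) e)
  (j : {rmorphism Kv -> Qpbar}) (j_Qp : forall a : Qp, j a%:A = i a)
  (* K_v contains mu_p and k, where Q_p(mu_p) <= k <= Q_p(mu_{p^oo}) *)
  (zeta : Kv) (zeta_prim : p.-primitive_root zeta)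
  (m : nat) (k : {subfield Kv})
  (k_cyclotomic : forall x : Kv, x \in k -> in_cyclotomic_tower i p (j x))
  (k_mu_p : (<<1; zeta>> <= k)%VS) (k_degree : \dim_<<1; zeta>> k = (p ^ m)%N)
  (* the local unit alpha and the Kummer extension L = K_v(alpha^(1/p)) *)
  (alpha : Kv) (alpha_unit : is_local_unit w alpha)
  (L : fieldExtType Kv) (beta : L) (beta_root : beta ^+ p = alpha%:A)
  (L_gen : <<1; beta>>%VS = {:L}%VS) (L_unramified : is_unramified w L) :
  congr_mod vp (p ^ (m + 2))%:R (field_norm alpha) 1
  /\
  (p = 2%N ->
   forall iota : {rmorphism algC -> Qpbar},
   (* k = Q_2^(m) as subfields of the algebraic closure *)
   (forall y : Qpbar,
      (exists2 x : Kv, x \in k & j x = y) <-> in_layer i iota m y) ->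
   (exists b : Kv, alpha = b ^+ 2)
   \/ (exists (u : subvs_of k -> int) (e : nat),
         [/\ is_valuation u, is_ramification_index u w vsval e & ~~ odd e]) ->
   congr_mod vp (4 * 2 ^ (m + 1))%:R (field_norm alpha) 1).

Proof.
case: p p_prime Qp_completion v_above_p k_cyclotomic zeta_prim k_degree beta_root => // q.
move=> q_prime QpC _ k_cyc zetaP k_deg beta_root'.
have [e0 he0] := Kv_over_Qp.
have hw := completion_valuation Kv_completion.
have hv := completion_valuation QpC.
have p_neq0 : q.+1%:R != 0 :> Qp := padic_natr_neq0 iQ (prime_gt0 q_prime).
have v_p := padic_val_p q_prime QpC.
have p_neq0_K : q.+1%:R != 0 :> Kv by apply: (natr_neq0 iQ).
have [z [z0 z1 zp]] := power_tower (prime_gt0 q_prime)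
  (etrans (esym (rmorphXn j _ zeta)) (etrans (congr1 j (prim_expr_order zetaP)) (rmorph1 j))).
have [x [c [x0 wx hc alphaE]]] := primary_decomposition q_prime hw zetaP
  (val_ge1_p q_prime QpC he0) p_neq0_K (residue_perfect q_prime QpC hw he0)
  alpha_unit beta_root' L_unramified.
have normE : field_norm alpha = field_norm x ^+ q.+1 *
    field_norm (1 + q.+1%:R * (1 - zeta) * c).
  by rewrite alphaE field_normM field_normX.
split.
  apply: congr_mod_expn => //; rewrite normE; apply: val_ge_mul1 => //.
    exact: (norm_unit_expp q_prime QpC j_Qp zetaP k_cyc k_mu_p k_deg z0 z1 zp hw he0).
  exact: (norm_principal q_prime QpC j_Qp zetaP k_cyc k_mu_p k_deg z0 z1 zp hw he0).
case=> q1; subst q => iota k_layer ha.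
(* The hypothesis that k is Q_2^(m) is used through a root of [psi Qpbar m] in k, of full degree
   2^m. *)
have [y [y_layer y_root]] := layer_generator i iota m.
have [t tk jt] := (k_layer y).2 y_layer.
pose theta := vsproj k t.
have theta_root : root (psi Qpbar m) ((j \o vsval) theta).
  by rewrite /= vsprojK // jt.
have dim_k : \dim {: subvs_of k} = (2 ^ m)%N.
  by rewrite (dim_cyclotomic_subfield q_prime QpC j_Qp zetaP k_mu_p k_deg z0 z1 zp) muln1.
have jk_Qp a : (j \o @vsval _ _ k) a%:A = i a by rewrite /= algid1.
have norm_unit b : b != 0 -> w b = 0 -> val_ge vp (m + 3)%:Z (field_norm b ^+ 2 - 1).
  move=> b0 wb; have [hb hbV] := unit_val_ge hw b0 wb.
  have [u0 uV] := rel_normV k b0.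
  rewrite (field_norm_tower k).
  apply: (norm_unit_sqr_theta (Qp_completion := QpC) jk_Qp theta_root dim_k) => //.
    exact: (rel_norm_integer q_prime QpC j_Qp k hw he0).
  by rewrite uV; exact: (rel_norm_integer q_prime QpC j_Qp k hw he0).
have -> : (4 * 2 ^ (m + 1) = 2 ^ (m + 3))%N by rewrite !addnS addn0 !expnS !mulnA.
apply: congr_mod_expn => //; case: ha => [[b alphab]|[u [e [hu he e_even]]]].
  have b0 : b != 0 by apply: contra_neq alpha_unit.1 => b0; rewrite alphab b0 expr0n.
  rewrite alphab field_normX; apply: norm_unit => //.
  by have := alpha_unit.2; rewrite alphab (valX hw) // => /eqP; rewrite mulf_eq0 => /orP[|/eqP].
rewrite normE; apply: val_ge_mul1 => //; first exact: norm_unit.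
(* A primitive square root of unity is -1, so the second factor of alpha is 1 + 4 c. *)
have -> : 1 - zeta = 2.
  have /eqP := prim_expr_order zetaP.
  rewrite sqrf_eq1 => /orP[/eqP zeta1|/eqP ->]; last by rewrite opprK.
  by have := prim_order_dvd zetaP 1; rewrite zeta1 expr1 eqxx.
have -> : 2 * 2 * c = 4 * c by rewrite -natrM.
have [y1 [y2 [hy1 hy2 hyE]]] := rel_norm_1_add4 QpC hw he0 j_Qp hu he e_even hc.
rewrite (field_norm_tower k) hyE field_normM; apply: val_ge_mul1 => //.
  exact: (norm_1_add4_theta jk_Qp theta_root dim_k hy1).
exact: (norm_1_add4_theta jk_Qp theta_root dim_k hy2).
Qed.
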